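(* Let $T>0$, let $k,d,m$ be positive integers and $\mathcal J=\{1,\dots,m\}$. Let $b:[0,T]\times\mathbb R^k\to\mathbb R^k$ and $\sigma:[0,T]\times\mathbb R^k\to\mathbb R^{k\times d}$ be jointly continuous with $|b(t,x)|+|\sigma(t,x)|\le C(1+|x|)$ and $|b(t,x)-b(t,x')|+|\sigma(t,x)-\sigma(t,x')|\le C|x-x'|$ for some constant $C\ge 0$ and all $t\in[0,T]$, $x,x'\in\mathbb R^k$. Assume that for every $i\in\mathcal J$ the function $f_i:[0,T]\times\mathbb R^{k}\times\mathbb R^m\times\mathbb R^d\to\mathbb R$, $(t,x,y^1,\dots,y^m,z)\mapsto f_i(t,x,y^1,\dots,y^m,z)$, satisfies: (1) $(t,x)\mapsto f_i(t,x,y^1,\dots,y^m,z)$ is continuous uniformly with respect to $(y^1,\dots,y^m,z)$; (2) for some $C\ge0$ and all arguments, $|f_i(t,x,y^1,\dots,y^m,z)-f_i(t,x,\bar y^1,\dots,\bar y^m,\bar z)|\le C(|y^1-\bar y^1|+\dots+|y^m-\bar y^m|+|z-\bar z|)$; (3) $(t,x)\mapsto f_i(t,x,0,\dots,0)$ is Borel measurable and of polynomial growth; (4) for every $l\in\mathcal J\setminus\{i\}$, $y^l\mapsto f_i(t,x,y^1,\dots,y^m,z)$ is non-decreasing when all other arguments are fixed. Assume that for all $i\ne j$ in $\mathcal J$ the function $g_{ij}:[0,T]\times\mathbb R^k\to\mathbb R$ is continuous, non-negative and of polynomial growth, and that for every $(t,x)\in[0,T]\times\mathbb R^k$ and every finite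 sequence $i_1,\dots,i_N\in\mathcal J$ with $N\ge3$, $i_1=i_N$ and $\mathrm{card}\{i_1,\dots,i_N\}=N-1$ one has $g_{i_1i_2}(t,x)+\dots+g_{i_{N-1}i_N}(t,x)>0$. Assume that every $h_i:\mathbb R^k\to\mathbb R$ is continuous, of polynomial growth, and $h_i(x)\ge\max_{j\in\mathcal J\setminus\{i\}}(h_j(x)-g_{ij}(T,x))$ for all $x\in\mathbb R^k$. Then the viscosity solution of the system: for all $i\in\mathcal J$, $$\min\Big\{v_i(t,x)-\max_{j\in\mathcal J\setminus\{i\}}(v_j(t,x)-g_{ij}(t,x));\ -\partial_tv_i(t,x)-\mathcal Lv_i(t,x)-f_i(t,x,v_1(t,x),\dots,v_m(t,x),\sigma^\top(t,x)D_xv_i(t,x))\Big\}=0,\qquad v_i(T,x)=h_i(x),$$ is unique in the class of tuples $(v_1,\dots,v_m)$ of continuous functions of polynomial growth; that is, any two viscosity solutions in this class coincide.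
   Context: $\mathcal L\varphi(t,x)=\frac12\mathrm{Tr}[(\sigma\sigma^\top)(t,x)D^2_{xx}\varphi(t,x)]+b(t,x)^\top D_x\varphi(t,x)$. A function $\phi$ is of polynomial growth if $|\phi(t,x)|\le C(1+|x|^\gamma)$ (resp. $|\phi(x)|\le C(1+|x|^\gamma)$) for some constants $C,\gamma\ge0$. A maximum over the empty set is read as $-\infty$. Jets. For $u:[0,T]\times\mathbb R^k\to\mathbb R$ lower (resp. upper) semicontinuous, the parabolic subjet $J^-u(t,x)$ (resp. superjet $J^+u(t,x)$) is the set of triples $(p,q,M)\in\mathbb R\times\mathbb R^k\times\mathbb S^k$ ($\mathbb S^k$ = symmetric real $k\times k$ matrices) with $u(t',x')\ge$ (resp. $\le$) $u(t,x)+p(t'-t)+\langle q,x'-x\rangle+\frac12\langle x'-x,M(x'-x)\rangle+o(|t'-t|+|x'-x|^2)$ as $(t',x')\to(t,x)$ in $[0,T]\times\mathbb R^k$. The limiting subjet $\bar J^-u(t,x)$ (resp. limiting superjet $\bar J^+u(t,x)$) is the set of limits $(p,q,M)=\lim_n(p_n,q_n,M_n)$ with $(p_n,q_n,M_n)\in J^-u(t_n,x_n)$ (resp. $J^+u(t_n,x_n)$), $(t_n,x_n)\to(t,x)$ and $u(t_n,x_n)\to u(t,x)$. Viscosity solutions. $(v_i)_{i\in\mathcal J}$ with every $v_i$ lower (resp. upper) semicontinuous on $[0,T]\times\mathbb R^k$ is a viscosity supersolution (resp. subsolution) of the system if for every $i\in\mathcal J$, every $(t,x)\in[0,T)\times\mathbb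 R^k$ and every $(p,q,M)\in\bar J^-v_i(t,x)$ (resp. $\bar J^+v_i(t,x)$), $$\min\Big\{v_i(t,x)-\max_{j\in\mathcal J\setminus\{i\}}(v_j(t,x)-g_{ij}(t,x));\ -p-b(t,x)^\top q-\tfrac12\mathrm{Tr}[(\sigma\sigma^\top)(t,x)M]-f_i(t,x,v_1(t,x),\dots,v_m(t,x),\sigma(t,x)^\top q)\Big\}\ge0\ (\text{resp. }\le0),$$ and $v_i(T,x)\ge h_i(x)$ (resp. $\le h_i(x)$) for all $x\in\mathbb R^k$. A tuple of continuous functions is a viscosity solution if it is both a viscosity supersolution and a viscosity subsolution. *)

(* Defs.v *)
From mathcomp Require Import all_boot all_order all_algebra.
From mathcomp Require Import all_classical all_reals all_analysis.

Set Implicit Arguments.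
Unset Strict Implicit.
Unset Printing Implicit Defensive.

Import Order.TTheory GRing.Theory Num.Theory.
Import numFieldNormedType.Exports.

Local Open Scope classical_set_scope.
Local Open Scope ring_scope.

(* Elements of R^n are column vectors.  A function on [0,T] x R^k is a total
   function on R * 'cV[R]_k that is only ever constrained on [strip k T]. *)

(* Euclidean norm on R^n, Frobenius norm on matrices; the library norm on
   matrices is the sup norm. *)
Definition enorm (R : realType) (m n : nat) (A : 'M[R]_(m, n)) : R :=
  Num.sqrt (\sum_i \sum_j A i j ^+ 2).

Definition dot (R : realType) (n : nat) (u v : 'cV[R]_n) : R :=
  (u^T *m v) 0 0.

Definition strip (R : realType) (k : nat) (T : R) : set (R * 'cV[R]_k) :=
  `[0, T] `*` setT.

Definition poly_growth (R : realType) (k : nat) (phi : 'cV[R]_k -> R) : Prop :=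
  exists C gamma : R, [/\ 0 <= C, 0 <= gamma &
    forall x, `|phi x| <= C * (1 + enorm x `^ gamma)].

Definition poly_growth_strip (R : realType) (k : nat) (T : R)
    (phi : R * 'cV[R]_k -> R) : Prop :=
  exists C gamma : R, [/\ 0 <= C, 0 <= gamma &
    forall (t : R) x, t \in `[0, T] ->
      `|phi (t, x)| <= C * (1 + enorm x `^ gamma)].

Definition borel_strip (R : realType) (k : nat) (T : R)
    (phi : R * 'cV[R]_k -> R) : Prop :=
  let X := g_sigma_algebraType (@open (R * 'cV[R]_k)%type) in
  measurable_fun (strip T : set X) (phi : X -> R).

(* Continuity in the strip variable, uniformly in the parameter [a : A]. *)
Definition continuous_unif_param (R : realType) (k : nat) (T : R) (A : Type)
    (F : R * 'cV[R]_k -> A -> R) : Prop :=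
  forall z, strip T z -> forall eps : R, 0 < eps ->
    \forall z' \near within (strip T) (nbhs z),
      forall a, `|F z' a - F z a| < eps.

Definition lsc_on (R : realType) (X : topologicalType) (D : set X)
    (u : X -> R) : Prop :=
  @lower_semicontinuous (subspace D) R (fun z => (u z)%:E).

Definition usc_on (R : realType) (X : topologicalType) (D : set X)
    (u : X -> R) : Prop := lsc_on D (fun z => - u z).

Section Jets.
Context {R : realType} {k : nat}.
Local Notation spacetime := (R * 'cV[R]_k)%type.
Local Notation jet := (R * 'cV[R]_k * 'M[R]_k)%type.
Implicit Types (T : R) (u : spacetime -> R) (z : spacetime) (a : jet).

Definition taylor2 u z a (z' : spacetime) : R :=
  let: (p, q, M) := a in
  u z + p * (z'.1 - z.1) + dot q (z'.2 - z.2)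
    + 2^-1 * dot (z'.2 - z.2) (M *m (z'.2 - z.2)).

Definition parabolic_gauge z (z' : spacetime) : R :=
  `|z'.1 - z.1| + enorm (z'.2 - z.2) ^+ 2.

Definition subjet T u z : set jet := [set a | strip T z /\ a.2^T = a.2 /\
  let F := within (strip T) (nbhs z) in
  exists2 r : spacetime -> R, r =o_F (parabolic_gauge z) &
    \forall z' \near F, u z' >= taylor2 u z a z' + r z'].

Definition superjet T u z : set jet := [set a | strip T z /\ a.2^T = a.2 /\
  let F := within (strip T) (nbhs z) in
  exists2 r : spacetime -> R, r =o_F (parabolic_gauge z) &
    \forall z' \near F, u z' <= taylor2 u z a z' + r z'].

Definition limiting_jet (J : spacetime -> set jet) u z : set jet :=
  [set a | exists (zn : nat -> spacetime) (an : nat -> jet),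
    [/\ forall n, J (zn n) (an n),
        an @ \oo --> a,
        zn @ \oo --> z &
        u \o zn @ \oo --> u z]].

Definition limiting_subjet T u := limiting_jet (subjet T u) u.
Definition limiting_superjet T u := limiting_jet (superjet T u) u.
End Jets.

Section System.
Context {R : realType} {k d m : nat}.
Local Notation spacetime := (R * 'cV[R]_k)%type.
Variables (T : R) (b : spacetime -> 'cV[R]_k) (sigma : spacetime -> 'M[R]_(k, d)).
Variable f : 'I_m -> spacetime -> 'cV[R]_m -> 'cV[R]_d -> R.
Variable g : 'I_m -> 'I_m -> spacetime -> R.
Variable h : 'I_m -> 'cV[R]_k -> R.
Implicit Types v : 'I_m -> spacetime -> R.

(* Extended-real valued because the maximum is -oo when m = 1. *)
Definition obstacle v (i : 'I_m) (z : spacetime) : \bar R :=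
  \big[maxe/-oo%E]_(j < m | j != i) (v j z - g i j z)%:E.

Definition pde_op v (i : 'I_m) (z : spacetime)
    (a : R * 'cV[R]_k * 'M[R]_k) : R :=
  let: (p, q, M) := a in
  - p - dot (b z) q - 2^-1 * \tr (sigma z *m (sigma z)^T *m M)
    - f i z (\col_j v j z) ((sigma z)^T *m q).

Definition system_op v (i : 'I_m) (z : spacetime) a : \bar R :=
  mine ((v i z)%:E - obstacle v i z)%E (pde_op v i z a)%:E.

Definition viscosity_supersolution v : Prop :=
  [/\ forall i, lsc_on (strip T) (v i),
      forall i (t : R) x a, 0 <= t < T -> limiting_subjet T (v i) (t, x) a ->
        (0 <= system_op v i (t, x) a)%E &
      forall i x, h i x <= v i (T, x)].

Definition viscosity_subsolution v : Prop :=
  [/\ forall i, usc_on (strip T) (v i),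
      forall i (t : R) x a, 0 <= t < T -> limiting_superjet T (v i) (t, x) a ->
        (system_op v i (t, x) a <= 0)%E &
      forall i x, v i (T, x) <= h i x].

Definition viscosity_solution v : Prop :=
  [/\ forall i, {within strip T, continuous (v i)},
      viscosity_supersolution v & viscosity_subsolution v].
End System.

(* Main.v *)
Require Import Defs.
From mathcomp Require Import all_boot all_order all_algebra.
From mathcomp Require Import all_classical all_reals all_analysis.
From mathcomp Require Import zify ring lra.
From mathcomp Require Import -(notations) mpoly.
Set Implicit Arguments.
Unset Strict Implicit.
Unset Printing Implicit Defensive.
Import Order.TTheory GRing.Theory Num.Theory.
Import numFieldNormedType.Exports.
Local Open Scope classical_set_scope.
Local Open Scope ring_scope.

(* Let v be a subsolution and w a supersolution with v_i > w_i somewhere.  For n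
   large, phi(t,x) = (2T - t)^(n+2) (M + theta (1 + |x|^2)^(j+2)) is a strict
   supersolution of the linearized equation; for small theta and a suitable
   M > 0 it touches max_i (v_i - w_i) from above at a point z0 with t0 < T.
   Following from index to index the constraints that v attains at z0 cannot
   produce a cycle, since that would be a free loop, so for some contact index i
   the function v_i lies strictly above its obstacle near z0, and the differential
   inequalities hold there for v_i and w_i.  Doubling the variables for
   v_i - phi and w_i then contradicts the strictness of phi.

   The theorem on sums of Crandall and Ishii is replaced by the trace inequality
   that the doubling needs: if u(z) - w(z') - alpha/2 |z - z'|^2 is maximal at
   (zu, zw), if \tr (s1 s1^T X) >= c1 for the superjets (q, X) of u close to
   (zu, alpha (zu - zw)), and if the same holds with c2 and s2 for -w, then
   c1 + c2 <= 2 alpha |s1 - s2|^2.  Consider the sup-convolutions of u and -w,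
   blown up at zu and zw and composed with the linear maps (s1, kappa I) and
   (s2, kappa I).  On the unit ball they lie, up to a small error, below
   polynomials Psi1, Psi2 with Laplacians c1 - tau, c2 - tau and almost the same
   boundary values; these exist because Bernstein polynomials approximate the
   boundary values and because q |-> Laplacian((1 - |x|^2) q) is onto the
   polynomials.  If the inequality failed, Psi1 + Psi2 - alpha |(s1 - s2) y|^2
   would have positive Laplacian, be almost nonpositive on the sphere, and be
   almost nonnegative at 0, against the maximum principle. *)

(** Only traces of second derivatives enter the doubled inequality, so comparison with polynomials
    can take the place of the almost everywhere second differentiability of convex functions. This
    rests on an order of choices: the bounds on the sup-convolutions, hence on the derivatives of
    Psi1 and Psi2, do not involve the blow-up scale h. With h chosen last, the superjets obtained
    stay bounded, and their points and slopes are as close as desired to zu and alpha (zu - zw), and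
    likewise at zw. The coefficients b and sigma are merely continuous in time. Time is therefore
    one more coordinate, measured in a unit [gam] chosen after alpha: the two times differ by at
    most [gam], while the time slopes of u and w cancel whatever [gam] is. No monotonicity of f_i in
    y^i is assumed. The factor (2T - t)^(n+2) makes up for it: its logarithmic derivative is at most
    -(n+2)/(2T), which for large n beats all other terms of the linearized equation; unlike an
    exponential it is a polynomial, so its jets come from algebra. *)

(** * The Laplacian on polynomials *)

Section HarmonicPolynomials.
Variables (R : realType) (n : nat).
Local Notation P := (mpoly n R).
Implicit Types (p q g : P) (i : 'I_n).

Definition pder i p : P := mderiv i p.

Lemma pderM i p q : pder i (p * q) = pder i p * q + p * pder i q.
Proof. exact: mderivM. Qed.

Lemma pderD i p q : pder i (p + q) = pder i p + pder i q.
Proof. exact: mderivD. Qed.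

Lemma pderZ i c p : pder i (c *: p) = c *: pder i p.
Proof. exact: mderivZ. Qed.

Lemma pder0 i : pder i 0 = 0.
Proof. exact: mderiv0. Qed.

Lemma pderC i c : pder i (mpolyC n c) = 0.
Proof. exact: mderivC. Qed.

Lemma pder_comm i j p : pder i (pder j p) = pder j (pder i p).
Proof. exact: mderiv_comm. Qed.

Lemma pder_sum i (I : finType) (F : I -> P) :
  pder i (\sum_j F j) = \sum_j pder i (F j).
Proof. exact: (raddf_sum (mderiv i)). Qed.

Lemma pderMn i p k : pder i (p *+ k) = pder i p *+ k.
Proof. exact: mderivMn. Qed.

Definition mvar i : P := mpolyX R (mnm1 i).
Definition mlap p : P := \sum_i pder i (pder i p).
Definition meuler p : P := \sum_i mvar i * pder i p.
Definition msqnorm : P := \sum_i mvar i ^+ 2.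

Lemma pder_mvar i j : pder i (mvar j) = (i == j)%:R.
Proof.
rewrite /pder /mvar mderivX mnm1E eq_sym; case: eqP => [->|_]; last by rewrite scale0r.
by rewrite scale1r -[X in mnm_sub X _]add0m addmK mpolyX0.
Qed.

Lemma pder_msqnorm i : pder i msqnorm = mvar i *+ 2.
Proof.
rewrite pder_sum (bigD1 i) //= big1 ?addr0 => [|j ji].
  by rewrite expr2 pderM pder_mvar eqxx mulr1 mul1r mulr2n.
by rewrite expr2 pderM pder_mvar eq_sym (negbTE ji) mulr0 mul0r addr0.
Qed.

Lemma pderXn i p s : pder i (p ^+ s.+1) = pder i p * p ^+ s *+ s.+1.
Proof.
elim: s => [|s IH]; first by rewrite expr1 expr0 mulr1 mulr1n.
by rewrite exprS pderM IH !exprS; ring.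
Qed.

Lemma meulerD p q : meuler (p + q) = meuler p + meuler q.
Proof. by rewrite -big_split /=; apply: eq_bigr => i _; rewrite pderD mulrDr. Qed.

Lemma meulerZ c p : meuler (c *: p) = c *: meuler p.
Proof. by rewrite scaler_sumr; apply: eq_bigr => i _; rewrite pderZ scalerAr. Qed.

Lemma meulerM p q : meuler (p * q) = meuler p * q + p * meuler q.
Proof.
rewrite mulr_suml mulr_sumr -big_split; apply: eq_bigr => i _ /=.
by rewrite pderM; ring.
Qed.

Lemma mlapD p q : mlap (p + q) = mlap p + mlap q.
Proof. by rewrite -big_split; apply: eq_bigr => i _; rewrite !pderD. Qed.

Lemma mlapZ c p : mlap (c *: p) = c *: mlap p.
Proof. by rewrite scaler_sumr; apply: eq_bigr => i _; rewrite !pderZ. Qed.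

Lemma mlapN p : mlap (- p) = - mlap p.
Proof. by rewrite -scaleN1r mlapZ scaleN1r. Qed.

Lemma mlapB p q : mlap (p - q) = mlap p - mlap q.
Proof. by rewrite mlapD mlapN. Qed.

Lemma mlap0 : mlap 0 = 0.
Proof. by rewrite /mlap big1 // => i _; rewrite !pder0. Qed.

Lemma meuler0 : meuler 0 = 0.
Proof. by rewrite /meuler big1 // => i _; rewrite pder0 mulr0. Qed.

Lemma mlap_mvar i : mlap (mvar i) = 0.
Proof.
by rewrite /mlap big1 // => j _; rewrite pder_mvar -mpolyC_nat pderC.
Qed.

Lemma mlapM p q :
  mlap (p * q) = mlap p * q + (\sum_i pder i p * pder i q) *+ 2 + p * mlap q.
Proof.
rewrite mulr_suml mulr_sumr -sumrMnl -!big_split; apply: eq_bigr => i _ /=.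
by rewrite pderM pderD !pderM; ring.
Qed.

(** In the Laplacian of x_i times the i-th derivative only the cross term with j = i survives,
    because x_i is linear; summed over i these cross terms give the commutator, twice the
    Laplacian. *)
Lemma meuler_mlap p : meuler (mlap p) = mlap (meuler p) - mlap p *+ 2.
Proof.
have -> : mlap (meuler p) = \sum_i mlap (mvar i * pder i p).
  rewrite /meuler; elim/big_rec2 : _ => [|i y1 y2 _ <-]; first by rewrite mlap0.
  by rewrite mlapD.
rewrite -sumrMnl -sumrB; apply: eq_bigr => i _.
rewrite mlapM mlap_mvar mul0r add0r.
rewrite (bigD1 i) //= big1 ?addr0; last first.
  by move=> j /negbTE ji; rewrite pder_mvar ji mul0r.
rewrite pder_mvar eqxx mul1r [X in _ = X - _]addrC addrK; congr (_ * _).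
rewrite pder_sum; apply: eq_bigr => j _.
by rewrite pder_comm; congr pder; rewrite pder_comm.
Qed.

Lemma meulerX (m : multinom n) :
  meuler (mpolyX R m) = (mdeg m)%:R *: mpolyX R m.
Proof.
rewrite mdegE natr_sum scaler_suml; apply: eq_bigr => i _.
rewrite /pder mderivX -scalerAr /mvar -mpolyXD.
have [->|mi0] := eqVneq (m i) 0%N; first by rewrite !scale0r.
by rewrite addmC submK // lep1mP.
Qed.

Lemma mcoeff_meuler p m : mcoeff m (meuler p) = (mdeg m)%:R * mcoeff m p.
Proof.
elim/mpolyind: p => [|c m' p _ _ IH].
  by rewrite meuler0 mcoeff0 mulr0.
rewrite meulerD meulerZ meulerX !mcoeffD IH !mcoeffZ mcoeffX mulrDr.
by case: eqP => [->|_]; rewrite ?mulr0 ?mulr1 //= mulrC.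
Qed.

(* Euler's identity as a definition; a real degree makes [mhomog_mlap] total. *)
Definition mhomog (s : R) p := meuler p = s *: p.

Lemma mhomogD s p q : mhomog s p -> mhomog s q -> mhomog s (p + q).
Proof. by rewrite /mhomog meulerD => -> ->; rewrite scalerDr. Qed.

Lemma mhomogZ s c p : mhomog s p -> mhomog s (c *: p).
Proof. by rewrite /mhomog meulerZ => ->; rewrite !scalerA mulrC. Qed.

Lemma mhomog_mlap s p : mhomog s p -> mhomog (s - 2) (mlap p).
Proof.
move=> hp; rewrite /mhomog meuler_mlap hp mlapZ scalerBl; congr (_ - _).
by rewrite -scaler_nat.
Qed.

(** The Euler operator multiplies each coefficient by the degree of its monomial, so its eigenvalues
    are nonnegative. *)
Lemma mhomog_lt0 s p : s < 0 -> mhomog s p -> p = 0.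
Proof.
move=> s0 hp; apply/mpolyP => m; rewrite mcoeff0.
have := congr1 (mcoeff m) hp; rewrite mcoeff_meuler mcoeffZ => /eqP.
rewrite -subr_eq0 -mulrBl mulf_eq0 => /orP[|/eqP//].
by rewrite subr_eq0 => /eqP es; move: s0; rewrite -es ltrn0.
Qed.

Lemma meuler_msqnorm : meuler msqnorm = msqnorm *+ 2.
Proof.
by rewrite -sumrMnl; apply: eq_bigr => i _; rewrite pder_msqnorm mulrnAr expr2.
Qed.

Lemma meuler_msqnormXn s : meuler (msqnorm ^+ s) = msqnorm ^+ s *+ s.*2.
Proof.
elim: s => [|s IH].
  by rewrite expr0 /meuler big1 // => i _; rewrite -mpolyC1 pderC mulr0.
by rewrite exprS meulerM meuler_msqnorm IH doubleS -addn2 mulrnDr; ring.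
Qed.

Lemma mhomog_msqnorm s p : mhomog s p -> mhomog (s + 2) (msqnorm * p).
Proof.
rewrite /mhomog meulerM meuler_msqnorm => ->.
by rewrite scalerDl scaler_nat -scalerAr mulrnAl addrC.
Qed.

Lemma mlap_msqnormXn s :
  mlap (msqnorm ^+ s.+1) = msqnorm ^+ s *+ (s.+1.*2 * (n + s.*2)).
Proof.
have -> : mlap (msqnorm ^+ s.+1) =
    \sum_i pder i (mvar i * msqnorm ^+ s) *+ s.+1.*2.
  apply: eq_bigr => i _; rewrite pderXn pder_msqnorm mulrnAl -mulrnA mul2n.
  by rewrite pderMn.
rewrite sumrMnl mulnC mulrnA; congr (_ *+ _).
under eq_bigr do rewrite pderM pder_mvar eqxx mul1r.
rewrite big_split /= -/(meuler _) meuler_msqnormXn sumr_const card_ord.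
by rewrite mulrnDr.
Qed.

(** The gradient of |x|^(2s+2) is radial, so the cross term of the product rule is a multiple of
    [meuler g], which homogeneity turns into a multiple of [g]. *)
Lemma mlap_msqnormXnM s j g : mhomog j%:R g ->
  mlap (msqnorm ^+ s.+1 * g) =
  (msqnorm ^+ s * g) *+ (s.+1.*2 * (n + s.*2 + j.*2)) + msqnorm ^+ s.+1 * mlap g.
Proof.
move=> hg; rewrite mlapM mlap_msqnormXn; congr (_ + _).
have -> : \sum_i pder i (msqnorm ^+ s.+1) * pder i g =
    msqnorm ^+ s * meuler g *+ s.+1.*2.
  rewrite mulr_sumr -sumrMnl; apply: eq_bigr => i _.
  by rewrite pderXn pder_msqnorm -mul2n; ring.
by rewrite hg -scalerAr scaler_nat -!mulrnA mulrnAl -mulrnDr; congr (_ *+ _); lia.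
Qed.

Lemma mlap_mhomog_small (j : nat) g : (j < 2)%N -> mhomog j%:R g -> mlap g = 0.
Proof.
move=> j2 /mhomog_mlap; apply: mhomog_lt0.
by rewrite subr_lt0 ltr_nat.
Qed.

(* By [mlap_msqnormXnM], [|x|^(2s+2) g] solves the equation up to a multiple of
   [|x|^(2s+2) mlap g], where the degree has dropped by two. *)
Lemma mlap_msqnorm_surj (j s : nat) g : (0 < n)%N -> mhomog j%:R g ->
  exists2 q, mhomog j%:R q & mlap (msqnorm ^+ s.+1 * q) = msqnorm ^+ s * g.
Proof.
move=> n0; have [k] := ubnP j; elim: k j s g => // k IH j s g jk hg.
have c0 : ((s.+1.*2 * (n + s.*2 + j.*2))%:R : R) != 0.
  by rewrite pnatr_eq0; lia.
have [q1 hq1 eq1] : exists2 q1, mhomog j%:R q1 &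
    mlap (msqnorm ^+ s.+1 * q1) = msqnorm ^+ s.+1 * mlap g.
  case: j jk hg {c0} => [|[|j]] jk hg.
  - exists 0; first by rewrite /mhomog meuler0 scaler0.
    by rewrite mulr0 mlap0 (@mlap_mhomog_small _ _ _ hg) ?mulr0.
  - exists 0; first by rewrite /mhomog meuler0 scaler0.
    by rewrite mulr0 mlap0 (@mlap_mhomog_small _ _ _ hg) ?mulr0.
  - have hlg : mhomog j%:R (mlap g).
      by have := mhomog_mlap hg; rewrite -addn2 natrD addrK.
    have [|q hq eq] := IH j s.+1 _ _ hlg; first lia.
    exists (msqnorm * q); first by rewrite -addn2 natrD; exact: mhomog_msqnorm.
    by rewrite mulrA -exprSr.
exists (((s.+1.*2 * (n + s.*2 + j.*2))%:R)^-1 *: (g - q1)).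
  by apply/mhomogZ/mhomogD => //; rewrite -scaleN1r; exact: mhomogZ.
rewrite -scalerAr mlapZ mulrBr mlapB eq1 (mlap_msqnormXnM _ hg) addrK.
by rewrite -[X in _ *: X]scaler_nat scalerA mulVf // scale1r.
Qed.

(** For homogeneous [h] solve [mlap (msqnorm * q) = h] with [q] of the same degree. Then (1 -
    |x|^2)(-q) has Laplacian [h - mlap q], and the error [mlap q] has degree two less, so induction
    supplies its correction [q1]. Multiples of 1 - |x|^2 vanish on the sphere: they adjust a
    Laplacian without touching boundary values. *)
Lemma mlap_ball_surj g : (0 < n)%N -> exists q, mlap ((1 - msqnorm) * q) = g.
Proof.
move=> n0.
have hom j h : mhomog j%:R h -> exists q, mlap ((1 - msqnorm) * q) = h.
  have [k] := ubnP j; elim: k j h => // k IH j h jk hh.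
  have [q hq] := mlap_msqnorm_surj 0 n0 hh; rewrite expr1 expr0 mul1r => eq.
  have [q1 eq1] : exists q1, mlap ((1 - msqnorm) * q1) = mlap q.
    case: j jk hh hq => [|[|j]] jk hh hq.
    - by exists 0; rewrite mulr0 mlap0 (@mlap_mhomog_small _ _ _ hq).
    - by exists 0; rewrite mulr0 mlap0 (@mlap_mhomog_small _ _ _ hq).
    - have := mhomog_mlap hq; rewrite -addn2 natrD addrK => hlq.
      by apply: (IH j) => //; lia.
  exists (q1 - q); rewrite mulrBr mlapB eq1 mulrBl mul1r mlapB eq.
  by rewrite opprB addrCA subrr addr0.
elim/mpolyind: g => [|c m p _ _ [q eq]]; first by exists 0; rewrite mulr0 mlap0.
have [|q1 eq1] := hom (mdeg m) (mpolyX R m); first exact: meulerX.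
by exists (c *: q1 + q); rewrite mulrDr -scalerAr mlapD mlapZ eq1 eq.
Qed.

End HarmonicPolynomials.

(** * Inner product and sup norm *)

Section Euclidean.
Variables (R : realType).

Lemma coord_le_norm m n (A : 'M[R]_(m, n)) i j : `|A i j| <= `|A|.
Proof.
rewrite [leRHS]/Num.Def.normr /= mx_normrE; apply/bigmax_geP; right => /=.
by exists (i, j).
Qed.

Lemma norm_le_coord m n (A : 'M[R]_(m, n)) r :
  0 <= r -> (forall i j, `|A i j| <= r) -> `|A| <= r.
Proof.
move=> r0 hA; rewrite [leLHS]/Num.Def.normr /= mx_normrE; apply/bigmax_leP.
by split=> // -[i j] _; exact: hA.
Qed.

Lemma dotE n (u v : 'cV[R]_n) : dot u v = \sum_i u i 0 * v i 0.
Proof. by rewrite /dot mxE; apply: eq_bigr => i _; rewrite mxE. Qed.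

Lemma dotC n (u v : 'cV[R]_n) : dot u v = dot v u.
Proof. by rewrite !dotE; apply: eq_bigr => i _; rewrite mulrC. Qed.

Lemma dotDl n (u v w : 'cV[R]_n) : dot (u + v) w = dot u w + dot v w.
Proof. by rewrite /dot linearD mulmxDl mxE. Qed.

Lemma dotDr n (u v w : 'cV[R]_n) : dot w (u + v) = dot w u + dot w v.
Proof. by rewrite dotC dotDl !(dotC w). Qed.

Lemma dotZl n a (u v : 'cV[R]_n) : dot (a *: u) v = a * dot u v.
Proof. by rewrite /dot linearZ -scalemxAl mxE. Qed.

Lemma dotZr n a (u v : 'cV[R]_n) : dot u (a *: v) = a * dot u v.
Proof. by rewrite dotC dotZl dotC. Qed.

Lemma dotNl n (u v : 'cV[R]_n) : dot (- u) v = - dot u v.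
Proof. by rewrite -scaleN1r dotZl mulN1r. Qed.

Lemma dotNr n (u v : 'cV[R]_n) : dot u (- v) = - dot u v.
Proof. by rewrite dotC dotNl dotC. Qed.

Lemma dot0l n (u : 'cV[R]_n) : dot 0 u = 0.
Proof. by rewrite -(scale0r 0) dotZl mul0r. Qed.

Lemma dot0r n (u : 'cV[R]_n) : dot u 0 = 0.
Proof. by rewrite dotC dot0l. Qed.

Definition dotlin := (dotDl, dotDr, dotNl, dotNr, dotZl, dotZr, dot0l, dot0r).

Lemma dot_mulmxr m n (A : 'M[R]_(m, n)) u v : dot u (A *m v) = dot (A^T *m u) v.
Proof. by rewrite /dot trmx_mul trmxK mulmxA. Qed.

Lemma dot_outer n (h g e : 'cV[R]_n) : dot h ((g *m e^T) *m h) = dot h g * dot e h.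
Proof.
rewrite -mulmxA.
have -> : g *m (e^T *m h) = dot e h *: g.
  by rewrite (mx11_scalar (e^T *m h)) mul_mx_scalar.
by rewrite dotZr mulrC.
Qed.

Lemma dot_ge0 n (u : 'cV[R]_n) : 0 <= dot u u.
Proof. by rewrite dotE sumr_ge0 // => i _; rewrite -expr2 sqr_ge0. Qed.

Lemma normM_le_dot n (u : 'cV[R]_n) : `|u| ^+ 2 <= dot u u.
Proof.
rewrite -[leRHS]sqr_sqrtr ?dot_ge0 // ler_pXn2r ?nnegrE ?normr_ge0 ?sqrtr_ge0 //.
apply: norm_le_coord; first exact: sqrtr_ge0.
move=> i j; rewrite ord1 -sqrtr_sqr ler_wsqrtr // dotE (bigD1 i) //= -expr2.
by rewrite lerDl sumr_ge0 // => k _; rewrite -expr2 sqr_ge0.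
Qed.

Lemma dot_le_norm n (u v : 'cV[R]_n) : `|dot u v| <= n%:R * (`|u| * `|v|).
Proof.
rewrite dotE (le_trans (ler_norm_sum _ _ _)) //.
rewrite mulr_natl -[X in _ *+ X](card_ord n) -sumr_const ler_sum // => i _.
by rewrite normrM ler_pM // coord_le_norm.
Qed.

Lemma norm_mulmx m n p (A : 'M[R]_(m, n)) (B : 'M[R]_(n, p)) :
  `|A *m B| <= n%:R * (`|A| * `|B|).
Proof.
apply: norm_le_coord => [|i j]; first by rewrite !mulr_ge0.
rewrite mxE (le_trans (ler_norm_sum _ _ _)) //.
rewrite mulr_natl -[X in _ *+ X](card_ord n) -sumr_const ler_sum // => k _.
by rewrite normrM ler_pM // coord_le_norm.
Qed.

Lemma norm_trmx m n (A : 'M[R]_(m, n)) : `|A^T| = `|A|.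
Proof.
apply/le_anti/andP; split; apply: norm_le_coord => // i j; rewrite ?mxE.
  exact: coord_le_norm.
by have := coord_le_norm A^T j i; rewrite mxE.
Qed.

End Euclidean.

Lemma continuous_for_eps (R : realType) (V W : normedModType R) (phi : V -> W) z :
  (forall e : R, 0 < e -> exists2 d : R, 0 < d &
     forall t, `|t - z| < d -> `|phi t - phi z| <= e) -> {for z, continuous phi}.
Proof.
move=> hphi; apply/cvgrPdist_le => /= e /hphi[d d0 hd].
apply/nbhs_normP; exists d => //= t; rewrite /ball_ /= distrC => /hd.
by rewrite distrC.
Qed.

(** * Second-order expansions at a point *)

Section Taylor.
Variables (R : realType) (n : nat).
Implicit Types (phi psi : 'cV[R]_n -> R) (z G h v : 'cV[R]_n) (H : 'M[R]_n).

Definition taylor_at phi z G H := forall eps : R, 0 < eps ->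
  exists2 r : R, 0 < r & forall h, `|h| < r ->
    `|phi (z + h) - phi z - dot G h - 2^-1 * dot h (H *m h)| <= eps * dot h h.

(** Symmetric second differences cancel the gradient; divided by s^2 they tend to the quadratic form
    of [H]. *)
Lemma taylor_second_diff phi z G H v c : taylor_at phi z G H ->
  (exists2 r : R, 0 < r & forall s : R, 0 < s < r ->
     phi (z + s *: v) + phi (z - s *: v) - 2 * phi z <= c * s ^+ 2) ->
  dot v (H *m v) <= c.
Proof.
move=> T [r r0 hr]; apply/ler_addgt0Pr => e e0.
have d0 : 0 < 1 + dot v v by rewrite ltr_wpDr ?dot_ge0.
have e1 : 0 < e / (2 * (1 + dot v v)) by rewrite divr_gt0 ?mulr_gt0.
have [r1 r10 hr1] := T _ e1.
have v0 : 0 < 1 + `|v| by rewrite ltr_wpDr.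
pose s := Num.min r (r1 / (1 + `|v|)) / 2.
have s0 : 0 < s by rewrite divr_gt0 // lt_min r0 divr_gt0.
have mr : s < Num.min r (r1 / (1 + `|v|)).
  by rewrite ltr_pdivrMr // ltr_pMr ?ltr1n // lt_min r0 divr_gt0.
have sr : s < r by apply: lt_le_trans mr _; rewrite ge_min lexx.
have sv : `|s *: v| < r1.
  rewrite normrZ gtr0_norm //.
  have : s < r1 / (1 + `|v|) by apply: lt_le_trans mr _; rewrite ge_min lexx orbT.
  rewrite ltr_pdivlMr //; apply: le_lt_trans; rewrite ler_pM2l //.
  by rewrite lerDr.
have h1 := hr1 _ sv; have := hr1 (- (s *: v)); rewrite normrN => /(_ sv) h2.
have := hr s; rewrite s0 sr => /(_ isT) h3.
move: h1 h2; rewrite !mulmxN -scalemxAr !dotlin !opprK !ler_norml.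
set A := dot v (H *m v); set B := dot G v; set D := dot v v.
move=> /andP[h1 _] /andP[h2 _].
have : s ^+ 2 * A <= s ^+ 2 * (c + 2 * (e / (2 * (1 + D)) * D)) by nra.
rewrite ler_pM2l ?exprn_gt0 // => /le_trans; apply.
rewrite lerD2l [X in X <= _](_ : _ = e * (D / (1 + D))); last first.
  by rewrite -/D in d0; field; rewrite gt_eqF.
by apply: ler_piMr; [exact: ltW|rewrite ler_pdivrMr // mul1r lerDr].
Qed.

Lemma taylor_atN phi z G H : taylor_at phi z G H ->
  taylor_at (fun x => - phi x) z (- G) (- H).
Proof.
move=> T e e0; have [r r0 hr] := T e e0; exists r => // h /hr.
rewrite mulNmx !dotlin; rewrite -normrN; congr (_ <= _); congr Num.Def.normr; ring.
Qed.

Lemma taylor_atD phi psi z G H G' H' : taylor_at phi z G H ->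
  taylor_at psi z G' H' -> taylor_at (fun x => phi x + psi x) z (G + G') (H + H').
Proof.
move=> T T' e e0; have e20 : 0 < e / 2 by rewrite divr_gt0.
have [r r0 hr] := T _ e20; have [r' r0' hr'] := T' _ e20.
exists (Num.min r r'); first by rewrite lt_min r0.
move=> h; rewrite lt_min => /andP[/hr h1 /hr' h2].
rewrite mulmxDl !dotlin.
have -> : phi (z + h) + psi (z + h) - (phi z + psi z) - (dot G h + dot G' h) -
   2^-1 * (dot h (H *m h) + dot h (H' *m h)) =
   (phi (z + h) - phi z - dot G h - 2^-1 * dot h (H *m h)) +
   (psi (z + h) - psi z - dot G' h - 2^-1 * dot h (H' *m h)) by ring.
rewrite (le_trans (ler_normD _ _)) //; lra.
Qed.

Lemma taylor_at_cont phi z G H : taylor_at phi z G H -> {for z, continuous phi}.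
Proof.
move=> T; apply: continuous_for_eps => e e0.
have [r r0 hr] := T 1 ltr01.
pose C := n%:R * `|G| + n%:R * (n%:R * `|H|) + n%:R.
have C0 : 0 <= C by rewrite !addr_ge0 ?mulr_ge0.
exists (Num.min r (Num.min 1 (e / (1 + C)))).
  by rewrite !lt_min r0 ltr01 divr_gt0 // ltr_wpDr.
move=> t; rewrite !lt_min => /and3P[tr t1 tC].
have := hr _ tr; rewrite [z + _]addrC subrK mul1r; set h := t - z in tr t1 tC *.
have b1 := dot_le_norm G h; have b2 := dot_le_norm h (H *m h).
have b3 := dot_le_norm h h; have b4 := norm_mulmx H h.
move=> b0.
have -> : phi t - phi z = (phi t - phi z - dot G h - 2^-1 * dot h (H *m h)) + dot G h
   + 2^-1 * dot h (H *m h) by ring.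
have hh : `|h| * `|h| <= `|h| by apply: ler_piMr => //; exact: ltW.
have : `|h| * C <= e.
  rewrite ltr_pdivlMr ?ltr_wpDr // in tC; apply: le_trans (ltW tC).
  by rewrite ler_wpM2l // lerDr.
rewrite /C => hC.
have b5 : n%:R * (`|h| * `|H *m h|) <= n%:R * (n%:R * `|H| * `|h|).
  rewrite ler_wpM2l //; apply: (le_trans (ler_wpM2l (normr_ge0 h) b4)).
  have : 0 <= n%:R * `|H| :> R by rewrite mulr_ge0.
  nra.
have b6 : n%:R * (`|h| * `|h|) <= n%:R * `|h| by rewrite ler_wpM2l.
apply: (le_trans (ler_normD _ _)); rewrite normrM (@ger0_norm _ (2^-1)) ?invr_ge0 //.
have := ler_normD (phi t - phi z - dot G h - 2^-1 * dot h (H *m h)) (dot G h).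
have := ler_norm (dot h h).
have := normr_ge0 (dot h (H *m h)).
lra.
Qed.

End Taylor.

(** * Evaluation, gradient and Hessian of polynomials *)

Section PolynomialTaylor.
Variables (R : realType) (n : nat).
Local Notation P := (mpoly n R).
Implicit Types (p q : P) (i : 'I_n) (z h : 'cV[R]_n).

Definition ev p z : R := meval (fun i => z i 0) p.
Definition grad p z : 'cV[R]_n := \col_i ev (pder i p) z.
Definition hess p z : 'M[R]_n := \matrix_(i, j) ev (pder i (pder j p)) z.

Lemma evD p q z : ev (p + q) z = ev p z + ev q z. Proof. exact: mevalD. Qed.
Lemma evN p z : ev (- p) z = - ev p z. Proof. exact: mevalN. Qed.
Lemma evZ c p z : ev (c *: p) z = c * ev p z. Proof. exact: mevalZ. Qed.
Lemma evM p q z : ev (p * q) z = ev p z * ev q z. Proof. exact: mevalM. Qed.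
Lemma ev1 z : ev 1 z = 1. Proof. exact: meval1. Qed.
Lemma ev0 z : ev 0 z = 0. Proof. exact: meval0. Qed.
Lemma ev_mvar i z : ev (mvar R i) z = z i 0. Proof. exact: mevalXU. Qed.
Lemma evXn p k z : ev (p ^+ k) z = ev p z ^+ k.
Proof. by elim: k => [|k IH]; rewrite ?expr0 ?ev1 // !exprS evM IH. Qed.
Lemma ev_sum (I : finType) (F : I -> P) z :
  ev (\sum_j F j) z = \sum_j ev (F j) z.
Proof. exact: (raddf_sum (meval _)). Qed.
Lemma ev_msqnorm z : ev (msqnorm R n) z = dot z z.
Proof. by rewrite ev_sum dotE; apply: eq_bigr => i _; rewrite evXn ev_mvar expr2. Qed.

Lemma ev_mlap p z : ev (mlap p) z = \tr (hess p z).
Proof. by rewrite ev_sum; apply: eq_bigr => i _; rewrite mxE. Qed.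

Lemma gradD p q z : grad (p + q) z = grad p z + grad q z.
Proof. by apply/colP => i; rewrite !mxE pderD evD. Qed.

Lemma gradZ c p z : grad (c *: p) z = c *: grad p z.
Proof. by apply/colP => i; rewrite !mxE pderZ evZ. Qed.

Lemma hessD p q z : hess (p + q) z = hess p z + hess q z.
Proof. by apply/matrixP => i j; rewrite !mxE !pderD evD. Qed.

Lemma hessZ c p z : hess (c *: p) z = c *: hess p z.
Proof. by apply/matrixP => i j; rewrite !mxE !pderZ evZ. Qed.

Lemma hess_sym p z : (hess p z)^T = hess p z.
Proof. by apply/matrixP => i j; rewrite !mxE pder_comm. Qed.

Lemma gradM p q z : grad (p * q) z = ev q z *: grad p z + ev p z *: grad q z.
Proof.
by apply/colP => i; rewrite !mxE pderM evD !evM mulrC.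
Qed.

Lemma hessM p q z : hess (p * q) z = ev q z *: hess p z + ev p z *: hess q z +
  (grad p z *m (grad q z)^T + grad q z *m (grad p z)^T).
Proof.
apply/matrixP => i j; rewrite !(mxE, big_ord1).
by rewrite !(pderM, pderD) !(evD, evM); ring.
Qed.

Lemma grad_mvar i z : grad (mvar R i) z = delta_mx i 0.
Proof.
by apply/colP => j; rewrite !mxE pder_mvar eqxx andbT; case: eqP => _; rewrite ?ev1 ?ev0.
Qed.

Lemma hess_mvar i z : hess (mvar R i) z = 0.
Proof.
by apply/matrixP => j k; rewrite !mxE pder_mvar -mpolyC_nat pderC ev0.
Qed.

Lemma grad0 z : grad 0 z = 0.
Proof. by apply/colP => i; rewrite !mxE pder0 ev0. Qed.

Lemma hess0 z : hess 0 z = 0.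
Proof. by apply/matrixP => i j; rewrite !mxE !pder0 ev0. Qed.

Lemma grad1 z : grad 1 z = 0.
Proof. by apply/colP => i; rewrite !mxE -mpolyC1 pderC ev0. Qed.

Lemma hess1 z : hess 1 z = 0.
Proof. by apply/matrixP => i j; rewrite !mxE -mpolyC1 !pderC ev0. Qed.

Lemma mpoly_mvar_ind (Q : P -> Prop) : Q 1 ->
  (forall c p q, Q p -> Q q -> Q (c *: p + q)) ->
  (forall i p, Q p -> Q (mvar R i * p)) -> forall p, Q p.
Proof.
move=> Q1 QD QM; have Q0 : Q 0 by have := QD (-1) _ _ Q1 Q1; rewrite scaleN1r addNr.
elim/mpolyind => // c m p _ _ Qp; apply: QD => //.
rewrite mpolyXE_id; elim/big_rec : _ => // i x _ Qx.
by elim: (m i) => [|k IH]; rewrite ?expr0 ?mul1r // exprS -mulrA; apply: QM.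
Qed.

Lemma ev_bounded p r : 0 <= r ->
  exists2 C : R, 0 <= C & forall z, `|z| <= r -> `|ev p z| <= C.
Proof.
move=> r0; elim/mpoly_mvar_ind: p => [|c p q [C C0 hC] [D D0 hD]|i p [C C0 hC]].
- by exists 1 => // z _; rewrite ev1 normr1.
- exists (`|c| * C + D) => [|z zr]; first by rewrite addr_ge0 ?mulr_ge0.
  rewrite evD evZ (le_trans (ler_normD _ _)) // normrM lerD ?hD //.
  by rewrite ler_wpM2l ?hC.
- exists (r * C) => [|z zr]; first exact: mulr_ge0.
  rewrite evM ev_mvar normrM ler_pM ?hC //.
  exact: le_trans (coord_le_norm _ _ _) zr.
Qed.

(** The remainder of x_i p at z + h is (z_i + h_i) times the remainder of p plus h_i/2 times the
    quadratic form of the Hessian of p, and both are cubic in h. *)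
Lemma ev_taylor3 p z : exists2 C : R, 0 <= C & forall h, `|h| <= 1 ->
  `|ev p (z + h) - ev p z - dot (grad p z) h - 2^-1 * dot h (hess p z *m h)|
    <= C * `|h| ^+ 3.
Proof.
elim/mpoly_mvar_ind: p => [|c p q [C C0 hC] [D D0 hD]|i p [C C0 hC]].
- exists 0 => // h _; rewrite !ev1 grad1 hess1 mul0mx !dotlin.
  by rewrite mulr0 !subr0 subrr normr0 mul0r.
- exists (`|c| * C + D) => [|h h1]; first by rewrite addr_ge0 ?mulr_ge0.
  rewrite !evD !evZ gradD hessD gradZ hessZ mulmxDl -scalemxAl !dotlin.
  set x := (X in `|X|).
  have -> : x = c * (ev p (z + h) - ev p z - dot (grad p z) h - 2^-1 * dot h (hess p z *m h))
     + (ev q (z + h) - ev q z - dot (grad q z) h - 2^-1 * dot h (hess q z *m h)).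
    by rewrite /x; ring.
  rewrite mulrDl (le_trans (ler_normD _ _)) // normrM lerD ?hD //.
  by rewrite -mulrA ler_wpM2l ?hC.
- pose K := n%:R * (n%:R * `|hess p z|).
  have K0 : 0 <= K by rewrite !mulr_ge0.
  exists (K + (`|z| + 1) * C) => [|h h1].
    by rewrite addr_ge0 // mulr_ge0 // addr_ge0.
  have zh : (z + h) i 0 = z i 0 + h i 0 by rewrite mxE.
  rewrite !evM !ev_mvar zh gradM hessM grad_mvar hess_mvar ev_mvar scaler0 add0r.
  rewrite !mulmxDl -scalemxAl !dotDr !dotDl !dot_outer !dotlin.
  have dh (v : 'cV[R]_n) : dot (delta_mx i 0) v = v i 0.
    rewrite dotE (bigD1 i) //= mxE !eqxx mul1r big1 ?addr0 // => j /negbTE ji.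
    by rewrite mxE ji mul0r.
  rewrite (dotC h (delta_mx i 0)) (dotC h (grad p z)) !dh.
  set x := (X in `|X|).
  have -> : x = (z i 0 + h i 0) *
     (ev p (z + h) - ev p z - dot (grad p z) h - 2^-1 * dot h (hess p z *m h))
     + 2^-1 * (h i 0 * dot h (hess p z *m h)).
    by rewrite /x; field.
  rewrite (le_trans (ler_normD _ _)) // [leRHS]mulrDl addrC lerD //.
    rewrite normrM (@ger0_norm _ (2^-1)) ?invr_ge0 // normrM exprS mulrCA.
    have hi := coord_le_norm h i 0.
    have hh : `|dot h (hess p z *m h)| <= K * `|h| ^+ 2.
      apply: le_trans (dot_le_norm _ _) _; rewrite /K -!mulrA ler_wpM2l //.
      rewrite (le_trans (ler_wpM2l (normr_ge0 _) (norm_mulmx _ _))) // expr2.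
      by rewrite le_eqVlt; apply/orP; left; apply/eqP; ring.
    have := ler_pM (normr_ge0 _) (normr_ge0 _) hi hh.
    have := mulr_ge0 (normr_ge0 (h i 0)) (normr_ge0 (dot h (hess p z *m h))).
    lra.
  rewrite normrM -mulrA ler_pM ?hC // (le_trans (ler_normD _ _)) //.
  by rewrite lerD ?coord_le_norm // (le_trans (coord_le_norm _ _ _)).
Qed.

Lemma ev_taylor p z : taylor_at (ev p) z (grad p z) (hess p z).
Proof.
have [C C0 hC] := ev_taylor3 p z => e e0.
have e1 : 0 < e / (1 + C) by rewrite divr_gt0 // ltr_wpDr.
exists (Num.min 1 (e / (1 + C))); first by rewrite lt_min ltr01.
move=> h; rewrite lt_min => /andP[h1 h2].
apply: le_trans (hC _ (ltW h1)) _.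
have := normM_le_dot h; rewrite exprS mulrA => hd.
have hC' : C * `|h| <= e.
  move: h2; rewrite ltr_pdivlMr ?ltr_wpDr //.
  have := normr_ge0 h; nra.
by apply: ler_pM => //; rewrite mulr_ge0.
Qed.

End PolynomialTaylor.

(** * Compactness and the maximum principle on the unit ball *)

Section Compactness.
Variables (R : realType).

Lemma trmx_continuous m n : continuous (fun A : 'M[R]_(m, n) => A^T).
Proof.
move=> A; apply: continuous_for_eps => e e0; exists e => // B.
by rewrite -linearB /= norm_trmx => /ltW.
Qed.

Lemma cV_compact n (A : set 'cV[R]_n) M :
  closed A -> (forall z, A z -> `|z| <= M) -> compact A.
Proof.
move=> cA bA.
have -> : A = trmx @` [set z : 'rV[R]_n | A z^T].
  apply/seteqP; split => [z Az|_ [z Az <-]] //.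
  by exists z^T; rewrite /= ?trmxK.
apply: continuous_compact.
  by apply/continuous_subspaceT => ?; exact: trmx_continuous.
apply: bounded_closed_compact.
  exists M; split; first exact: num_real.
  by move=> x Mx z /= /bA; rewrite norm_trmx => /le_trans; apply; exact: ltW.
by apply: (@closed_comp _ _ trmx) => // z _; exact: trmx_continuous.
Qed.

Lemma dot_continuous n : continuous (fun z : 'cV[R]_n => dot z z).
Proof.
have -> : (fun z : 'cV[R]_n => dot z z) = ev (msqnorm R n).
  by apply/funext => z; rewrite ev_msqnorm.
by move=> z; exact: taylor_at_cont (ev_taylor _ _).
Qed.

Lemma ball_norm_le1 n (z : 'cV[R]_n) : dot z z <= 1 -> `|z| <= 1.
Proof.
move=> z1; rewrite -(@ler_pXn2r _ 2) ?nnegrE // expr1n.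
exact: le_trans (normM_le_dot z) z1.
Qed.

Lemma unit_ball_compact n : compact [set z : 'cV[R]_n | dot z z <= 1].
Proof.
apply: (@cV_compact _ _ 1) => [|z]; last exact: ball_norm_le1.
apply: (@closed_comp _ _ (fun z : 'cV[R]_n => dot z z) [set x | x <= 1]).
  by move=> z _; exact: dot_continuous.
exact: closed_le.
Qed.

Lemma taylor_quadratic n (a : R) (H : 'M[R]_n) z : H^T = H ->
  taylor_at (fun x => a * dot x (H *m x)) z ((2 * a) *: (H *m z)) ((2 * a) *: H).
Proof.
move=> Hs e e0; exists 1 => // h _.
rewrite mulmxDr -!scalemxAl !dotlin (dotC (H *m z)) (dot_mulmxr H h) Hs (dotC (H *m h) z).
set x := (X in `|X|); have -> : x = 0 by rewrite /x; field.
by rewrite normr0 mulr_ge0 ?dot_ge0 // ltW.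
Qed.

(* In the interior the maximum is excluded because the Hessian there would be
   nonpositive, against the positive trace. *)
Lemma ball_max_principle n (phi : 'cV[R]_n -> R) G H tau M : (0 < n)%N -> 0 < tau ->
  (forall z, dot z z <= 1 -> taylor_at phi z (G z) (H z) /\ tau <= \tr (H z)) ->
  (forall z, dot z z = 1 -> phi z <= M) ->
  phi 0 <= M - tau / (4 * n%:R).
Proof.
(* Subtracting a |x|^2 lowers the trace by 2 a n = tau/2, so it stays positive, and lowers the
   values on the sphere by a, which is the gain in the conclusion. *)
move=> n0 tau0 T bd; set a := tau / _.
have n0' : 0 < n%:R :> R by rewrite ltr0n.
have a0 : 0 < a by rewrite divr_gt0 // mulr_gt0.
pose psi z := phi z + (- a) * dot z (1%:M *m z).
have Tpsi z : dot z z <= 1 -> taylor_at psi z (G z + (2 * - a) *: (1%:M *m z))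
    (H z + (2 * - a) *: 1%:M).
  move=> z1; apply: taylor_atD; first by case: (T _ z1).
  by apply: taylor_quadratic; rewrite trmx1.
have [||c] := @compact_EVT_max _ _ psi _ _ (@unit_ball_compact n).
- by exists 0; rewrite /= dot0l.
- apply: continuous_in_subspaceT => z; rewrite inE => /Tpsi.
  exact: taylor_at_cont.
rewrite inE /= => c1 cmax.
have := cmax 0; rewrite inE /= dot0l ler01 => /(_ isT).
rewrite {1}/psi mulmx0 dot0l mulr0 addr0 => /le_trans; apply.
move: c1; rewrite le_eqVlt => /orP[/eqP c1|c1].
  by rewrite /psi mul1mx c1 mulr1 lerD2r bd.
exfalso.
have Hc v : dot v ((H c + (2 * - a) *: 1%:M) *m v) <= 0.
  apply: (taylor_second_diff (Tpsi _ (ltW c1))).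
  have d0 : 0 < 1 + `|2 * dot c v| + dot v v.
    by rewrite addrAC ltr_wpDr // ltr_wpDr ?dot_ge0.
  exists (Num.min 1 ((1 - dot c c) / (1 + `|2 * dot c v| + dot v v))).
    by rewrite lt_min ltr01 divr_gt0 ?subr_gt0.
  move=> s; rewrite lt_min => /and3P[s0 s1]; rewrite ltr_pdivlMr // => s2.
  rewrite mul0r subr_le0.
  have := ler_norm (2 * dot c v); have := ler_norm (- (2 * dot c v)).
  rewrite normrN => n1 n2; have v0 := dot_ge0 v.
  have ss : s ^+ 2 * dot v v <= s * dot v v by apply: ler_wpM2r => //; rewrite expr2; nra.
  have A b : b ^+ 2 = 1 -> psi (c + (b * s) *: v) <= psi c.
    move=> b2; apply: cmax; rewrite inE /= !dotlin (dotC v c).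
    have : b * (2 * dot c v) <= `|2 * dot c v|.
      have /orP[/eqP->|/eqP->] : (b == 1) || (b == -1) by rewrite -sqrf_eq1 b2.
        by rewrite mul1r.
      by rewrite mulN1r.
    have : (b * s) * (b * s * dot v v) = s ^+ 2 * dot v v.
      by rewrite -[RHS]mul1r -b2; ring.
    nra.
  have N1 : (-1 : R) ^+ 2 = 1 by rewrite sqrrN expr1n.
  have := A 1 (expr1n _ _); have := A (-1) N1.
  by rewrite mul1r mulN1r scaleNr; lra.
have : \tr (H c + (2 * - a) *: 1%:M) <= 0.
  rewrite /mxtrace sumr_le0 // => i _.
  have := Hc (delta_mx i 0); rewrite -colE dotE (bigD1 i) //= big1 ?addr0.
    by rewrite !mxE !eqxx mul1r.
  by move=> j /negbTE ji; rewrite mxE ji mul0r.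
rewrite linearD linearZ /= mxtrace1; have [_] := T _ (ltW c1).
have -> : 2 * - a * n%:R = - (tau / 2).
  by rewrite /a; field; rewrite gt_eqF.
lra.
Qed.

End Compactness.

(** * Bernstein approximation with nodes independent of the function *)

Section Bernstein.
Variables (R : realType) (n : nat).
Local Notation P := (mpoly n R).
Implicit Types (x y : 'cV[R]_n) (s : seq 'I_n) (f g : 'cV[R]_n -> R).

(* Expectation of [f] along a random walk from [y] with independent steps
   [+- delta e_i], [i] running through [s], of mean [delta x_i e_i]: for [s]
   made of [N] copies of each index and [delta = 1 / N] this is a tensor
   Bernstein polynomial of [f] on the cube [[-1, 1]^n]. *)
Fixpoint walk (delta : R) x s f y : R :=
  if s is i :: s' then
    (1 + x i 0) / 2 * walk delta x s' f (y + delta *: delta_mx i 0)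
    + (1 - x i 0) / 2 * walk delta x s' f (y - delta *: delta_mx i 0)
  else f y.

Let half_ge0 x i : `|x| <= 1 -> 0 <= (1 + x i 0) / 2 /\ 0 <= (1 - x i 0) / 2.
Proof.
move=> x1; have := le_trans (coord_le_norm x i 0) x1; rewrite ler_norml; lra.
Qed.

Let norm_step (delta : R) i : 0 <= delta ->
  `|delta *: delta_mx i 0 : 'cV[R]_n| <= delta.
Proof.
move=> d0; rewrite normrZ ger0_norm // ler_piMr //.
apply: norm_le_coord => // j l; rewrite mxE.
by case: (_ && _); rewrite ?normr1 ?normr0.
Qed.

Let step_bound (delta : R) y y' w (k : nat) : `|w| <= delta ->
  `|y' - (y + w)| <= delta * k%:R -> `|y' - y| <= delta * k.+1%:R.
Proof.
move=> d0 hy; rewrite -natr1 mulrDr mulr1.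
have -> : y' - y = (y' - (y + w)) + w by rewrite opprD addrA subrK.
by rewrite (le_trans (ler_normD _ _)) // lerD.
Qed.

Lemma walk_le delta x s f g y : 0 <= delta -> `|x| <= 1 ->
  (forall y', `|y' - y| <= delta * (size s)%:R -> f y' <= g y') ->
  walk delta x s f y <= walk delta x s g y.
Proof.
move=> d0 x1; elim: s y => [|i s IH] y fg /=.
  by apply: fg; rewrite subrr normr0 mulr0.
have [p0 p1] := half_ge0 i x1.
by rewrite lerD // ler_wpM2l // IH // => y' hy; apply: fg; apply: step_bound hy;
  rewrite ?normrN norm_step.
Qed.

Lemma walk_affine delta x s f a b y :
  walk delta x s (fun y' => a + b * f y') y = a + b * walk delta x s f y.
Proof. by elim: s y => //= i s IH y; rewrite !IH; field. Qed.

(** Squared bias plus variance: the mean end point is y + delta times the sum of x_i e_i, and the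
    independent steps contribute delta^2 (1 - x_i^2) each. *)
Lemma walk_sqr delta x s y :
  walk delta x s (fun y' => dot (y' - x) (y' - x)) y =
  (let m := y + delta *: \sum_(i <- s) x i 0 *: delta_mx i 0 - x in dot m m)
  + delta ^+ 2 * \sum_(i <- s) (1 - x i 0 ^+ 2).
Proof.
elim: s y => [|i s IH] y /=; first by rewrite !big_nil scaler0 mulr0 !addr0.
rewrite !IH /= !big_cons scalerDr.
set m := delta *: \sum_(_ <- _) _; set S := \sum_(_ <- _) _; set e := delta_mx i 0.
have -> : y + delta *: e + m - x = (y + m - x) + delta *: e.
  by rewrite (addrAC y) (addrAC (y + m)).
have -> : y - delta *: e + m - x = (y + m - x) - delta *: e.
  by rewrite (addrAC y) (addrAC (y + m)).
have -> : y + (delta *: (x i 0 *: e) + m) - x = (y + m - x) + delta *: (x i 0 *: e).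
  by rewrite addrCA -addrA addrC.
move: (y + m - x) => w; rewrite !dotlin (dotC e w).
have -> : dot e e = 1.
  rewrite dotE (bigD1 i) //= mxE !eqxx mulr1 big1 ?addr0 // => j /negbTE ji.
  by rewrite mxE ji mul0r.
by field.
Qed.

(** The nodes and their weight polynomials depend neither on [f] nor on [x]: the walk is polynomial
    in [x] and linear in [f], which later makes derivative bounds uniform in [f]. *)
Lemma walk_linear delta s y : 0 <= delta ->
  exists l : seq ('cV[R]_n * P),
    (forall a, a \in l -> `|a.1 - y| <= delta * (size s)%:R) /\
    forall x f, walk delta x s f y = \sum_(a <- l) f a.1 * ev a.2 x.
Proof.
move=> d0; elim: s y => [|i s IH] y.
  exists [:: (y, 1)]; split => [a|x f].
    by rewrite inE => /eqP->; rewrite subrr normr0 mulr0.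
  by rewrite big_seq1 ev1 mulr1.
have [l1 [b1 h1]] := IH (y + delta *: delta_mx i 0).
have [l2 [b2 h2]] := IH (y - delta *: delta_mx i 0).
exists ([seq (a.1, 2^-1 *: ((1 + mvar R i) * a.2)) | a <- l1] ++
        [seq (a.1, 2^-1 *: ((1 - mvar R i) * a.2)) | a <- l2]); split.
  move=> a; rewrite mem_cat => /orP[] /mapP[a' /[swap] -> /=].
    by move=> /b1; apply: step_bound; rewrite norm_step.
  by move=> /b2; apply: step_bound; rewrite normrN norm_step.
move=> x f /=; rewrite h1 h2 big_cat !big_map /= !mulr_sumr.
congr (_ + _); apply: eq_bigr => a _.
  by rewrite evZ evM evD ev1 ev_mvar; field.
by rewrite evZ evM evD evN ev1 ev_mvar; field.
Qed.

Lemma bernstein_approx L eps : 0 <= L -> 0 < eps ->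
  exists2 l : seq ('cV[R]_n * P), (forall a, a \in l -> `|a.1| <= n%:R) &
  forall f, (forall y y', `|y| <= n%:R -> `|y'| <= n%:R ->
      `|f y - f y'| <= L * `|y - y'|) ->
    forall x, `|x| <= 1 -> `|\sum_(a <- l) f a.1 * ev a.2 x - f x| <= eps.
Proof.
(* At distance w from x the error is at most L w <= eps/2 + L^2 w^2 / (2 eps). The mean of w^2 is at
   most n/N, so N >= K keeps the mean of the second term below eps/2. The radius n of the nodes is
   the triangle inequality for N n steps of length 1/N. *)
move=> L0 e0; pose K := L ^+ 2 * n%:R / eps ^+ 2.
have K0 : 0 <= K by rewrite /K divr_ge0 ?sqr_ge0 // mulr_ge0 ?sqr_ge0.
have [N NK N0] : exists2 N : nat, K <= N%:R & 0 < N%:R :> R.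
  by exists (Num.truncn K).+1; rewrite ?ltr0n // ltW // truncnS_gt.
pose s := flatten [seq nseq N i | i <- enum 'I_n].
have sums (V : zmodType) (F : 'I_n -> V) : \sum_(i <- s) F i = (\sum_i F i) *+ N.
  rewrite big_flatten big_map big_enum /= -sumrMnl; apply: eq_bigr => i _.
  by rewrite big_nseq iter_addr_0.
have sizes : (N%:R^-1 * (size s)%:R = n%:R :> R).
  have -> : size s = (n * N)%N.
    rewrite size_flatten /shape -map_comp sumnE big_map enumT.
    rewrite (eq_bigr (fun=> N)) => [|i _]; last exact: size_nseq.
    by rewrite sum_nat_const card_ord.
  by rewrite natrM mulrCA mulVf ?mulr1 // gt_eqF.
have dN : 0 <= N%:R^-1 :> R by rewrite invr_ge0.
have [l [bl hl]] := walk_linear s 0 dN.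
exists l => [a /bl|f fL x x1]; first by rewrite subr0 sizes.
rewrite -hl.
have W0 : walk N%:R^-1 x s (fun y' => dot (y' - x) (y' - x)) 0 <= n%:R / N%:R.
  rewrite walk_sqr /= !sums add0r.
  have -> : N%:R^-1 *: ((\sum_i x i 0 *: delta_mx i 0) *+ N) - x = 0 :> 'cV[R]_n.
    rewrite -scaler_nat scalerA mulVf ?gt_eqF // scale1r; apply/eqP.
    rewrite subr_eq0; apply/eqP/colP => j; rewrite summxE (bigD1 j) //= big1.
      by rewrite !mxE !eqxx mulr1 addr0.
    by move=> i /negbTE ij; rewrite !mxE eq_sym ij mulr0.
  rewrite dot0l add0r -[X in _ * X]mulr_natr expr2 mulrACA mulVf ?gt_eqF // mulr1.
  rewrite mulrC ler_wpM2r // -[X in _ <= X%:R](card_ord n) -sumr_const.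
  by rewrite ler_sum // => i _; rewrite gerBl sqr_ge0.
have xn : forall y', `|y' - 0| <= N%:R^-1 * (size s)%:R ->
    `|f y' - f x| <= eps / 2 + L ^+ 2 / (2 * eps) * dot (y' - x) (y' - x).
  move=> y'; rewrite subr0 sizes => y'n.
  have [n0|n0] := posnP n.
    have -> : y' = x by apply/colP => i; have := ltn_ord i; rewrite {2}n0 ltn0.
    by rewrite !subrr normr0 dot0l mulr0 addr0 divr_ge0 // ltW.
  apply: le_trans (fL _ _ y'n _) _.
    by apply: le_trans x1 _; rewrite ler1n.
  have := normM_le_dot (y' - x); set D := dot _ _; set w := `|_| => wD.
  have : L ^+ 2 / (2 * eps) * w ^+ 2 <= L ^+ 2 / (2 * eps) * D.
    by rewrite ler_wpM2l // divr_ge0 ?sqr_ge0 // mulr_ge0 // ltW.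
  have : 0 <= (eps - L * w) ^+ 2 / (2 * eps).
    by rewrite divr_ge0 ?sqr_ge0 // mulr_ge0 // ltW.
  have -> : (eps - L * w) ^+ 2 / (2 * eps) = eps / 2 - L * w + L ^+ 2 / (2 * eps) * w ^+ 2.
    by field; rewrite gt_eqF.
  lra.
have W1 : eps / 2 + L ^+ 2 / (2 * eps) *
    walk N%:R^-1 x s (fun y' => dot (y' - x) (y' - x)) 0 <= eps.
  have : L ^+ 2 / (2 * eps) * walk N%:R^-1 x s (fun y' => dot (y' - x) (y' - x)) 0
      <= L ^+ 2 / (2 * eps) * (n%:R / N%:R).
    by rewrite ler_wpM2l // divr_ge0 ?sqr_ge0 // mulr_ge0 // ltW.
  have -> : L ^+ 2 / (2 * eps) * (n%:R / N%:R) = K / N%:R * (eps / 2).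
    by rewrite /K; field; rewrite !gt_eqF.
  have : K / N%:R * (eps / 2) <= eps / 2.
    by rewrite ler_piMl ?divr_ge0 ?(ltW e0) // ler_pdivrMr // mul1r.
  lra.
have up := @walk_le N%:R^-1 x s f (fun y' => (f x + eps / 2) +
  L ^+ 2 / (2 * eps) * dot (y' - x) (y' - x)) 0 dN x1.
have lo := @walk_le N%:R^-1 x s (fun y' => (f x - eps / 2) +
  (- (L ^+ 2 / (2 * eps))) * dot (y' - x) (y' - x)) f 0 dN x1.
rewrite !walk_affine in up lo.
rewrite ler_distl; apply/andP; split.
  apply: le_trans (lo _); first lra.
  by move=> y' /xn; rewrite ler_distl => /andP[]; lra.
apply: le_trans (up _) _; last lra.
by move=> y' /xn; rewrite ler_distl => /andP[]; lra.
Qed.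

End Bernstein.

(** * The Dirichlet problem on the ball with polynomial data *)

Section Dirichlet.
Variables (R : realType) (n : nat).
Hypothesis n_gt0 : (0 < n)%N.
Local Notation P := (mpoly n R).

Lemma ev_derivatives_bounded (p : P) : exists2 C : R, 0 <= C &
  forall z, `|z| <= 1 -> `|grad p z| <= C /\ `|hess p z| <= C.
Proof.
have H1 i : exists D : R, 0 <= D /\ forall z, `|z| <= 1 -> `|ev (pder i p) z| <= D.
  by have [C C0 hC] := @ev_bounded R n (pder i p) 1 ler01; exists C.
have H2 (i : 'I_n * 'I_n) : exists D : R, 0 <= D /\
    forall z, `|z| <= 1 -> `|ev (pder i.1 (pder i.2 p)) z| <= D.
  by have [C C0 hC] := @ev_bounded R n (pder i.1 (pder i.2 p)) 1 ler01; exists C.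
have [D1 h1] := choice H1; have [D2 h2] := choice H2.
have S1 : 0 <= \sum_i D1 i by rewrite sumr_ge0 // => i _; case: (h1 i).
have S2 : 0 <= \sum_i D2 i by rewrite sumr_ge0 // => i _; case: (h2 i).
exists (\sum_i D1 i + \sum_i D2 i) => [|z z1]; first exact: addr_ge0.
split; apply: norm_le_coord; rewrite ?addr_ge0 // => i j; rewrite mxE.
  apply: le_trans ((h1 i).2 _ z1) _; rewrite (bigD1 i) //= -addrA lerDl.
  by rewrite addr_ge0 // sumr_ge0 // => k _; case: (h1 k).
apply: le_trans ((h2 (i, j)).2 _ z1) _; rewrite addrC (bigD1 (i, j)) //= -addrA lerDl.
by rewrite addr_ge0 // sumr_ge0 // => k _; case: (h2 k).
Qed.

(** Each weight polynomial is made harmonic once and for all by subtracting a multiple of 1 - |x|^2;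
    [f] enters only through coefficients bounded by [B]. *)
Lemma dirichlet_combination (l : seq ('cV[R]_n * P)) (B : R) : 0 <= B ->
  exists2 C : R, 0 <= C & forall f : 'cV[R]_n -> R,
    (forall a, a \in l -> `|f a.1| <= B) ->
  exists Psi : P, [/\ mlap Psi = 0,
    forall z, dot z z = 1 -> ev Psi z = \sum_(a <- l) f a.1 * ev a.2 z &
    forall z, `|z| <= 1 -> `|grad Psi z| <= C /\ `|hess Psi z| <= C].
Proof.
move=> B0; elim: l => [|[a p] l [C C0 IH]].
  exists 0 => // f _; exists 0; split => [|z _|z _]; first exact: mlap0.
    by rewrite big_nil ev0.
  by rewrite grad0 hess0 !normr0.
have [q hq] := mlap_ball_surj (mlap p) n_gt0.
pose hp := p - (1 - msqnorm R n) * q.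
have [D D0 hD] := ev_derivatives_bounded hp.
exists (B * D + C) => [|f hf]; first by rewrite addr_ge0 ?mulr_ge0.
have [b hb|Psi [Psi0 Psi1 Psi2]] := IH f; first by apply: hf; rewrite inE hb orbT.
have fa : `|f a| <= B by apply: (hf (a, p)); rewrite inE eqxx.
exists (f a *: hp + Psi); split => [|z z1|z /[dup] z1 /Psi2 [g1 g2]].
- by rewrite mlapD mlapZ mlapB hq subrr scaler0 add0r.
- rewrite big_cons /= evD evZ Psi1 // evD evN evM evD evN ev1 ev_msqnorm z1.
  by rewrite subrr mul0r subr0.
- have [h1 h2] := hD _ z1.
  rewrite gradD gradZ hessD hessZ; split; rewrite (le_trans (ler_normD _ _)) //;
    by rewrite lerD // normrZ ler_pM.
Qed.

(** [C] comes before [f]: the functions to be approximated change with the blow-up scale, while the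
    derivatives of [Psi] have to stay bounded. The constant Laplacian comes from c (1 - |x|^2) q,
    where (1 - |x|^2) q has Laplacian 1. *)
Lemma dirichlet_approx (L B c eps : R) : 0 <= L -> 0 <= B -> 0 < eps ->
  exists2 C : R, 0 <= C & forall f : 'cV[R]_n -> R,
    (forall y, `|y| <= n%:R -> `|f y| <= B) ->
    (forall y y', `|y| <= n%:R -> `|y'| <= n%:R -> `|f y - f y'| <= L * `|y - y'|) ->
  exists Psi : P, [/\ mlap Psi = c *: 1,
    forall z, dot z z = 1 -> `|ev Psi z - f z| <= eps &
    forall z, `|z| <= 1 -> `|grad Psi z| <= C /\ `|hess Psi z| <= C].
Proof.
move=> L0 B0 e0; have [l bl hl] := bernstein_approx n L0 e0.
have [C C0 hC] := dirichlet_combination l B0.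
have [q hq] := mlap_ball_surj (1 : P) n_gt0.
have [D D0 hD] := ev_derivatives_bounded ((1 - msqnorm R n) * q).
exists (C + `|c| * D) => [|f fB fL]; first by rewrite addr_ge0 ?mulr_ge0.
have [a /bl /fB //|Psi [Psi0 Psi1 Psi2]] := hC f.
exists (Psi + c *: ((1 - msqnorm R n) * q)); split=> [|z z1|z /[dup] z1 /Psi2 [g1 g2]].
- by rewrite mlapD mlapZ hq Psi0 add0r.
- rewrite evD evZ Psi1 // evM evD evN ev1 ev_msqnorm z1 subrr mul0r mulr0 addr0.
  by apply: hl => //; apply: ball_norm_le1; rewrite z1.
- have [h1 h2] := hD _ z1.
  rewrite gradD gradZ hessD hessZ; split; rewrite (le_trans (ler_normD _ _)) //;
    by rewrite lerD // normrZ ler_pM.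
Qed.

End Dirichlet.

Lemma continuous_lincomb (R : realType) (T : topologicalType) (f g : T -> R) a b z :
  {for z, continuous f} -> {for z, continuous g} ->
  {for z, continuous (fun z => a * f z + b * g z)}.
Proof. by move=> cf cg; apply: cvgD; apply: cvgMr. Qed.

(** * Sup-convolutions blown up at a contact point *)

Section SupConvolution.
Variables (R : realType) (N : nat).
Variables (K : set 'cV[R]_N) (u : 'cV[R]_N -> R) (z0 p : 'cV[R]_N) (alpha : R).
Hypothesis K_compact : compact K.
Hypothesis u_cont : {within K, continuous u}.
Hypothesis Kz0 : K z0.
Hypothesis alpha_gt0 : 0 < alpha.
Hypothesis u_touch : forall z, K z ->
  u z - u z0 - dot p (z - z0) <= alpha / 2 * dot (z - z0) (z - z0).

Definition superj (z q : 'cV[R]_N) (X : 'M[R]_N) := forall eps : R, 0 < eps ->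
  exists2 r : R, 0 < r & forall z', K z' -> `|z' - z| < r ->
    u z' <= u z + dot q (z' - z) + 2^-1 * dot (z' - z) (X *m (z' - z))
            + eps * dot (z' - z) (z' - z).

(* The sup-convolution of [u] minus its tangent at [z0], blown up at [z0] by the
   factor [1 / h], is the maximum of [sc_obj h xi] over [K]. *)
Definition sc_obj (h : R) (xi z : 'cV[R]_N) : R :=
  (u z - u z0 - dot p (z - z0)) / h ^+ 2
  - 2 * alpha * dot (h^-1 *: (z - z0) - xi) (h^-1 *: (z - z0) - xi).

Definition sc_argmax (h : R) (am : 'cV[R]_N -> 'cV[R]_N) := forall xi,
  K (am xi) /\ forall z, K z -> sc_obj h xi z <= sc_obj h xi (am xi).

Lemma sc_argmax_exists h : exists am, sc_argmax h am.
Proof.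
have H xi : exists a, K a /\ forall z, K z -> sc_obj h xi z <= sc_obj h xi a.
  have [||a] := @compact_EVT_max _ _ (sc_obj h xi) K _ K_compact.
  - by exists z0.
  - have lin : continuous (fun z : 'cV[R]_N => u z0 + dot p (z - z0)).
      move=> z; apply: continuous_for_eps => e e0.
      exists (e / (1 + N%:R * `|p|)); first by rewrite divr_gt0 // ltr_wpDr ?mulr_ge0.
      move=> t; rewrite ltr_pdivlMr ?ltr_wpDr ?mulr_ge0 // => te.
      have -> : u z0 + dot p (t - z0) - (u z0 + dot p (z - z0)) = dot p (t - z).
        by rewrite !dotlin; ring.
      apply: le_trans (dot_le_norm _ _) _.
      by have := normr_ge0 (t - z); lra.
    have aff : continuous (fun z : 'cV[R]_N => h^-1 *: (z - z0) - xi).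
      move=> z; apply: continuous_for_eps => e e0.
      exists (e / (1 + `|h^-1|)); first by rewrite divr_gt0 // ltr_wpDr.
      move=> t; rewrite ltr_pdivlMr ?ltr_wpDr // => te.
      have -> : h^-1 *: (t - z0) - xi - (h^-1 *: (z - z0) - xi) = h^-1 *: (t - z).
        by rewrite opprB addrA subrK -scalerBr opprB addrA subrK.
      by rewrite normrZ; have := normr_ge0 (t - z); lra.
    have cobj : continuous (fun z : 'cV[R]_N => - h ^- 2 * (u z0 + dot p (z - z0)) +
        - (2 * alpha) * dot (h^-1 *: (z - z0) - xi) (h^-1 *: (z - z0) - xi)).
      move=> z; apply: (continuous_lincomb (lin z)).
      exact: (continuous_comp (aff z) (@dot_continuous _ _ _)).
    have -> : sc_obj h xi = fun z => h ^- 2 * u z + 1 *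
       (- h ^- 2 * (u z0 + dot p (z - z0)) +
        - (2 * alpha) * dot (h^-1 *: (z - z0) - xi) (h^-1 *: (z - z0) - xi)).
      by apply/funext => z; rewrite /sc_obj; ring.
    have cobjK := @continuous_subspaceT _ _ K _ cobj.
    by move=> z; have := @continuous_lincomb R (subspace K) _ _ (h ^- 2) 1 z
      (@u_cont z) (cobjK z).
  by rewrite inE => Ka amax; exists a; split=> // z Kz; apply: amax; rewrite inE.
by have [am ham] := choice H; exists am.
Qed.

Section Fixed.
Variables (h : R) (am : 'cV[R]_N -> 'cV[R]_N).
Hypothesis h_gt0 : 0 < h.
Hypothesis ham : sc_argmax h am.

Let W xi := sc_obj h xi (am xi).
Let eta xi := h^-1 *: (am xi - z0).

Let am_eta xi : am xi - z0 = h *: eta xi.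
Proof. by rewrite scalerA divff ?gt_eqF // scale1r. Qed.

Lemma sc_lower xi : - (2 * alpha * dot xi xi) <= W xi.
Proof.
have [_ /(_ _ Kz0)] := ham xi; apply: le_trans.
by rewrite /sc_obj !subrr scaler0 sub0r !dotlin oppr0 mul0r; lra.
Qed.

Let quad_le (a b : 'cV[R]_N) : dot a a <= 2 * dot b b + 2 * dot (a - b) (a - b).
Proof.
have := dot_ge0 (a - 2 *: b); rewrite !dotlin (dotC b a); lra.
Qed.

Let W_le_eta xi :
  W xi <= alpha / 2 * dot (eta xi) (eta xi) - 2 * alpha * dot (eta xi - xi) (eta xi - xi).
Proof.
rewrite /W /sc_obj -/(eta xi) lerD2r ler_pdivrMr ?exprn_gt0 //.
apply: le_trans (u_touch (ham xi).1) _.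
by rewrite am_eta !dotlin le_eqVlt; apply/orP; left; apply/eqP; ring.
Qed.

(** By |eta|^2 <= 2 |xi|^2 + 2 |eta - xi|^2 the touching parabola, of coefficient alpha/2, is
    absorbed by the penalty, of coefficient 2 alpha. *)
Lemma sc_upper xi : W xi <= alpha * dot xi xi.
Proof.
apply: le_trans (W_le_eta xi) _; have := quad_le (eta xi) xi.
have := dot_ge0 (eta xi - xi); have := alpha_gt0; nra.
Qed.

(** Competition with z0 bounds the maximum from below by -2 alpha |xi|^2; together with the touching
    parabola this gives |eta|^2 <= 8 |xi|^2. The maximizers thus stay within O(h) of z0 for bounded
    xi. *)
Lemma sc_argmax_bound xi : dot (am xi - z0) (am xi - z0) <= h ^+ 2 * (8 * dot xi xi).
Proof.
have -> : dot (am xi - z0) (am xi - z0) = h ^+ 2 * dot (eta xi) (eta xi).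
  by rewrite am_eta !dotlin; ring.
rewrite ler_pM2l ?exprn_gt0 //.
have := le_trans (sc_lower xi) (W_le_eta xi); have := quad_le (eta xi) xi.
have := alpha_gt0; set A := dot (eta xi) _; set B := dot xi xi.
set C := dot _ _; move=> a0 q1 q2.
have : alpha * (A / 2 - 2 * C + 2 * B) >= 0 by lra.
rewrite pmulr_rge0 //; lra.
Qed.

Lemma sc_argmax_norm xi rho : `|xi| <= rho -> `|am xi - z0| <= h * (3 * (1 + N%:R) * rho).
Proof.
move=> hxi; have rho0 : 0 <= rho by apply: le_trans hxi.
have n0 : 0 <= N%:R :> R by [].
rewrite -(@ler_pXn2r _ 2) ?nnegrE ?normr_ge0 ?mulr_ge0 ?addr_ge0 ?(ltW h_gt0) //.
apply: le_trans (normM_le_dot _) _; apply: le_trans (sc_argmax_bound _) _.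
rewrite exprMn ler_wpM2l ?sqr_ge0 //.
have : dot xi xi <= N%:R * (rho * rho).
  apply: le_trans (ler_norm _) _; apply: le_trans (dot_le_norm _ _) _.
  by rewrite ler_wpM2l // ler_pM.
have : 0 <= rho * rho by rewrite mulr_ge0.
set q := rho * rho; have -> : (3 * (1 + N%:R) * rho) ^+ 2 = 9 * (1 + N%:R) ^+ 2 * q.
  by rewrite /q; ring.
set n := N%:R in n0 *; nra.
Qed.

(** The maximizer for xi competes at xi', where only the quadratic penalty differs. The constant is
    free of [h]. *)
Lemma sc_lipschitz xi xi' rho : `|xi| <= rho -> `|xi'| <= rho ->
  `|W xi - W xi'| <= 2 * alpha * (N%:R * (8 * (1 + N%:R) * rho)) * `|xi - xi'|.
Proof.
move: xi xi'.
suff H xi xi' : `|xi| <= rho -> `|xi'| <= rho ->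
    W xi - W xi' <= 2 * alpha * (N%:R * (8 * (1 + N%:R) * rho)) * `|xi - xi'|.
  move=> xi xi' h1 h2; rewrite ler_norml lerNl opprB (H xi xi') // andbT.
  by rewrite distrC H.
move=> h1 h2; have rho0 : 0 <= rho by apply: le_trans h1.
have [_ /(_ _ (ham xi).1)] := ham xi'; rewrite -/(W xi') => hW.
apply: le_trans (lerB (lexx (W xi)) hW) _.
rewrite /W /sc_obj -/(eta xi).
have -> (a b c : R) : a - 2 * alpha * b - (a - 2 * alpha * c) = 2 * alpha * (c - b) by ring.
have -> : dot (eta xi - xi') (eta xi - xi') - dot (eta xi - xi) (eta xi - xi) =
    dot (xi - xi') (2 *: eta xi - xi - xi').
  move: (eta xi) => e; rewrite !dotlin (dotC xi e) (dotC xi' e) (dotC xi' xi); ring.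
have a20 : 0 <= 2 * alpha by rewrite mulr_ge0 // ltW.
rewrite -(mulrA (2 * alpha)) ler_wpM2l //.
apply: le_trans (ler_norm _) _; apply: le_trans (dot_le_norm _ _) _.
rewrite -(mulrA N%:R) ler_wpM2l // mulrC ler_wpM2r //.
apply: le_trans (ler_normB _ _) _.
have e1 : `|eta xi| <= 3 * (1 + N%:R) * rho.
  have := sc_argmax_norm h1; rewrite am_eta normrZ gtr0_norm //.
  by rewrite ler_pM2l.
have : `|2 *: eta xi - xi| <= 2 * `|eta xi| + `|xi|.
  by rewrite (le_trans (ler_normB _ _)) // normrZ ger0_norm.
have : 0 <= N%:R * rho by rewrite mulr_ge0.
nra.
Qed.

(** The maximizer for xi competes at xi + v and xi - v, and the second difference of the penalty is
    constant. *)
Lemma sc_semiconvex xi v :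
  - (4 * alpha * dot v v) <= W (xi + v) + W (xi - v) - 2 * W xi.
Proof.
have [_ /(_ _ (ham xi).1) h1] := ham (xi + v).
have [_ /(_ _ (ham xi).1) h2] := ham (xi - v).
apply: le_trans (lerD (lerD h1 h2) (lexx _)).
rewrite /W /sc_obj -/(eta xi).
set U := _ / h ^+ 2.
have -> : eta xi - (xi + v) = (eta xi - xi) - v by rewrite opprD addrA.
have -> : eta xi - (xi - v) = (eta xi - xi) + v by rewrite opprB addrA addrAC.
move: (eta xi - xi) => w; rewrite !dotlin (dotC v w) le_eqVlt; apply/orP; left.
by apply/eqP; ring.
Qed.

(** Moving the maximizer by h dl and xi by dl leaves the penalty unchanged, so the increment of u
    minus its tangent is at most h^2 times that of W. Since [S *m Sd = 1], the shift dl of xi is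
    realized by the shift Sd dl of the source, where [Psi] controls W. In terms of h dl the slope
    acquires a factor h and the Hessian none. *)
Lemma sc_superj D (S : 'M[R]_(N, D)) (Sd : 'M[R]_(D, N)) Psi c G H :
  S *m Sd = 1%:M -> taylor_at Psi c G H ->
  (exists2 r : R, 0 < r & forall v, `|v| < r ->
     W (S *m (c + v)) - Psi (c + v) <= W (S *m c) - Psi c) ->
  superj (am (S *m c)) (p + h *: (Sd^T *m G)) (Sd^T *m H *m Sd).
Proof.
move=> SSd T [r r0 hmax] e e0.
have D0 : 0 < 1 + D%:R * (N%:R * (N%:R * (`|Sd| * `|Sd|))) :> R.
  by rewrite ltr_wpDr ?mulr_ge0.
have [r1 r10 hT] := T _ (divr_gt0 e0 D0).
have Sd0 : 0 < 1 + N%:R * `|Sd| :> R by rewrite ltr_wpDr ?mulr_ge0.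
exists (h * (Num.min r r1 / (1 + N%:R * `|Sd|))).
  by rewrite mulr_gt0 // divr_gt0 // lt_min r0.
move=> z Kz; set z1 := am _; rewrite -ltr_pdivrMl // => hz.
have [dl dlE] : exists dl, dl = h^-1 *: (z - z1) by eexists.
have zz : z - z1 = h *: dl by rewrite dlE scalerA divff ?gt_eqF // scale1r.
have dln : `|dl| < Num.min r r1 / (1 + N%:R * `|Sd|).
  by rewrite dlE normrZ ger0_norm // invr_ge0 ltW.
have Sdl : `|Sd *m dl| < Num.min r r1.
  apply: le_lt_trans (norm_mulmx _ _) _.
  rewrite ltr_pdivlMr // in dln; apply: le_lt_trans dln.
  by have := normr_ge0 dl; lra.
move: (Sdl); rewrite lt_min => /andP[Sr Sr1].
have := hT _ Sr1; rewrite ler_norml => /andP[_ hT1].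
have := hmax _ Sr; rewrite mulmxDr mulmxA SSd mul1mx => hm.
have [_ /(_ _ Kz)] := ham (S *m c + dl); rewrite -/(W _) => hW.
have e1 : sc_obj h (S *m c + dl) z - W (S *m c) =
    (u z - u z1 - dot p (z - z1)) / h ^+ 2.
  rewrite /W /sc_obj -/z1.
  have -> : h^-1 *: (z - z0) - (S *m c + dl) = h^-1 *: (z1 - z0) - S *m c.
    have -> : h^-1 *: (z - z0) = dl + h^-1 *: (z1 - z0).
      by rewrite dlE -scalerDr addrA subrK.
    by rewrite [S *m c + dl]addrC opprD addrACA subrr add0r.
  have -> : dot p (z - z0) = dot p (z - z1) + dot p (z1 - z0).
    by rewrite -dotDr addrA subrK.
  by field; rewrite gt_eqF.
have {hm hW e1} : u z - u z1 - dot p (z - z1) <= h ^+ 2 * (Psi (c + Sd *m dl) - Psi c).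
  by rewrite -ler_pdivrMl ?exprn_gt0 // mulrC -e1; lra.
have hT2 : Psi (c + Sd *m dl) - Psi c <= dot (Sd^T *m G) dl
    + 2^-1 * dot dl (Sd^T *m H *m Sd *m dl) + e * dot dl dl.
  have -> : dot (Sd^T *m G) dl = dot G (Sd *m dl) by rewrite dot_mulmxr.
  have -> : dot dl (Sd^T *m H *m Sd *m dl) = dot (Sd *m dl) (H *m (Sd *m dl)).
    by rewrite -!mulmxA dot_mulmxr trmxK.
  have b : dot (Sd *m dl) (Sd *m dl) <= (1 + D%:R * (N%:R * (N%:R * (`|Sd| * `|Sd|)))) * dot dl dl.
    apply: le_trans (ler_norm _) _; apply: le_trans (dot_le_norm _ _) _.
    rewrite mulrDl mul1r -[leLHS]add0r lerD ?dot_ge0 //.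
    rewrite -!mulrA ler_wpM2l //.
    have := norm_mulmx Sd dl; have := normM_le_dot dl; have := normr_ge0 (Sd *m dl).
    set a := `|Sd *m dl|; set d := `|dl|; set s := `|Sd| => a0 hd ha.
    have -> : N%:R * (N%:R * (s * (s * dot dl dl))) = (N%:R * s) ^+ 2 * dot dl dl by ring.
    apply: le_trans (ler_pM a0 a0 ha ha) _.
    have -> : N%:R * (s * d) * (N%:R * (s * d)) = (N%:R * s) ^+ 2 * d ^+ 2 by ring.
    by rewrite ler_wpM2l ?sqr_ge0.
  have := ler_wpM2l (ltW (divr_gt0 e0 D0)) b.
  rewrite [X in _ <= X -> _]mulrA divfK ?gt_eqF //; lra.
rewrite zz -!scalemxAr !dotlin.
have := ler_wpM2l (ltW (exprn_gt0 2 h_gt0)) hT2.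
set A := dot (Sd^T *m G) dl; set B := dot dl (_ *m dl); set C := dot dl dl; set Q := dot p dl.
set X := h ^+ 2 * _.
have -> : h ^+ 2 * (A + 2^-1 * B + e * C) =
  h * (h * A) + 2^-1 * (h * (h * B)) + e * (h * (h * C)) by ring.
lra.
Qed.

(** At a maximum of W o S - Psi the second differences of Psi dominate those of W o S, which
    semiconvexity bounds below. On the kernel of S this makes H nonnegative. *)
Lemma sc_hess_lower D (S : 'M[R]_(N, D)) Psi c G H v :
  taylor_at Psi c G H ->
  (exists2 r : R, 0 < r & forall v, `|v| < r ->
     W (S *m (c + v)) - Psi (c + v) <= W (S *m c) - Psi c) ->
  - (4 * alpha * dot (S *m v) (S *m v)) <= dot v (H *m v).
Proof.
move=> T [r r0 hmax].
rewrite lerNl -dotNr -mulNmx; apply: (taylor_second_diff (taylor_atN T)).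
have v0 : 0 < 1 + `|v| by rewrite ltr_wpDr.
exists (r / (1 + `|v|)); first exact: divr_gt0.
move=> s /andP[s0]; rewrite ltr_pdivlMr // => sr.
have sv : `|s *: v| < r.
  by rewrite normrZ gtr0_norm // (le_lt_trans _ sr) // ler_pM2l // lerDr.
have h1 := hmax _ sv; have := hmax (- (s *: v)); rewrite normrN => /(_ sv) h2.
have := sc_semiconvex (S *m c) (s *: (S *m v)).
rewrite mulmxDr -scalemxAr in h1; rewrite mulmxBr -scalemxAr in h2.
rewrite !dotlin; lra.
Qed.

End Fixed.
End SupConvolution.

Lemma within_continuousP (R : realType) (V W : normedModType R) (A : set V) (f : V -> W) :
  {within A, continuous f} <-> (forall z, A z -> forall e : R, 0 < e ->
    exists2 d : R, 0 < d & forall t, A t -> `|t - z| < d -> `|f t - f z| <= e).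
Proof.
split=> [/subspace_continuousP cf z Az e e0|H].
  have /cvgrPdist_le /(_ e e0) := cf z Az.
  rewrite near_withinE => /nbhs_normP[d /= d0 hd]; exists d => // t At tz.
  by rewrite distrC; apply: hd => //; rewrite /ball_ /= distrC.
apply/subspace_continuousP => z Az; apply/cvgrPdist_le => /= e /(H z Az)[d d0 hd].
rewrite near_withinE; apply/nbhs_normP; exists d => //= t; rewrite /ball_ /= distrC.
by move=> tz At; rewrite distrC hd.
Qed.

Lemma unit_ball_interior (R : realType) n (y : 'cV[R]_n) : dot y y < 1 ->
  exists2 r : R, 0 < r & forall v, `|v| < r -> dot (y + v) (y + v) <= 1.
Proof.
move=> y1; pose C : R := 1 + n%:R * (2 * `|y| + 1).
have C0 : 0 < C by rewrite ltr_wpDr // mulr_ge0 // addr_ge0.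
exists (Num.min 1 ((1 - dot y y) / C)).
  by rewrite lt_min ltr01 divr_gt0 // subr_gt0.
move=> v; rewrite lt_min ltr_pdivlMr // => /andP[v1 vC].
have h1 := le_trans (ler_norm _) (dot_le_norm y v).
have h2 := le_trans (ler_norm _) (dot_le_norm v v).
have vv : n%:R * (`|v| * `|v|) <= n%:R * `|v|.
  by rewrite ler_wpM2l // ler_piMr // ltW.
have := normr_ge0 v; rewrite /C in vC; rewrite !dotlin (dotC v y); lra.
Qed.

(** * The trace inequality at a maximum in doubled variables *)

Section TraceSums.
Variable R : realType.

Lemma dot_delta n (A : 'M[R]_n) i : dot (delta_mx i 0) (A *m delta_mx i 0) = A i i.
Proof.
rewrite -colE dotE (bigD1 i) //= big1 ?addr0.
  by rewrite !mxE !eqxx mul1r.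
by move=> j /negbTE ji; rewrite mxE ji mul0r.
Qed.

(** [Sd *m S] is the orthogonal projection along the kernel of [S], and the left-hand side is the
    trace of [H] on its range. What is missing is the trace of Q H Q, with Q the projection onto the
    kernel, where [H] is nonnegative. *)
Lemma trace_projection N D (S : 'M[R]_(N, D)) (Sd : 'M[R]_(D, N)) (H : 'M[R]_D) :
  S *m Sd = 1%:M -> (Sd *m S)^T = Sd *m S ->
  (forall v, S *m v = 0 -> 0 <= dot v (H *m v)) ->
  \tr (S *m S^T *m (Sd^T *m H *m Sd)) <= \tr H.
Proof.
move=> SSd Psym ker; pose Q := 1%:M - Sd *m S.
have SQ : S *m Q = 0 by rewrite mulmxBr mulmx1 mulmxA SSd mul1mx subrr.
have QT : Q^T = Q by rewrite linearB /= trmx1 Psym.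
have QQ : Q *m Q = Q by rewrite {1}/Q mulmxBl mul1mx -mulmxA SQ mulmx0 subr0.
have -> : \tr (S *m S^T *m (Sd^T *m H *m Sd)) = \tr (Sd *m S *m H).
  rewrite mulmxA mxtrace_mulC !mulmxA -(mulmxA (Sd *m S)) -trmx_mul Psym.
  by rewrite (mulmxA (Sd *m S) Sd) -(mulmxA Sd) SSd mulmx1.
have -> : \tr H = \tr (Sd *m S *m H) + \tr (Q *m H *m Q).
  by rewrite (mxtrace_mulC _ Q) mulmxA QQ -linearD /= -mulmxDl addrC subrK mul1mx.
rewrite lerDl /mxtrace sumr_ge0 // => i _.
have := ker (Q *m delta_mx i 0); rewrite mulmxA SQ mul0mx => /(_ erefl).
by rewrite -{1}QT -dot_mulmxr !mulmxA -(mulmxA Q) dot_delta.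
Qed.

(** The Moore-Penrose inverse: a mere right inverse would give an oblique projection [Sd *m S]. *)
Lemma normal_pinv N D (S : 'M[R]_(N, D)) : S *m S^T \in unitmx ->
  exists2 Sd : 'M[R]_(D, N), S *m Sd = 1%:M & (Sd *m S)^T = Sd *m S.
Proof.
move=> U; exists (S^T *m invmx (S *m S^T)); first by rewrite mulmxA mulmxV.
by rewrite !trmx_mul trmx_inv !trmx_mul trmxK mulmxA.
Qed.

Lemma unitmx_noise N d (s : 'M[R]_(N, d)) (kappa : R) : 0 < kappa ->
  row_mx s kappa%:M *m (row_mx s kappa%:M)^T \in unitmx.
Proof.
move=> k0; set S := row_mx _ _.
rewrite -row_free_unit -kermx_eq0; apply/rowV0P => v /sub_kermxP hv.
have : dot (S^T *m v^T) (S^T *m v^T) = 0.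
  have SSv : S *m S^T *m v^T = 0.
    have SSs : (S *m S^T)^T = S *m S^T by rewrite trmx_mul trmxK.
    by rewrite -SSs -trmx_mul hv trmx0.
  by rewrite dot_mulmxr trmxK mulmxA SSv dot0l.
have := normM_le_dot (S^T *m v^T) => /[swap] -> h0.
have : S^T *m v^T = 0.
  by apply/eqP; rewrite -normr_eq0 -sqrf_eq0 eq_le h0 sqr_ge0.
rewrite -trmx_mul => /(congr1 trmx); rewrite trmxK trmx0 mul_mx_row => /(congr1 rsubmx).
rewrite row_mxKr linear0 mul_mx_scalar => /eqP; rewrite scaler_eq0 gt_eqF //=.
by move/eqP.
Qed.


Section OneSide.
Variables (N d : nat) (K : set 'cV[R]_N) (u : 'cV[R]_N -> R) (z0 p : 'cV[R]_N).
Variables (alpha c : R) (s : 'M[R]_(N, d)).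
Hypothesis N_gt0 : (0 < N)%N.
Hypothesis Kz0 : K z0.
Hypothesis alpha_gt0 : 0 < alpha.
Hypothesis u_touch : forall z, K z ->
  u z - u z0 - dot p (z - z0) <= alpha / 2 * dot (z - z0) (z - z0).

(** A lower bound in the limit, along bounded superjets whose point and slope tend to (z0, p). This
    is the form a differential inequality takes once its coefficients are frozen at z0. *)
Definition superj_trace_ge := forall eta B : R, 0 < eta -> 0 <= B ->
  exists2 r : R, 0 < r & forall z q X, K z -> `|z - z0| < r -> `|q - p| < r ->
    `|X| <= B -> X^T = X -> superj K u z q X -> c - eta <= \tr (s *m s^T *m X).

Variables (kappa tau eps : R).
Hypothesis kappa_gt0 : 0 < kappa.
Hypothesis tau_gt0 : 0 < tau.
Hypothesis eps_gt0 : 0 < eps.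
Hypothesis kappa_tau : 4 * alpha * kappa ^+ 2 * N%:R <= tau / 2.

(* The noise [kappa] makes [S] surjective, so that a test function on the source
   pushes forward to a superjet of the sup-convolution; semiconvexity bounds its
   contribution to the trace. *)
Let S : 'M[R]_(N, d + N) := row_mx s kappa%:M.

(** If W o S - Psi exceeded eps somewhere in the ball, its maximum would be interior and would give
    a superjet X of u near (z0, p). The trace of s s^T X is at least c - tau/4, and semiconvexity
    makes the noise term kappa^2 tr X at least -tau/2; by projection their sum is at most the
    Laplacian c - tau of Psi, a contradiction. The bound at 0 follows since W is nonnegative
    there. *)
Lemma sc_dirichlet : superj_trace_ge ->
  exists2 h0 : R, 0 < h0 & forall h am, 0 < h < h0 ->
    sc_argmax K u z0 p alpha h am ->
  exists Psi : mpoly (d + N) R, [/\ mlap Psi = (c - tau) *: 1,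
    - eps <= ev Psi 0 &
    forall y, dot y y = 1 ->
      ev Psi y <= sc_obj u z0 p alpha h (S *m y) (am (S *m y)) + eps].
Proof.
move=> Hc; have D0 : (0 < d + N)%N by rewrite addn_gt0 N_gt0 orbT.
have [Sd SSd Psym] := normal_pinv (unitmx_noise s kappa_gt0).
pose rho := (d + N)%:R * (`|S| * (d + N)%:R) : R.
have rho0 : 0 <= rho by rewrite !mulr_ge0.
have Srho (y : 'cV[R]_(d + N)) : `|y| <= (d + N)%:R -> `|S *m y| <= rho.
  move=> hy; apply: le_trans (norm_mulmx _ _) _.
  by rewrite ler_wpM2l // ler_wpM2l.
pose L := 2 * alpha * (N%:R * (8 * (1 + N%:R) * rho)) * ((d + N)%:R * `|S|).
have L0 : 0 <= L by rewrite !mulr_ge0 // ?addr_ge0 ?ltW.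
pose B := 2 * alpha * (N%:R * (rho * rho)).
have B0 : 0 <= B by rewrite !mulr_ge0 // ltW.
have [C C0 hC] := dirichlet_approx D0 (c - tau) L0 B0 eps_gt0.
pose BX := (d + N)%:R * ((d + N)%:R * (`|Sd^T| * C) * `|Sd|).
have BX0 : 0 <= BX by rewrite !mulr_ge0.
have tau4 : 0 < tau / 4 by rewrite divr_gt0.
have [r r0 hr] := Hc _ _ tau4 BX0.
(* [h * Z] bounds both the distance from the maximizer to z0 and that from the slope to p. *)
pose Z := 1 + 3 * (1 + N%:R) * rho + (d + N)%:R * (`|Sd^T| * C).
have Z0 : 0 < Z by rewrite /Z -addrA ltr_wpDr // addr_ge0 // !mulr_ge0 // addr_ge0.
exists (r / Z) => [|h am /andP[h0]]; first exact: divr_gt0.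
rewrite ltr_pdivlMr // => hrZ ham.
pose f y := sc_obj u z0 p alpha h (S *m y) (am (S *m y)).
have fL y y' : `|y| <= (d + N)%:R -> `|y'| <= (d + N)%:R -> `|f y - f y'| <= L * `|y - y'|.
  move=> hy hy'.
  apply: le_trans (sc_lipschitz Kz0 alpha_gt0 u_touch h0 ham (Srho _ hy) (Srho _ hy')) _.
  rewrite -mulmxBr /L -(mulrA _ (_ * `|S|)) ler_wpM2l //.
    by rewrite !mulr_ge0 // ?addr_ge0 ?ltW.
  by rewrite -mulrA norm_mulmx.
have fB y : `|y| <= (d + N)%:R -> `|f y| <= B.
  move=> hy; have := sc_lower Kz0 ham (S *m y).
  have := sc_upper alpha_gt0 u_touch h0 ham (S *m y); rewrite -/(f y).
  have : dot (S *m y) (S *m y) <= N%:R * (rho * rho).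
    apply: le_trans (ler_norm _) _; apply: le_trans (dot_le_norm _ _) _.
    by rewrite ler_wpM2l // ler_pM // Srho.
  have := dot_ge0 (S *m y); rewrite ler_norml /B.
  have := alpha_gt0; nra.
have [Psi [hlap hbd hder]] := hC f fB fL.
exists Psi; split=> //; last first.
  by move=> y /hbd; rewrite ler_norml => /andP[]; rewrite -/(f y); lra.
suff H : forall y, dot y y <= 1 -> f y - ev Psi y <= eps.
  have := H 0; rewrite dot0l ler01 => /(_ isT).
  by have := sc_lower Kz0 ham (S *m 0); rewrite -/(f 0) mulmx0 dot0l mulr0; lra.
have sub1 (y : 'cV[R]_(d + N)) : dot y y <= 1 -> `|y| <= (d + N)%:R.
  by move=> /ball_norm_le1 hy; rewrite (le_trans hy) // ler1n.
have fcont : {within [set y : 'cV[R]_(d + N) | dot y y <= 1], continuous f}.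
  apply/within_continuousP => y y1 e e0; exists (e / (1 + L)).
    by rewrite divr_gt0 // ltr_wpDr.
  move=> t t1; rewrite ltr_pdivlMr ?ltr_wpDr // => ty.
  have := fL _ _ (sub1 _ t1) (sub1 _ y1); have := normr_ge0 (t - y).
  by lra.
have Pcont : {within [set y : 'cV[R]_(d + N) | dot y y <= 1], continuous (ev Psi)}.
  by apply: continuous_subspaceT => y; exact: taylor_at_cont (ev_taylor _ _).
have [||y0] := @compact_EVT_max _ _ (fun y => 1 * f y + (-1) * ev Psi y) _ _
    (@unit_ball_compact R (d + N)).
- by exists 0; rewrite /= dot0l.
- by move=> y; have := @continuous_lincomb R (subspace _) _ _ 1 (-1) y (fcont y) (Pcont y).
rewrite inE /= => y01 ymax y y1.
have {}ymax t : dot t t <= 1 -> f t - ev Psi t <= f y0 - ev Psi y0.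
  by move=> t1; have := ymax t; rewrite inE /= => /(_ t1); rewrite !mul1r !mulN1r.
apply: le_trans (ymax _ y1) _; rewrite leNgt; apply/negP => ygt.
move: y01; rewrite le_eqVlt => /orP[/eqP y01|y01].
  by have := hbd _ y01; rewrite ler_norml => /andP[]; lra.
have [r1 r10 hr1] := unit_ball_interior y01.
have lmax : exists2 r : R, 0 < r & forall v, `|v| < r ->
    f (y0 + v) - ev Psi (y0 + v) <= f y0 - ev Psi y0.
  by exists r1 => // v /hr1 /ymax.
have T := ev_taylor Psi y0.
have X := sc_superj h0 ham SSd T lmax.
have y0n := ball_norm_le1 (ltW y01); have [hg hh] := hder _ y0n.
have amr : `|am (S *m y0) - z0| < r.
  apply: le_lt_trans (sc_argmax_norm Kz0 alpha_gt0 u_touch h0 ham (Srho _ (sub1 _ (ltW y01)))) _.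
  apply: le_lt_trans hrZ; rewrite ler_pM2l // /Z addrAC lerDr addr_ge0 //.
  by rewrite !mulr_ge0.
have qr : `|p + h *: (Sd^T *m grad Psi y0) - p| < r.
  rewrite addrAC subrr add0r normrZ gtr0_norm //.
  apply: le_lt_trans hrZ; rewrite ler_pM2l //; apply: le_trans (norm_mulmx _ _) _.
  rewrite /Z -[leLHS]add0r lerD ?addr_ge0 // ?mulr_ge0 ?addr_ge0 //.
  by rewrite ler_wpM2l // ler_wpM2l.
have XB : `|Sd^T *m hess Psi y0 *m Sd| <= BX.
  apply: le_trans (norm_mulmx _ _) _; rewrite /BX ler_wpM2l // ler_wpM2r //.
  apply: le_trans (norm_mulmx _ _) _; rewrite ler_wpM2l // ler_wpM2l //.
have Xs : (Sd^T *m hess Psi y0 *m Sd)^T = Sd^T *m hess Psi y0 *m Sd.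
  by rewrite !trmx_mul trmxK hess_sym mulmxA.
have lo := hr _ _ _ (ham _).1 amr qr XB Xs X.
have ker v : S *m v = 0 -> 0 <= dot v (hess Psi y0 *m v).
  move=> Sv; have := sc_hess_lower ham v T lmax.
  by rewrite Sv dot0l mulr0 oppr0.
have := trace_projection SSd Psym ker.
have -> : \tr (hess Psi y0) = c - tau by rewrite -ev_mlap hlap evZ ev1 mulr1.
have -> : S *m S^T = s *m s^T + (kappa ^+ 2)%:M.
  rewrite tr_row_mx mul_row_col tr_scalar_mx -scalar_mxM expr2 //.
have low : - (4 * alpha * N%:R) <= \tr (Sd^T *m hess Psi y0 *m Sd).
  have -> : 4 * alpha * N%:R = \sum_(i < N) 4 * alpha.
    by rewrite sumr_const card_ord mulr_natr.
  rewrite /mxtrace -sumrN ler_sum // => i _.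
  have := sc_hess_lower ham (Sd *m delta_mx i 0) T lmax.
  rewrite mulmxA SSd mul1mx -{2}[delta_mx i 0]mul1mx dot_delta mxE eqxx mulr1.
  move=> /le_trans; apply; rewrite le_eqVlt; apply/orP; left; apply/eqP.
  by rewrite -[RHS]dot_delta -!mulmxA [RHS]dot_mulmxr trmxK.
rewrite mulmxDl linearD /= mul_scalar_mx linearZ /=.
have := ler_wpM2l (sqr_ge0 kappa) low; have := tau_gt0; have := kappa_tau.
lra.
Qed.
End OneSide.

Lemma enorm_sqr m n (A : 'M[R]_(m, n)) : enorm A ^+ 2 = \tr (A *m A^T).
Proof.
rewrite /enorm sqr_sqrtr; last by do 2! apply: sumr_ge0 => ? _; exact: sqr_ge0.
by apply: eq_bigr => i _; rewrite mxE; apply: eq_bigr => j _; rewrite mxE expr2.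
Qed.

Section Sum.
Variables (N d : nat) (K : set 'cV[R]_N) (u w : 'cV[R]_N -> R) (zu zw : 'cV[R]_N).
Variables (alpha c1 c2 : R) (s1 s2 : 'M[R]_(N, d)).
Hypothesis N_gt0 : (0 < N)%N.
Hypothesis K_compact : compact K.
Hypothesis u_cont : {within K, continuous u}.
Hypothesis w_cont : {within K, continuous w}.
Hypothesis Kzu : K zu.
Hypothesis Kzw : K zw.
Hypothesis alpha_gt0 : 0 < alpha.
Hypothesis max_uw : forall z z', K z -> K z' ->
  u z - w z' - alpha / 2 * dot (z - z') (z - z') <=
  u zu - w zw - alpha / 2 * dot (zu - zw) (zu - zw).

Let p := alpha *: (zu - zw).

(** Once the tangents of slopes p and -p are removed, only the difference of the two increments is
    left in the bound. Taking z' = zw or z = zu yields the two one-sided touching conditions. *)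
Let doubled_touch z z' : K z -> K z' ->
  u z - u zu - dot p (z - zu) + (- w z' - - w zw - dot (- p) (z' - zw)) <=
  alpha / 2 * dot ((z - zu) - (z' - zw)) ((z - zu) - (z' - zw)).
Proof.
move=> Kz Kz'; have := max_uw Kz Kz'.
have -> : z - z' = ((z - zu) - (z' - zw)) + (zu - zw).
  by apply/colP => i; rewrite !mxE; ring.
rewrite /p; move: (z - zu) (z' - zw) (zu - zw) => a b c.
by rewrite !dotlin (dotC c a) (dotC c b) (dotC b a); lra.
Qed.

Lemma trace_sums : superj_trace_ge K u zu p c1 s1 ->
  superj_trace_ge K (fun z => - w z) zw (- p) c2 s2 ->
  c1 + c2 <= 2 * alpha * enorm (s1 - s2) ^+ 2.
Proof.
move=> H1 H2; set E := enorm _ ^+ 2; rewrite leNgt; apply/negP => gap.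
pose g := c1 + c2 - 2 * alpha * E; have g0 : 0 < g by rewrite subr_gt0.
pose w' z := - w z.
have w'_cont : {within K, continuous w'}.
  by move=> z; apply: cvgN; exact: w_cont.
have u_touch z : K z ->
    u z - u zu - dot p (z - zu) <= alpha / 2 * dot (z - zu) (z - zu).
  by move=> Kz; have := doubled_touch Kz Kzw; rewrite !subrr dot0r !subr0 addr0.
have w_touch z : K z ->
    w' z - w' zw - dot (- p) (z - zw) <= alpha / 2 * dot (z - zw) (z - zw).
  move=> Kz; have := doubled_touch Kzu Kz.
  by rewrite !subrr dot0r subr0 add0r sub0r /w' !dotNl !dotNr !opprK.
(* The Laplacian of phi below is g - 2 tau = g/2. By the maximum principle this lowers phi at 0 by 8
   eps, more than the errors 2 eps on the sphere and 2 eps at the centre together. *)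
pose tau := g / 4; have tau0 : 0 < tau by rewrite divr_gt0.
have D0 : (0 < d + N)%N by rewrite addn_gt0 N_gt0 orbT.
have D0' : 0 < (d + N)%:R :> R by rewrite ltr0n.
pose eps := g / (64 * (d + N)%:R); have eps0 : 0 < eps by rewrite divr_gt0 ?mulr_gt0.
have [kappa k0 hk] : exists2 kappa : R, 0 < kappa & 4 * alpha * kappa ^+ 2 * N%:R <= tau / 2.
  have q0 : 0 < 8 * alpha * (1 + N%:R) by rewrite !mulr_gt0 // ltr_wpDr.
  exists (Num.min 1 (tau / (8 * alpha * (1 + N%:R)))).
    by rewrite lt_min ltr01 divr_gt0.
  set k := Num.min _ _.
  have k0 : 0 < k by rewrite /k lt_min ltr01 divr_gt0.
  have k1 : k <= 1 by rewrite /k ge_min lexx.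
  have : k <= tau / (8 * alpha * (1 + N%:R)) by rewrite /k ge_min lexx orbT.
  rewrite ler_pdivlMr // => hk.
  have kk : k ^+ 2 <= k by rewrite expr2 ler_piMr // ltW.
  have aN : 0 <= alpha * N%:R by rewrite mulr_ge0 // ltW.
  have : alpha * N%:R * k ^+ 2 <= alpha * N%:R * k by rewrite ler_wpM2l.
  have : 0 < k * alpha by rewrite mulr_gt0.
  lra.
have [h1 h10 H1'] := sc_dirichlet N_gt0 Kzu alpha_gt0 u_touch k0 tau0 eps0 hk H1.
have [h2 h20 H2'] := sc_dirichlet N_gt0 Kzw alpha_gt0 w_touch k0 tau0 eps0 hk H2.
pose h := Num.min h1 h2 / 2.
have m0 : 0 < Num.min h1 h2 by rewrite lt_min h10.
have h0 : 0 < h by rewrite divr_gt0.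
have hm : h < Num.min h1 h2 by rewrite ltr_pdivrMr // ltr_pMr // ltr1n.
have [hh1 hh2] : h < h1 /\ h < h2 by move: hm; rewrite lt_min => /andP[].
have [am1 ham1] := @sc_argmax_exists _ _ K u zu p alpha K_compact u_cont Kzu h.
have [am2 ham2] := @sc_argmax_exists _ _ K w' zw (- p) alpha K_compact w'_cont Kzw h.
have [||Psi1 [lap1 lo1 bd1]] := H1' h am1; rewrite ?h0 ?hh1 //.
have [||Psi2 [lap2 lo2 bd2]] := H2' h am2; rewrite ?h0 ?hh2 //.
(* Both sides use the same noise block, so it cancels in the difference. *)
pose M : 'M[R]_(N, d + N) := row_mx (s1 - s2) 0.
have SM (y : 'cV[R]_(d + N)) : row_mx s1 kappa%:M *m y - row_mx s2 kappa%:M *m y = M *m y.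
  by rewrite -mulmxBl opp_row_mx add_row_mx subrr.
pose phi y := ev (Psi1 + Psi2) y + (- alpha) * dot y (M^T *m M *m y).
have MTs : (M^T *m M)^T = M^T *m M by rewrite trmx_mul trmxK.
have Tphi y : taylor_at phi y (grad (Psi1 + Psi2) y + (2 * - alpha) *: (M^T *m M *m y))
    (hess (Psi1 + Psi2) y + (2 * - alpha) *: (M^T *m M)).
  by apply: taylor_atD; [exact: ev_taylor|exact: taylor_quadratic].
have trphi y : \tr (hess (Psi1 + Psi2) y + (2 * - alpha) *: (M^T *m M)) = g / 2.
  rewrite linearD linearZ /= -ev_mlap mlapD lap1 lap2 -scalerDl evZ ev1.
  rewrite mxtrace_mulC tr_row_mx mul_row_col mul0mx addr0 -enorm_sqr -/E.
  by rewrite /tau /g; field.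
have : phi 0 <= 2 * eps - g / 2 / (4 * (d + N)%:R).
  have g2 : 0 < g / 2 by rewrite divr_gt0.
  apply: (@ball_max_principle R (d + N) phi _ _ (g / 2) (2 * eps) D0 g2
    (fun y _ => conj (Tphi y) _)) => [y|y y1]; first by rewrite trphi.
  have b1 := bd1 _ y1; have b2 := bd2 _ y1.
  rewrite /phi evD -mulmxA dot_mulmxr trmxK -SM mulNr.
  set xi1 := row_mx s1 _ *m y in b1 *; set xi2 := row_mx s2 _ *m y in b2 *.
  (* The supremum over e1, e2 of alpha/2 |e1 - e2|^2 minus both penalties is exactly alpha |xi1 -
     xi2|^2: the two regularizations double the constant. *)
  have hs : sc_obj u zu p alpha h xi1 (am1 xi1) + sc_obj w' zw (- p) alpha h xi2 (am2 xi2)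
      <= alpha * dot (xi1 - xi2) (xi1 - xi2).
    have := doubled_touch (ham1 xi1).1 (ham2 xi2).1; rewrite /sc_obj.
    set A := u _ - _ - _; set B := _ - _ - dot (- p) _.
    set a := am1 xi1 - zu; set b := am2 xi2 - zw => hAB.
    have ae : a = h *: (h^-1 *: a) by rewrite scalerA divff ?gt_eqF // scale1r.
    have be : b = h *: (h^-1 *: b) by rewrite scalerA divff ?gt_eqF // scale1r.
    have {hAB} : A / h ^+ 2 + B / h ^+ 2 <=
        alpha / 2 * dot (h^-1 *: a - h^-1 *: b) (h^-1 *: a - h^-1 *: b).
      rewrite -mulrDl ler_pdivrMr ?exprn_gt0 //; apply: le_trans hAB _.
      rewrite {1 2}ae {1 2}be -scalerBr; move: (_ - _) => e.
      by rewrite !dotlin le_eqVlt; apply/orP; left; apply/eqP; ring.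
    move: (h^-1 *: a) (h^-1 *: b) => e1 e2.
    have -> : e1 - e2 = (xi1 - xi2) + ((e1 - xi1) - (e2 - xi2)).
      by apply/colP => i; rewrite !mxE; ring.
    move: (e1 - xi1) (e2 - xi2) (xi1 - xi2) => x y' z hAB.
    have sq1 := dot_ge0 (z - (x - y')); have sq2 := dot_ge0 (x + y').
    have : 0 <= alpha * (dot (z - (x - y')) (z - (x - y')) + 2 * dot (x + y') (x + y')).
      by rewrite mulr_ge0 ?addr_ge0 ?mulr_ge0 // ltW.
    by move: hAB; rewrite !dotlin (dotC x z) (dotC y' z) (dotC y' x); lra.
  rewrite -/w' in b2; lra.
rewrite /phi dot0l mulr0 addr0 evD.
have -> : g / 2 / (4 * (d + N)%:R) = 8 * eps.
  by rewrite /eps; field; rewrite -natrD gt_eqF.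
lra.
Qed.
End Sum.
End TraceSums.

Lemma near_within_norm (R : realType) (V : normedModType R) (A : set V) z (P : V -> Prop) :
  (\forall z' \near within A (nbhs z), P z') <->
  (exists2 r : R, 0 < r & forall z', A z' -> `|z' - z| < r -> P z').
Proof.
rewrite near_withinE; split=> [/nbhs_normP[r /= r0 hr]|[r r0 hr]].
  by exists r => // z' Az zr; apply: hr => //; rewrite /ball_ /= distrC.
by apply/nbhs_normP; exists r => //= z'; rewrite /ball_ /= distrC => zr Az; exact: hr.
Qed.

(** * Parabolic jets, and spacetime as a Euclidean space *)

Section ParabolicJets.
Variables (R : realType) (k : nat).
Local Notation spacetime := (R * 'cV[R]_k)%type.
Local Notation jet := (R * 'cV[R]_k * 'M[R]_k)%type.
Implicit Types (T : R) (u phi : spacetime -> R) (z : spacetime).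

Lemma enorm_dot n (x : 'cV[R]_n) : enorm x ^+ 2 = dot x x.
Proof.
rewrite enorm_sqr /dot mxtrace_mulC.
by rewrite /mxtrace big_ord1.
Qed.

Lemma enorm_ge0 m n (A : 'M[R]_(m, n)) : 0 <= enorm A.
Proof. exact: sqrtr_ge0. Qed.

Lemma prod_norm_lt (V W : normedModType R) (x : V * W) r :
  (`|x| < r) = (`|x.1| < r) && (`|x.2| < r).
Proof. by rewrite prod_normE gt_max. Qed.

(** The superjet inequality in epsilon form, with no remainder function and no symmetry condition,
    so that jets can be added and shifted freely. *)
Definition psuperj T u z (a : jet) := forall eps : R, 0 < eps ->
  exists2 r : R, 0 < r & forall z', strip T z' -> `|z' - z| < r ->
    u z' <= taylor2 u z a z' + eps * parabolic_gauge z z'.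

Definition ptaylor phi z (a : jet) := forall eps : R, 0 < eps ->
  exists2 r : R, 0 < r & forall z', `|z' - z| < r ->
    `|phi z' - taylor2 phi z a z'| <= eps * parabolic_gauge z z'.

Lemma parabolic_gauge_ge0 z z' : 0 <= parabolic_gauge z z'.
Proof. by rewrite addr_ge0 // sqr_ge0. Qed.

Lemma psuperj_superjet T u z p q M : strip T z -> M^T = M ->
  psuperj T u z (p, q, M) -> superjet T u z (p, q, M).
Proof.
move=> Tz Ms J; split=> //; split=> //=.
(* The positive part of the excess over the parabola serves as remainder. *)
exists (fun z' => Num.max 0 (u z' - taylor2 u z (p, q, M) z')); last first.
  apply: nearW => z'; have : u z' - taylor2 u z (p, q, M) z' <=
    Num.max 0 (u z' - taylor2 u z (p, q, M) z') by rewrite le_max lexx orbT.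
  by rewrite lerBlDl.
apply/eqoP => e e0; have [r r0 hr] := J e e0.
apply/(@near_within_norm _ spacetime); exists r => // z' Tz' zr.
have g0 := parabolic_gauge_ge0 z z'.
rewrite ger0_norm ?le_max ?lexx // (ger0_norm g0) ge_max mulr_ge0 ?(ltW e0) //=.
by rewrite lerBlDl hr.
Qed.

Lemma superjetN_subjet T u z p q M :
  superjet T (fun z => - u z) z (- p, - q, - M) -> subjet T u z (p, q, M).
Proof.
move=> [Tz [Ms [r ro hr]]]; split=> //; split=> /=.
  by move: Ms; rewrite /= linearN /= => /oppr_inj.
exists (fun z' => - r z').
  apply/eqoP => e e0; have /eqoP /(_ e e0) := ro.
  by apply: filterS => z'; rewrite normrN.
apply: filterS hr => z'; rewrite /taylor2 mulNmx !dotlin mulNr; lra.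
Qed.

Lemma limiting_superjet_superjet T u z a :
  superjet T u z a -> limiting_superjet T u z a.
Proof.
by move=> J; exists (fun=> z), (fun=> a); split=> //; exact: cvg_cst.
Qed.

Lemma limiting_subjet_subjet T u z a :
  subjet T u z a -> limiting_subjet T u z a.
Proof.
by move=> J; exists (fun=> z), (fun=> a); split=> //; exact: cvg_cst.
Qed.

Lemma psuperj_add T u phi z p q M p' q' M' :
  psuperj T (fun z => u z - phi z) z (p, q, M) -> ptaylor phi z (p', q', M') ->
  psuperj T u z (p + p', q + q', M + M').
Proof.
move=> J P e e0; have e20 : 0 < e / 2 by rewrite divr_gt0.
have [r r0 hr] := J _ e20; have [s s0 hs] := P _ e20.
exists (Num.min r s) => [|z' Tz']; first by rewrite lt_min r0.
rewrite lt_min => /andP[/(hr _ Tz') h1 /hs]; rewrite ler_norml => /andP[_ h2].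
move: h1 h2; rewrite /taylor2 mulmxDl !dotlin; lra.
Qed.

Lemma psuperj_max T u z r : 0 < r ->
  (forall z', strip T z' -> `|z' - z| < r -> u z' <= u z) -> psuperj T u z (0, 0, 0).
Proof.
move=> r0 hr e e0; exists r => // z' Tz' zr.
have -> : taylor2 u z (0, 0, 0) z' = u z by rewrite /taylor2 mul0mx !dotlin; ring.
by apply: le_trans (hr _ Tz' zr) _; rewrite lerDl mulr_ge0 ?(ltW e0) ?parabolic_gauge_ge0.
Qed.

Definition pdist2 z0 z : R := (z.1 - z0.1) ^+ 2 + dot (z.2 - z0.2) (z.2 - z0.2).

Lemma pdist2_ge0 z0 z : 0 <= pdist2 z0 z.
Proof. by rewrite addr_ge0 ?sqr_ge0 ?dot_ge0. Qed.

Lemma pdist2_norm z0 z : `|z - z0| ^+ 2 <= pdist2 z0 z.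
Proof.
rewrite prod_normE /pdist2; have [_|_] := leP `|(z - z0).1| `|(z - z0).2|.
  by apply: le_trans (normM_le_dot _) _; rewrite lerDr sqr_ge0.
by rewrite -normrX ger0_norm ?sqr_ge0 // lerDl dot_ge0.
Qed.

(** The expansion is exact in space; the remainder delta (t' - t)^2 is negligible against |t' -
    t|. *)
Lemma ptaylor_pdist2 z0 z (delta : R) : 0 <= delta -> ptaylor (fun z => delta * pdist2 z0 z) z
  (delta * (2 * (z.1 - z0.1)), (delta * 2) *: (z.2 - z0.2), (delta * 2)%:M).
Proof.
move=> d0 e e0; exists (e / (1 + delta)); first by rewrite divr_gt0 // ltr_wpDr.
move=> z'; rewrite prod_norm_lt => /andP[/= tr _].
rewrite ltr_pdivlMr ?ltr_wpDr // in tr.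
rewrite /taylor2 /pdist2 /parabolic_gauge mul_scalar_mx enorm_dot.
have -> : z'.2 - z0.2 = (z'.2 - z.2) + (z.2 - z0.2) by rewrite addrA subrK.
move: (z'.2 - z.2) (z.2 - z0.2) => x y; rewrite !dotlin (dotC y x).
have -> : z'.1 - z0.1 = (z'.1 - z.1) + (z.1 - z0.1) by rewrite addrA subrK.
move: (z'.1 - z.1) (z.1 - z0.1) tr => t s tr.
set X := (X in `|X|); have -> : X = delta * t ^+ 2 by rewrite /X; field.
rewrite normrM normrX (ger0_norm d0) mulrDr -[leLHS]addr0 lerD //; last first.
  by rewrite mulr_ge0 ?dot_ge0 // ltW.
rewrite expr2 mulrA ler_wpM2r //; have := normr_ge0 t; move: tr => /=; lra.
Qed.

Definition stvec (a : R) (x : 'cV[R]_k) : 'cV[R]_(1 + k) := col_mx a%:M x.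
Definition tpart (q : 'cV[R]_(1 + k)) : R := usubmx q 0 0.

Lemma stvecE q : q = stvec (tpart q) (dsubmx q).
Proof. by rewrite /stvec /tpart -mx11_scalar vsubmxK. Qed.

Lemma dot_stvec a b x y : dot (stvec a x) (stvec b y) = a * b + dot x y.
Proof.
by rewrite /dot /stvec tr_col_mx mul_row_col mxE tr_scalar_mx -scalar_mxM mxE eqxx.
Qed.

Lemma dot_stvecr q a x : dot q (stvec a x) = tpart q * a + dot (dsubmx q) x.
Proof. by rewrite {1}(stvecE q) dot_stvec. Qed.

Lemma stvecB a b x y : stvec a x - stvec b y = stvec (a - b) (x - y).
Proof. by rewrite /stvec opp_col_mx add_col_mx raddfB. Qed.

Lemma stvecD a b x y : stvec a x + stvec b y = stvec (a + b) (x + y).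
Proof. by rewrite /stvec add_col_mx raddfD. Qed.

Lemma norm_stvec_le a x r : `|a| <= r -> `|x| <= r -> `|stvec a x| <= r.
Proof.
move=> ar xr; apply: norm_le_coord => [|i j]; first exact: le_trans ar.
rewrite /stvec -[i]splitK; case: (fintype.split i) => i' /=.
  by rewrite col_mxEu mxE; case: (_ == _); rewrite ?mulr1n ?mulr0n ?normr0 // (le_trans _ ar).
by rewrite col_mxEd (le_trans (coord_le_norm _ _ _)).
Qed.

Lemma le_norm_stvec a x : `|a| <= `|stvec a x| /\ `|x| <= `|stvec a x|.
Proof.
split.
  have := coord_le_norm (stvec a x) (lshift k 0) 0.
  by rewrite /stvec col_mxEu mxE eqxx.
apply: norm_le_coord => // i j; have := coord_le_norm (stvec a x) (rshift 1 i) j.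
by rewrite /stvec col_mxEd.
Qed.

Lemma quad_stvec0 (X : 'M[R]_(1 + k)) x :
  dot (stvec 0 x) (X *m stvec 0 x) = dot x (drsubmx X *m x).
Proof.
rewrite -[in LHS](submxK X) /stvec mul_block_col raddf0 !mulmx0 !add0r.
by rewrite /dot tr_col_mx mul_row_col trmx0 mul0mx add0r.
Qed.

Lemma quad_stvec_split (X : 'M[R]_(1 + k)) (gam : R) : exists2 C : R, 0 <= C &
  forall a x, `|dot (stvec (a / gam) x) (X *m stvec (a / gam) x) - dot x (drsubmx X *m x)|
    <= C * (`|a| * (`|a| + `|x|)).
Proof.
pose c := (1 + k)%:R * ((1 + k)%:R * `|X|) : R.
have c0 : 0 <= c by rewrite !mulr_ge0.
have bd (v w : 'cV[R]_(1 + k)) : `|dot v (X *m w)| <= c * (`|v| * `|w|).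
  apply: le_trans (dot_le_norm _ _) _.
  have -> : c * (`|v| * `|w|) = (1 + k)%:R * (`|v| * ((1 + k)%:R * (`|X| * `|w|))).
    by rewrite /c; ring.
  by rewrite ler_wpM2l // ler_wpM2l // norm_mulmx.
pose g := `|gam^-1|; have g0 : 0 <= g by exact: normr_ge0.
exists (c * (g * (g + 2))); first by rewrite !mulr_ge0 // addr_ge0.
move=> a x; rewrite -quad_stvec0.
have -> : stvec (a / gam) x = stvec (a / gam) 0 + stvec 0 x.
  by rewrite stvecD addr0 add0r.
have n1 : `|stvec (a / gam) 0| <= g * `|a|.
  by apply: norm_stvec_le; rewrite ?normr0 ?mulr_ge0 // normrM mulrC.
have n2 : `|stvec 0 x| <= `|x| by apply: norm_stvec_le; rewrite ?normr0.
move: (stvec (a / gam) 0) (stvec 0 x) n1 n2 => v w n1 n2.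
rewrite mulmxDr !dotlin.
set Y := (Y in `|Y|).
have -> : Y = dot v (X *m v) + dot v (X *m w) + dot w (X *m v) by rewrite /Y; ring.
have vv : `|v| * `|v| <= (g * `|a|) * (g * `|a|) by rewrite ler_pM.
have vw : `|v| * `|w| <= (g * `|a|) * `|x| by rewrite ler_pM.
have h1 := le_trans (bd v v) (ler_wpM2l c0 vv).
have h2 := le_trans (bd v w) (ler_wpM2l c0 vw).
have h3 := bd w v; rewrite (mulrC `|w|) in h3; have {}h3 := le_trans h3 (ler_wpM2l c0 vw).
apply: le_trans (ler_normD _ _) _; apply: le_trans (lerD (ler_normD _ _) (lexx _)) _.
have a0 := normr_ge0 a; have x0 := normr_ge0 x.
have : 0 <= c * (g * (g * (`|a| * `|x|))) by rewrite !mulr_ge0.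
have : 0 <= c * (g * (`|a| * `|a|)) by rewrite !mulr_ge0.
lra.
Qed.

(* Spacetime as [R^(1+k)], with time measured in units of [gam]. *)
Definition stpair (gam : R) (x : 'cV[R]_(1 + k)) : spacetime := (gam * tpart x, dsubmx x).
Definition stcol (gam : R) (z : spacetime) : 'cV[R]_(1 + k) := stvec (z.1 / gam) z.2.

Lemma tpart_stvec a x : tpart (stvec a x) = a.
Proof. by rewrite /tpart /stvec col_mxKu mxE eqxx. Qed.

Lemma stcolK gam : gam != 0 -> cancel (stcol gam) (stpair gam).
Proof.
move=> g0 [t x]; rewrite /stpair /stcol tpart_stvec /stvec col_mxKd /=.
by rewrite mulrC divfK.
Qed.

Lemma stpairK gam : gam != 0 -> cancel (stpair gam) (stcol gam).
Proof.
by move=> g0 x; rewrite /stpair /stcol /= mulrAC divff // mul1r -stvecE.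
Qed.

Lemma stcolB gam z z' : stcol gam z' - stcol gam z = stvec ((z'.1 - z.1) / gam) (z'.2 - z.2).
Proof. by rewrite stvecB mulrBl. Qed.

Lemma stcol_near gam (r : R) : 0 < gam -> 0 < r ->
  exists2 s : R, 0 < s & forall z z', `|z' - z| < s -> `|stcol gam z' - stcol gam z| < r.
Proof.
move=> g0 r0; exists (r / 2 / (1 + gam^-1)).
  by rewrite !divr_gt0 // ltr_wpDr // invr_ge0 ltW.
have g1 : 0 < 1 + gam^-1 by rewrite ltr_wpDr // invr_ge0 ltW.
move=> z z'; rewrite prod_norm_lt !ltr_pdivlMr // => /andP[/= h1 h2].
have gi : 0 < gam^-1 by rewrite invr_gt0.
rewrite stcolB; apply: (@le_lt_trans _ _ (r / 2)); last by rewrite ltr_pdivrMr // ltr_pMr // ltr1n.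
have := normr_ge0 (z'.1 - z.1); have := normr_ge0 (z'.2 - z.2) => x0 t0.
apply: norm_stvec_le; last by move: h2 => /=; nra.
by rewrite normrM (gtr0_norm gi); move: h1 => /=; nra.
Qed.

(* Quadratic terms involving the time increment are negligible for the
   parabolic gauge. *)
Lemma taylor2_stcol (phi : spacetime -> R) gam q X z : 0 < gam -> forall eps : R, 0 < eps ->
  exists r : R, [/\ 0 < r, r <= 1 & forall z', `|z' - z| < r ->
    let dl := stcol gam z' - stcol gam z in
    `|phi z + dot q dl + 2^-1 * dot dl (X *m dl)
      - taylor2 phi z (tpart q / gam, dsubmx q, drsubmx X) z'| <= eps * `|z'.1 - z.1|
    /\ dot dl dl <= (1 + gam ^- 2) * parabolic_gauge z z'].
Proof.
move=> g0 e e0; have [C C0 hC] := quad_stvec_split X gam.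
exists (Num.min 1 (e / (1 + C))); split.
- by rewrite lt_min ltr01 divr_gt0 // ltr_wpDr.
- by rewrite ge_min lexx.
move=> z'; rewrite lt_min => /andP[z1]; rewrite ltr_pdivlMr ?ltr_wpDr // => ze.
rewrite stcolB /=; have := hC (z'.1 - z.1) (z'.2 - z.2).
rewrite dot_stvecr dot_stvec /taylor2 /=.
rewrite /parabolic_gauge enorm_dot.
move: z1; rewrite prod_norm_lt => /andP[/= t1 x1].
have te : `|z'.1 - z.1| * (1 + C) < e.
  by apply: le_lt_trans ze; rewrite ler_wpM2r ?addr_ge0 // prod_normE le_max lexx.
have xe : `|z'.2 - z.2| * (1 + C) < e.
  by apply: le_lt_trans ze; rewrite ler_wpM2r ?addr_ge0 // prod_normE le_max lexx orbT.
move: (z'.1 - z.1) (z'.2 - z.2) t1 x1 te xe => t x t1 x1 te xe.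
set A := dot (stvec _ _) _; set B := dot x (_ *m x) => hAB; split.
  set Y := (Y in `|Y|); have -> : Y = 2^-1 * (A - B).
    by rewrite /Y; field; rewrite gt_eqF.
  rewrite normrM ger0_norm ?invr_ge0 //.
  have t0 := normr_ge0 t; have x0 := normr_ge0 x.
  have h1 : `|t| * (C * (`|t| + `|x|)) <= `|t| * (2 * e).
    by rewrite ler_wpM2l //; lra.
  lra.
have -> : t / gam * (t / gam) = t ^+ 2 * gam ^- 2 by field; rewrite gt_eqF.
have gi : 0 <= gam ^- 2 by rewrite invr_ge0 sqr_ge0.
have d0 := dot_ge0 x.
have tt : t ^+ 2 <= `|t|.
  by rewrite -real_normK ?num_real // expr2 ler_piMr // ltW.
have := ler_wpM2r gi tt; have : 0 <= gam ^- 2 * dot x x by rewrite mulr_ge0.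
have := normr_ge0 t; lra.
Qed.

(** Near the base point the parabolic gauge dominates the squared Euclidean distance, and it
    swallows every quadratic term containing the time increment; of X only the space block
    remains. *)
Lemma superj_psuperj T (A : set spacetime) u gam x q X : 0 < gam ->
  (exists2 r : R, 0 < r & forall z', strip T z' -> `|z' - stpair gam x| < r -> A z') ->
  superj (stpair gam @^-1` A) (u \o stpair gam) x q X ->
  psuperj T u (stpair gam x) (tpart q / gam, dsubmx q, drsubmx X).
Proof.
move=> g0 [rA rA0 hA] J e e0; have gn : gam != 0 by rewrite gt_eqF.
have gi : 0 < 1 + gam ^- 2 by rewrite ltr_wpDr // invr_ge0 sqr_ge0.
have e1 : 0 < e / 2 / (1 + gam ^- 2) by rewrite !divr_gt0.
have [r r0 hr] := J _ e1; have [s s0 hs] := stcol_near g0 r0.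
have e20 : 0 < e / 2 by rewrite divr_gt0.
have [r2 [r20 _ hr2]] := @taylor2_stcol u gam q X (stpair gam x) g0 _ e20.
exists (Num.min rA (Num.min s r2)); first by rewrite !lt_min rA0 s0.
move=> z' Tz'; rewrite !lt_min => /and3P[zA zs zr].
have := hs _ _ zs; rewrite (stpairK gn) => near.
have := hr (stcol gam z'); rewrite /= (stcolK gn) => /(_ (hA _ Tz' zA) near).
have [] := hr2 _ zr; rewrite (stpairK gn) ler_norml => /andP[_ h1] h2 h3.
have h4 := ler_wpM2l (ltW e1) h2.
rewrite mulrA divfK ?gt_eqF // in h4.
have : e / 2 * `|z'.1 - (stpair gam x).1| <= e / 2 * parabolic_gauge (stpair gam x) z'.
  by rewrite ler_wpM2l ?(ltW e20) // lerDl sqr_ge0.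
rewrite /taylor2 /= in h1; lra.
Qed.

Lemma ptaylor_ev (P : mpoly (1 + k) R) z : ptaylor (fun z => ev P (stcol 1 z)) z
  (tpart (grad P (stcol 1 z)), dsubmx (grad P (stcol 1 z)), drsubmx (hess P (stcol 1 z))).
Proof.
move=> e e0; have e1 : 0 < e / 4 by rewrite divr_gt0.
have [r r0 hr] := ev_taylor P (stcol 1 z) e1.
have [s s0 hs] := stcol_near ltr01 r0.
have e20 : 0 < e / 2 by rewrite divr_gt0.
have [r2 [r20 _ hr2]] := @taylor2_stcol (fun z => ev P (stcol 1 z)) 1
  (grad P (stcol 1 z)) (hess P (stcol 1 z)) z ltr01 _ e20.
exists (Num.min s r2); first by rewrite !lt_min s0.
move=> z'; rewrite lt_min => /andP[zs zr].
have := hr _ (hs _ _ zs); rewrite [stcol 1 z + _]addrC subrK.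
have [] := hr2 _ zr; rewrite divr1 expr1n invr1 => h1 h2 h3.
have h4 := ler_wpM2l (ltW e1) h2.
have : e / 2 * `|z'.1 - z.1| <= e / 2 * parabolic_gauge z z'.
  by rewrite ler_wpM2l ?(ltW e20) // lerDl sqr_ge0.
move: h1 h3; rewrite !ler_norml => /andP[h11 h12] /andP[h31 h32] h5.
apply/andP; split; lra.
Qed.

End ParabolicJets.

(** * Euclidean and Frobenius norms *)

Section EuclideanNorm.
Variable R : realType.

Lemma cauchy_schwarz_sum (I : finType) (a b : I -> R) :
  (\sum_i a i * b i) ^+ 2 <= (\sum_i a i ^+ 2) * (\sum_i b i ^+ 2).
Proof.
set A := \sum_i a i ^+ 2; set B := \sum_i b i ^+ 2; set C := \sum_i _.
have B0 : 0 <= B by rewrite sumr_ge0 // => i _; exact: sqr_ge0.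
have : 0 <= \sum_i (B * a i - C * b i) ^+ 2.
  by rewrite sumr_ge0 // => i _; exact: sqr_ge0.
have -> : \sum_i (B * a i - C * b i) ^+ 2 = B * (A * B - C ^+ 2).
  have E x y : \sum_i (x * a i - y * b i) ^+ 2 = x ^+ 2 * A - 2 * x * y * C + y ^+ 2 * B.
    rewrite /A /C /B !mulr_sumr -sumrN -!big_split; apply: eq_bigr => i _ /=.
    by ring.
  by rewrite E; ring.
move: B0; rewrite le_eqVlt => /orP[/eqP B0 _|B0]; last by rewrite pmulr_rge0 // subr_ge0.
rewrite -B0 mulr0 (_ : C = 0) ?expr0n // /C big1 // => i _.
have /eqP : \sum_i b i ^+ 2 = 0 by [].
rewrite psumr_eq0 => [/allP /(_ i)|j _]; last exact: sqr_ge0.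
by rewrite mem_index_enum sqrf_eq0 => /(_ isT) /eqP ->; rewrite mulr0.
Qed.

Lemma enorm_pair m n (A : 'M[R]_(m, n)) :
  enorm A = Num.sqrt (\sum_(i : 'I_m * 'I_n) A i.1 i.2 ^+ 2).
Proof. by rewrite /enorm pair_bigA. Qed.

Lemma enorm_pair_sqr m n (A : 'M[R]_(m, n)) :
  enorm A ^+ 2 = \sum_(i : 'I_m * 'I_n) A i.1 i.2 ^+ 2.
Proof. by rewrite enorm_pair sqr_sqrtr // sumr_ge0 // => i _; exact: sqr_ge0. Qed.

Lemma enormD m n (A B : 'M[R]_(m, n)) : enorm (A + B) <= enorm A + enorm B.
Proof.
rewrite -(@ler_pXn2r _ 2) ?nnegrE ?addr_ge0 ?enorm_ge0 //.
rewrite sqrrD !enorm_pair_sqr.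
have -> : \sum_(i : 'I_m * 'I_n) (A + B) i.1 i.2 ^+ 2 =
    \sum_(i : 'I_m * 'I_n) A i.1 i.2 ^+ 2 +
    (\sum_(i : 'I_m * 'I_n) A i.1 i.2 * B i.1 i.2) *+ 2 +
    \sum_(i : 'I_m * 'I_n) B i.1 i.2 ^+ 2.
  rewrite -sumrMnl -!big_split; apply: eq_bigr => i _ /=.
  by rewrite mxE sqrrD.
rewrite lerD2r lerD2l lerMn2r /= (le_trans (ler_norm _)) //.
rewrite -(@ler_pXn2r _ 2) ?nnegrE ?mulr_ge0 ?enorm_ge0 // real_normK ?num_real //.
by rewrite exprMn !enorm_pair_sqr cauchy_schwarz_sum.
Qed.

Lemma enormZ m n a (A : 'M[R]_(m, n)) : enorm (a *: A) = `|a| * enorm A.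
Proof.
rewrite !enorm_pair -sqrtr_sqr -sqrtrM ?sqr_ge0 // mulr_sumr.
by congr Num.sqrt; apply: eq_bigr => i _; rewrite mxE exprMn.
Qed.

Lemma enormN m n (A : 'M[R]_(m, n)) : enorm (- A) = enorm A.
Proof. by rewrite -scaleN1r enormZ normrN1 mul1r. Qed.

Lemma enorm_tr m n (A : 'M[R]_(m, n)) : enorm A^T = enorm A.
Proof.
rewrite /enorm exchange_big; congr Num.sqrt; apply: eq_bigr => i _.
by apply: eq_bigr => j _; rewrite mxE.
Qed.

Lemma enorm_mulmx m n (A : 'M[R]_(m, n)) (v : 'cV[R]_n) :
  enorm (A *m v) <= enorm A * enorm v.
Proof.
rewrite -(@ler_pXn2r _ 2) ?nnegrE ?mulr_ge0 ?enorm_ge0 // exprMn.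
have -> : enorm v ^+ 2 = \sum_j v j 0 ^+ 2.
  by rewrite enorm_dot dotE; apply: eq_bigr => j _; rewrite expr2.
rewrite enorm_dot dotE {1}/enorm sqr_sqrtr; last first.
  by do 2! (apply: sumr_ge0 => ? _); exact: sqr_ge0.
rewrite mulr_suml ler_sum // => i _; rewrite -expr2 mxE.
exact: cauchy_schwarz_sum.
Qed.

Lemma dot_enorm n (u v : 'cV[R]_n) : `|dot u v| <= enorm u * enorm v.
Proof.
rewrite -(@ler_pXn2r _ 2) ?nnegrE ?mulr_ge0 ?enorm_ge0 // exprMn real_normK ?num_real //.
rewrite !enorm_dot !dotE; apply: le_trans (cauchy_schwarz_sum _ _) _.
by rewrite !(eq_bigr _ (fun i _ => expr2 _)).
Qed.

Lemma enorm_le_norm m n (A : 'M[R]_(m, n)) : enorm A <= (1 + (m * n)%:R) * `|A|.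
Proof.
have mn0 : 0 <= (m * n)%:R :> R by [].
rewrite -(@ler_pXn2r _ 2) ?nnegrE ?mulr_ge0 ?addr_ge0 ?enorm_ge0 //.
rewrite enorm_pair_sqr exprMn.
have : \sum_(i : 'I_m * 'I_n) A i.1 i.2 ^+ 2 <= (m * n)%:R * `|A| ^+ 2.
  have -> : (m * n)%:R * `|A| ^+ 2 = \sum_(i : 'I_m * 'I_n) `|A| ^+ 2.
    by rewrite sumr_const card_prod !card_ord mulr_natl.
  rewrite ler_sum // => i _; rewrite -[leLHS]real_normK ?num_real //.
  by rewrite ler_pXn2r ?nnegrE // coord_le_norm.
move=> /le_trans; apply; rewrite ler_wpM2r ?sqr_ge0 //; nra.
Qed.

Lemma mxtrace_norm n (A : 'M[R]_n) : `|\tr A| <= n%:R * `|A|.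
Proof.
have -> : n%:R * `|A| = \sum_(i < n) `|A| by rewrite sumr_const card_ord mulr_natl.
by rewrite (le_trans (ler_norm_sum _ _ _)) // ler_sum // => i _; exact: coord_le_norm.
Qed.

End EuclideanNorm.

(** * Bounds and moduli of continuity on compact sets *)

Section CompactStrip.
Variables (R : realType).

Lemma compact_bounded_fun (V : normedModType R) (A : set V) (f : V -> R) :
  compact A -> {within A, continuous f} ->
  exists2 B : R, 0 <= B & forall z, A z -> `|f z| <= B.
Proof.
move=> cA cf; have [->|/set0P A0] := eqVneq A set0; first by exists 0.
have [c _ hc] := compact_EVT_max A0 cA cf; have [d _ hd] := compact_EVT_min A0 cA cf.
exists (`|f c| + `|f d|) => [|z Az]; first exact: addr_ge0.
have := hc z; have := hd z; rewrite inE => /(_ Az) h1 /(_ Az) h2.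
rewrite ler_norml; have := ler_norm (f c); have := ler_norm (- f d); rewrite normrN.
have := normr_ge0 (f c); have := normr_ge0 (f d); lra.
Qed.

Lemma compact_unif_continuous (V W : normedModType R) (A : set V) (f : V -> W) :
  compact A -> {within A, continuous f} -> forall e : R, 0 < e ->
  exists2 d : R, 0 < d & forall z z', A z -> A z' -> `|z - z'| < d -> `|f z - f z'| <= e.
Proof.
move=> /compact_near_coveringP cA cf e e0.
have e2 : 0 < e / 2 by rewrite divr_gt0.
have : \forall d \near (0 : R)^'+, A `<=` [set z | A z -> forall z', A z' ->
    `|z - z'| < d -> `|f z - f z'| <= e].
  apply: (cA R (0^'+) (fun d z => A z -> forall z', A z' -> `|z - z'| < d ->
    `|f z - f z'| <= e)) => z Az.
  have [d d0 hd] := (within_continuousP A f).1 cf z Az _ e2.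
  have d20 : 0 < d / 2 by rewrite divr_gt0.
  exists (ball z (d / 2), [set r | r < d / 2]).
    by split; [exact: nbhsx_ballx|exact: nbhs_right_lt].
  move=> [x r] [/=]; rewrite -ball_normE /ball_ /= => zx rd Ax z' Az' xz'.
  have h1 : `|f x - f z| <= e / 2 by apply: hd => //; rewrite distrC; lra.
  have h2 : `|f z' - f z| <= e / 2.
    apply: hd => //; rewrite -(subrK x z') -addrA.
    rewrite (le_lt_trans (ler_normD _ _)) // (distrC z' x) (distrC x z); lra.
  rewrite -(subrK (f z) (f x)) -addrA (le_trans (ler_normD _ _)) //.
  by rewrite (distrC (f z)); lra.
move=> h; have [d /= [d0 hd]] : exists d : R, 0 < d /\ A `<=` [set z | A z ->
    forall z', A z' -> `|z - z'| < d -> `|f z - f z'| <= e].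
  have : \forall d \near (0 : R)^'+, 0 < d by exact: nbhs_right_gt.
  move=> h'; have h2 := @filterI _ (nbhs (0 : R)^'+) _ _ _ h' h.
  by have [d [d0 hd]] := @filter_ex _ (nbhs (0 : R)^'+) _ _ (h2 _); exists d.
by exists d => // z z' Az Az'; exact: hd.
Qed.

End CompactStrip.

(** * Differential inequalities near a point of the strip *)

Section LocalComparison.
Variables (R : realType) (k d : nat) (T : R).
Local Notation spacetime := (R * 'cV[R]_k)%type.
Implicit Types (z : spacetime) (q : 'cV[R]_k) (u w : spacetime -> R).
Variable sigma : spacetime -> 'M[R]_(k, d).

Definition first_order_cont (F : spacetime -> 'cV[R]_k -> R) z q :=
  forall e : R, 0 < e -> exists2 r : R, 0 < r & forall z' q', strip T z' ->
    `|z' - z| < r -> `|q' - q| < r -> `|F z' q' - F z q| <= e.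

(** All terms of order at most one sit in [F], so that inequalities for u and for -w take the same
    shape. *)
Definition psub (F : spacetime -> 'cV[R]_k -> R) u z := forall p q M, M^T = M ->
  psuperj T u z (p, q, M) ->
  0 <= p + 2^-1 * \tr (sigma z *m (sigma z)^T *m M) + F z q.

Lemma tpart_norm (x : 'cV[R]_(1 + k)) : `|tpart x| <= `|x| /\ `|dsubmx x| <= `|x|.
Proof.
rewrite [in X in _ <= X /\ _](stvecE x) [in X in _ /\ _ <= X](stvecE x).
exact: le_norm_stvec.
Qed.

Lemma tpartB (x y : 'cV[R]_(1 + k)) : tpart (x - y) = tpart x - tpart y.
Proof. by rewrite /tpart !mxE. Qed.

Lemma stpair_lip gam (x y : 'cV[R]_(1 + k)) : 0 < gam ->
  `|stpair gam x - stpair gam y| <= (1 + gam) * `|x - y|.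
Proof.
move=> g0; have [h1 h2] := tpart_norm (x - y); have n0 := normr_ge0 (x - y).
rewrite prod_normE ge_max /=; apply/andP; split.
  rewrite -mulrBr -tpartB normrM gtr0_norm //.
  have := ler_wpM2l (ltW g0) h1; lra.
rewrite -linearB /=; apply: le_trans h2 _; rewrite ler_peMl // lerDl ltW //.
Qed.

Lemma trace_col0 (s : 'M[R]_(k, d)) (X : 'M[R]_(1 + k)) :
  \tr (col_mx 0 s *m (col_mx 0 s)^T *m X) = \tr (s *m s^T *m drsubmx X).
Proof.
rewrite -[X in LHS]submxK tr_col_mx mul_col_row trmx0 !mul0mx mulmx0 mulmx_block.
by rewrite mxtrace_block !mul0mx addr0 mxtrace0 !add0r.
Qed.

Lemma enorm_col0 (s : 'M[R]_(k, d)) : enorm (col_mx (0 : 'M[R]_(1, d)) s) ^+ 2 = enorm s ^+ 2.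
Proof.
by rewrite !enorm_sqr tr_col_mx mul_col_row trmx0 !mul0mx mulmx0 mxtrace_block mxtrace0 add0r.
Qed.

Lemma trace_sigma_diff (s s' : 'M[R]_(k, d)) (M : 'M[R]_k) :
  `|\tr (s *m s^T *m M) - \tr (s' *m s'^T *m M)| <=
  k%:R * (k%:R * (d%:R * (`|s - s'| * (`|s - s'| + 2 * `|s'|)) * `|M|)).
Proof.
rewrite -linearB /= -mulmxBl; apply: le_trans (mxtrace_norm _) _.
rewrite ler_wpM2l //; apply: le_trans (norm_mulmx _ _) _.
rewrite ler_wpM2l // ler_wpM2r //.
have -> : s *m s^T - s' *m s'^T =
    (s - s') *m (s - s')^T + ((s - s') *m s'^T + s' *m (s - s')^T).
  rewrite linearB /= mulmxBr !mulmxBl mulmxBr.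
  by apply/matrixP => i j; rewrite !mxE; ring.
have h1 := norm_mulmx (s - s') (s - s')^T.
have h2 := norm_mulmx (s - s') s'^T; have h3 := norm_mulmx s' (s - s')^T.
rewrite !norm_trmx in h1 h2 h3.
apply: le_trans (ler_normD _ _) _.
have := ler_normD ((s - s') *m s'^T) (s' *m (s - s')^T); lra.
Qed.

(** In R^(1+k) the diffusion has a zero time row, so the trace sees only the space block. Freezing
    sigma and F at [zh] costs at most eta by continuity; for sigma this uses the bound B on the
    superjets. *)
Lemma superj_trace_ge_stpair (A : set spacetime) u F gam zeta p :
  0 < gam -> let zh := stpair gam zeta in
  (forall z, A z -> strip T z) ->
  (exists2 r : R, 0 < r & forall z, strip T z -> `|z - zh| < r -> A z) ->
  (exists2 r : R, 0 < r & forall z, strip T z -> `|z - zh| < r -> psub F u z) ->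
  {within strip T, continuous sigma} -> strip T zh ->
  first_order_cont F zh (dsubmx p) ->
  superj_trace_ge (stpair gam @^-1` A) (u \o stpair gam) zeta p
    (- (2 * (tpart p / gam + F zh (dsubmx p)))) (col_mx (0 : 'M[R]_(1, d)) (sigma zh)).
Proof.
move=> g0 zh AT [rA rA0 hA] [rF rF0 hF] cs Tzh cF eta B eta0 B0.
have gi : 0 < gam^-1 by rewrite invr_gt0.
have e40 : 0 < eta / 8 by rewrite divr_gt0.
have [r1 r10 hr1] := cF _ e40.
pose C := k%:R * (k%:R * (d%:R * (1 + 2 * `|sigma zh|) * B)).
have C0 : 0 <= C by rewrite !mulr_ge0 // addr_ge0.
have e41 : 0 < Num.min 1 (eta / (2 * (1 + C))).
  by rewrite lt_min ltr01 divr_gt0 // mulr_gt0 // ltr_wpDr.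
have [r2 r20 hr2] := (within_continuousP (strip T : set spacetime) sigma).1 cs zh Tzh _ e41.
pose m := Num.min (Num.min (rA / 2) rF) (Num.min r1 r2).
have m0 : 0 < m by rewrite !lt_min rF0 r10 r20 divr_gt0.
have g1 : 0 < 1 + gam by rewrite ltr_wpDr // ltW.
exists (Num.min (m / (1 + gam)) (Num.min r1 (eta / 8 / (gam^-1)))).
  by rewrite !lt_min r10 !divr_gt0.
move=> x q X Kx; rewrite lt_min ltr_pdivlMr // => /andP[xm _].
rewrite !lt_min ltr_pdivlMr // => /and3P[_ qr1 qe] XB Xs J.
have zm : `|stpair gam x - zh| < m.
  by apply: le_lt_trans (stpair_lip _ _ g0) _; rewrite mulrC.
move: zm; rewrite /m !lt_min => /andP[/andP[zA zF] /andP[z1 z2]].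
set z := stpair gam x in Kx zA zF z1 z2; have Tz : strip T z by exact: AT.
have int : exists2 r : R, 0 < r & forall z', strip T z' -> `|z' - z| < r -> A z'.
  exists (rA / 2) => [|z' Tz' zz']; first by rewrite divr_gt0.
  apply: hA => //; rewrite -(subrK z z') -addrA.
  by rewrite (le_lt_trans (ler_normD _ _)) //; lra.
have PJ := superj_psuperj g0 int J.
have Ms : (drsubmx X)^T = drsubmx X by rewrite trmx_drsub Xs.
have := hF z Tz zF _ _ _ Ms PJ.
have [_ dq] := tpart_norm (q - p); have [tq _] := tpart_norm (q - p).
have := hr1 z (dsubmx q) Tz z1; rewrite -linearB /= => /(_ (le_lt_trans dq qr1)).
have MB : `|drsubmx X| <= B.
  apply: norm_le_coord => // i j; rewrite /drsubmx !mxE.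
  exact: le_trans (coord_le_norm _ _ _) XB.
have := hr2 z Tz z2; rewrite le_min ler_pdivlMr ?mulr_gt0 ?ltr_wpDr // => /andP[s1 s2].
have sd : `|\tr (sigma z *m (sigma z)^T *m drsubmx X) -
    \tr (sigma zh *m (sigma zh)^T *m drsubmx X)| <= eta / 2.
  apply: le_trans (trace_sigma_diff _ _ _) _.
  set a := `|sigma z - _| in s1 s2 *; have a0 : 0 <= a by exact: normr_ge0.
  apply: (@le_trans _ _ (a * C)); last by lra.
  have -> : a * C = k%:R * (k%:R * (a * (d%:R * ((1 + 2 * `|sigma zh|) * B)))).
    by rewrite /C; ring.
  rewrite ler_wpM2l // ler_wpM2l //.
  have -> : d%:R * (a * (a + 2 * `|sigma zh|)) * `|drsubmx X| =
    a * (d%:R * ((a + 2 * `|sigma zh|) * `|drsubmx X|)) by ring.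
  by rewrite ler_wpM2l // ler_wpM2l // ler_pM ?addr_ge0 ?mulr_ge0 // lerD2r.
have tp : `|tpart q / gam - tpart p / gam| <= eta / 8.
  rewrite -mulrBl -tpartB normrM (gtr0_norm gi) -ler_pdivlMr //.
  by apply: ltW; apply: le_lt_trans tq qe.
rewrite trace_col0; move: tp sd; rewrite !ler_norml.
move=> /andP[t1 t2] /andP[d1 d2] /andP[f1 f2]; lra.
Qed.

Lemma prod_norm_le (V W : normedModType R) (x : V * W) r :
  (`|x| <= r) = (`|x.1| <= r) && (`|x.2| <= r).
Proof. by rewrite prod_normE ge_max. Qed.

Definition box (z0 : spacetime) (r : R) : set spacetime :=
  [set z | strip T z /\ `|z - z0| <= r].

Lemma box_compact z0 r : compact (box z0 r).
Proof.
have -> : box z0 r = `[Num.max 0 (z0.1 - r), Num.min T (z0.1 + r)] `*`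
    [set x : 'cV[R]_k | `|x - z0.2| <= r].
  apply/seteqP; split=> [[t x]|[t x]].
    move=> [[+ _]]; rewrite prod_norm_le /= => + /andP[+ xr].
    rewrite !in_itv /= ge_max le_min ler_norml => /andP[t0 tT] /andP[h1 h2].
    by split=> //; apply/andP; split; apply/andP; split=> //; lra.
  move=> [/=]; rewrite in_itv /= ge_max le_min => /andP[/andP[t0 h1] /andP[tT h2]] xr.
  split; first by split=> //=; rewrite in_itv /= t0.
  by rewrite prod_norm_le /= xr andbT ler_norml; apply/andP; split; lra.
apply: compact_setX; first exact: segment_compact.
apply: (@cV_compact _ _ _ (`|z0.2| + r)) => [|x /= xr].
  apply: (@closed_comp _ _ (fun x : 'cV[R]_k => `|x - z0.2|) [set y | y <= r]).
    move=> x _; apply: continuous_for_eps => e e0; exists e => // y /ltW; apply: le_trans.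
    by rewrite (le_trans (ler_dist_dist _ _)) // opprB addrA subrK.
  exact: closed_le.
by rewrite -(subrK z0.2 x) addrC (le_trans (ler_normD _ _)) // lerD2l.
Qed.

Lemma stcol_continuous gam : 0 < gam -> continuous (@stcol R k gam).
Proof.
move=> g0 z; apply: (@continuous_for_eps R (R * 'cV[R]_k)%type) => e e0.
by have [s s0 hs] := stcol_near k g0 e0; exists s => // t ts; apply/ltW/hs.
Qed.

Lemma stpair_box_compact gam z0 r : 0 < gam -> compact (stpair gam @^-1` box z0 r).
Proof.
move=> g0; have gn : gam != 0 by rewrite gt_eqF.
have -> : stpair gam @^-1` box z0 r = stcol gam @` box z0 r.
  apply/seteqP; split=> [x hx|_ [z hz <-]].
    by exists (stpair gam x); rewrite ?stpairK.
  by rewrite /= stcolK.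
apply: continuous_compact; last exact: box_compact.
by apply: continuous_subspaceT => z; exact: stcol_continuous.
Qed.

Lemma stpair_within gam z0 r u : 0 < gam -> {within strip T, continuous u} ->
  {within stpair gam @^-1` box z0 r, continuous (u \o stpair gam)}.
Proof.
move=> g0 /(@within_continuousP _ (R * 'cV[R]_k)%type) cu.
apply/within_continuousP => x [Tx _] e e0.
have [d' d0 hd] := cu _ Tx _ e0; have g1 : 0 < 1 + gam by rewrite ltr_wpDr // ltW.
exists (d' / (1 + gam)) => [|y [Ty _]]; first exact: divr_gt0.
rewrite ltr_pdivlMr // => yx; apply: hd => //.
by apply: le_lt_trans (stpair_lip _ _ g0) _; rewrite mulrC.
Qed.

Lemma doubling_max n (K : set 'cV[R]_n) (f g : 'cV[R]_n -> R) c :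
  compact K -> K !=set0 -> {within K, continuous f} -> {within K, continuous g} ->
  exists a b, [/\ K a, K b & forall x y, K x -> K y ->
    f x - g y - c * dot (x - y) (x - y) <= f a - g b - c * dot (a - b) (a - b)].
Proof.
move=> cK [x0 Kx0] cf cg.
have csub : continuous (fun p : 'cV[R]_n * 'cV[R]_n => p.1 - p.2).
  move=> p; apply: (@continuous_for_eps R ('cV[R]_n * 'cV[R]_n)%type) => e e0.
  exists (e / 2) => [|q]; first exact: divr_gt0.
  rewrite prod_norm_lt /= => /andP[h1 h2].
  have -> : q.1 - q.2 - (p.1 - p.2) = (q.1 - p.1) - (q.2 - p.2).
    by rewrite !opprB addrACA [RHS]addrACA; congr (_ + _); rewrite addrC.
  by rewrite (le_trans (ler_normB _ _)) //; lra.
have cdot : {within K `*` K, continuous (fun p : 'cV[R]_n * 'cV[R]_n =>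
    dot (p.1 - p.2) (p.1 - p.2))}.
  apply: continuous_subspaceT => p.
  exact: (continuous_comp (csub p) (@dot_continuous _ _ _)).
have c1 : {within K `*` K, continuous (fun p : 'cV[R]_n * 'cV[R]_n => f p.1)}.
  apply/(@within_continuousP _ ('cV[R]_n * 'cV[R]_n)%type) => p [Kp _] e e0.
  have [d' d0 hd] := (within_continuousP K f).1 cf _ Kp _ e0.
  by exists d' => // t [Kt _]; rewrite prod_norm_lt => /andP[/= h _]; exact: hd.
have c2 : {within K `*` K, continuous (fun p : 'cV[R]_n * 'cV[R]_n => g p.2)}.
  apply/(@within_continuousP _ ('cV[R]_n * 'cV[R]_n)%type) => p [_ Kp] e e0.
  have [d' d0 hd] := (within_continuousP K g).1 cg _ Kp _ e0.
  by exists d' => // t [_ Kt]; rewrite prod_norm_lt => /andP[_ /= h]; exact: hd.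
have [||m] := @compact_EVT_max _ _ (fun p : 'cV[R]_n * 'cV[R]_n =>
    1 * (1 * f p.1 + (-1) * g p.2) + (- c) * dot (p.1 - p.2) (p.1 - p.2)) _ _
    (compact_setX cK cK).
- by exists (x0, x0).
- move=> p; have h := @continuous_lincomb R (subspace (K `*` K)) _ _ 1 (-1) p (c1 p) (c2 p).
  by have := @continuous_lincomb R (subspace (K `*` K)) _ _ 1 (- c) p h (cdot p).
rewrite inE => -[Ka Kb] hm; exists m.1, m.2; split=> // x y Kx Ky.
by have := hm (x, y); rewrite inE /= => /(_ (conj Kx Ky)); lra.
Qed.

Lemma psub_shift F u z z0 (delta : R) : 0 <= delta -> psub F u z ->
  psub (fun z q => delta * (2 * (z.1 - z0.1)) +
      delta * \tr (sigma z *m (sigma z)^T) + F z (q + (delta * 2) *: (z.2 - z0.2)))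
    (fun z => u z - delta * pdist2 z0 z) z.
Proof.
move=> d0 H p q M Ms J.
have := psuperj_add J (ptaylor_pdist2 z0 z d0).
move=> /H; rewrite linearD /= Ms tr_scalar_mx => /(_ erefl).
rewrite mulmxDr linearD /= mul_mx_scalar linearZ /=; lra.
Qed.

Lemma first_order_cont_shift F z z0 q (delta : R) : 0 <= delta ->
  {within strip T, continuous sigma} -> strip T z ->
  first_order_cont F z (q + (delta * 2) *: (z.2 - z0.2)) ->
  first_order_cont (fun z q => delta * (2 * (z.1 - z0.1)) +
      delta * \tr (sigma z *m (sigma z)^T) + F z (q + (delta * 2) *: (z.2 - z0.2))) z q.
Proof.
move=> d0 cs Tz cF e e0; have e3 : 0 < e / 3 by rewrite divr_gt0.
have [r r0 hr] := cF _ e3.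
pose C := k%:R * (k%:R * (d%:R * (1 + 2 * `|sigma z|) * `|1%:M : 'M[R]_k|)).
have C0 : 0 <= C by rewrite !mulr_ge0 // addr_ge0.
have e4 : 0 < Num.min 1 (e / 3 / (1 + delta * C)).
  by rewrite lt_min ltr01 !divr_gt0 // ltr_wpDr // mulr_ge0.
have [r2 r20 hr2] := (within_continuousP (strip T : set spacetime) sigma).1 cs z Tz _ e4.
have D0 : 0 < 1 + 2 * delta by rewrite ltr_wpDr // mulr_ge0.
exists (Num.min (r / 2 / (1 + 2 * delta)) (Num.min r2 (e / 3 / (1 + 2 * delta)))).
  by rewrite !lt_min r20 !divr_gt0.
move=> z' q' Tz'; rewrite !lt_min !ltr_pdivlMr // => /and3P[zr z2 ze] /and3P[qr _ _].
have n0 := normr_ge0 (z' - z); have m0 := normr_ge0 (q' - q).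
have [t1 x1] : `|z'.1 - z.1| <= `|z' - z| /\ `|z'.2 - z.2| <= `|z' - z|.
  by rewrite prod_normE /= !le_max !lexx orbT.
have h1 : `|z' - z| < r.
  have : 0 <= `|z' - z| * (2 * delta) by rewrite mulr_ge0 // mulr_ge0.
  have : r / 2 < r by rewrite ltr_pdivrMr // ltr_pMr // ltr1n.
  by lra.
have h2 : `|q' + (delta * 2) *: (z'.2 - z0.2) - (q + (delta * 2) *: (z.2 - z0.2))| < r.
  have -> : q' + (delta * 2) *: (z'.2 - z0.2) - (q + (delta * 2) *: (z.2 - z0.2)) =
      (q' - q) + (delta * 2) *: (z'.2 - z.2).
    by apply/colP => i; rewrite !mxE; ring.
  apply: le_lt_trans (ler_normD _ _) _; rewrite normrZ ger0_norm ?mulr_ge0 //.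
  have := ler_wpM2l (mulr_ge0 d0 (ler0n R 2)) x1.
  have : 0 <= `|q' - q| * (2 * delta) by rewrite mulr_ge0 // mulr_ge0.
  lra.
have := hr _ _ Tz' h1 h2; have := hr2 _ Tz' z2.
rewrite le_min ler_pdivlMr ?ltr_wpDr ?mulr_ge0 // => /andP[s1 s2].
have sd : `|\tr (sigma z' *m (sigma z')^T) - \tr (sigma z *m (sigma z)^T)| * delta <= e / 3.
  have := trace_sigma_diff (sigma z') (sigma z) 1%:M; rewrite !mulmx1 => sd.
  set a := `|sigma z' - _| in s1 s2 sd; have a0 : 0 <= a by exact: normr_ge0.
  have : `|\tr (sigma z' *m (sigma z')^T) - \tr (sigma z *m (sigma z)^T)| <= a * C.
    apply: le_trans sd _.
    have -> : a * C = k%:R * (k%:R * (a * (d%:R * ((1 + 2 * `|sigma z|) * `|1%:M : 'M[R]_k|)))).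
      by rewrite /C; ring.
    rewrite ler_wpM2l // ler_wpM2l //.
    have -> : d%:R * (a * (a + 2 * `|sigma z|)) * `|1%:M : 'M[R]_k| =
      a * (d%:R * ((a + 2 * `|sigma z|) * `|1%:M : 'M[R]_k|)) by ring.
    by rewrite ler_wpM2l // ler_wpM2l // ler_wpM2r // lerD2r.
  by move=> /(ler_wpM2r d0); lra.
have td : `|z'.1 - z.1| * (2 * delta) <= e / 3.
  apply: le_trans (ler_wpM2r (mulr_ge0 (ler0n R 2) d0) t1) _.
  lra.
rewrite ler_norml => /andP[f1 f2]; move: sd td.
set x := \tr _ - _; set y := z'.1 - z.1 => sd td.
have := ler_norm x; have := ler_norm (- x); have := ler_norm y; have := ler_norm (- y).
rewrite !normrN => y2 y1 x2 x1'.
have := ler_wpM2r d0 x1'; have := ler_wpM2r d0 x2.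
have := ler_wpM2r d0 y1; have := ler_wpM2r d0 y2.
rewrite ler_norml /x /y => a1 a2 a3 a4.
by apply/andP; split; clear -f1 f2 sd td a1 a2 a3 a4; lra.
Qed.

End LocalComparison.

(** * Local comparison by doubling the variables *)

Section DoublingVariables.
Variables (R : realType) (k d : nat) (T : R).
Local Notation spacetime := (R * 'cV[R]_k)%type.
Implicit Types (z : spacetime) (q : 'cV[R]_k) (u w : spacetime -> R).
Variables (sigma : spacetime -> 'M[R]_(k, d)) (b : spacetime -> 'cV[R]_k) (C : R).
Hypothesis sigma_cont : {within strip T, continuous sigma}.
Hypothesis b_cont : {within strip T, continuous b}.
Hypothesis C_ge0 : 0 <= C.
Hypothesis lip : forall (t : R) x x', t \in `[0, T] ->
  enorm (b (t, x) - b (t, x')) + enorm (sigma (t, x) - sigma (t, x')) <= C * enorm (x - x').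

Lemma within_box (W : normedModType R) (f : spacetime -> W) z0 r :
  {within strip T, continuous f} -> {within box T z0 r, continuous f}.
Proof.
move=> /(@within_continuousP _ spacetime) cf.
apply/(@within_continuousP _ spacetime) => z [Tz _] e e0.
have [d' d0 hd] := cf z Tz e e0; exists d' => // t [Tt _]; exact: hd.
Qed.

Lemma box_enorm_unif m n (f : spacetime -> 'M[R]_(m, n)) z0 r e :
  {within strip T, continuous f} -> 0 < e ->
  exists2 dl : R, 0 < dl & forall z z', box T z0 r z -> box T z0 r z' ->
    `|z - z'| < dl -> enorm (f z - f z') <= e.
Proof.
move=> cf e0; have D0 : 0 < 1 + (m * n)%:R :> R by rewrite ltr_wpDr.
have [dl dl0 hd] := @compact_unif_continuous R spacetime _ _ f
  (@box_compact R k T z0 r) (within_box cf) _ (divr_gt0 e0 D0).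
exists dl => // z z' Az Az' zz'.
apply: le_trans (enorm_le_norm _) _; rewrite mulrC -ler_pdivlMr //.
exact: hd.
Qed.

Lemma trace_box_bounded z0 r :
  exists2 B : R, 0 <= B & forall z, box T z0 r z -> \tr (sigma z *m (sigma z)^T) <= B.
Proof.
have cn : {within box T z0 r, continuous (fun z => `|sigma z|)}.
  have /(@within_continuousP _ spacetime) cs := @within_box _ sigma z0 r sigma_cont.
  apply/(@within_continuousP _ spacetime) => z Az e e0.
  have [d' d0 hd] := cs z Az e e0; exists d' => // t At tz.
  exact: le_trans (ler_dist_dist _ _) (hd _ At tz).
have [B B0 hB] := @compact_bounded_fun R spacetime _ _ (@box_compact R k T z0 r) cn.
exists (((1 + (k * d)%:R) * B) ^+ 2) => [|z /hB]; first exact: sqr_ge0.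
rewrite normr_id -enorm_sqr => h.
rewrite ler_pXn2r ?nnegrE ?enorm_ge0 ?mulr_ge0 ?addr_ge0 //.
by apply: le_trans (enorm_le_norm _) _; rewrite ler_wpM2l // addr_ge0.
Qed.

Lemma dot_dsubmx_le (x : 'cV[R]_(1 + k)) : dot (dsubmx x) (dsubmx x) <= dot x x.
Proof. by rewrite [x in leRHS]stvecE dot_stvec lerDr -expr2 sqr_ge0. Qed.

Lemma pdist2_continuous z0 : continuous (pdist2 z0).
Proof.
have -> : pdist2 z0 = (fun v => dot v v) \o (fun z => stcol 1 z - stcol 1 z0).
  by apply/funext => z; rewrite /= stcolB dot_stvec divr1 -expr2.
move=> z; apply: continuous_comp; last exact: dot_continuous.
apply: (@continuous_for_eps R spacetime) => e e0.
have [s s0 hs] := stcol_near k ltr01 e0; exists s => // t ts.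
by rewrite opprB addrA subrK; apply/ltW/hs.
Qed.

(** The outcome is one inequality without second derivatives, relating F1 and F2 at two nearby
    points with almost opposite slopes; [r] is the gradient of the penalty that localizes the
    maximum at z0. Since q need not stay bounded as e tends to 0, the products of |q| with the
    variations of b and sigma are controlled instead. *)
Lemma local_comparison u w F1 F2 z0 rho : strip T z0 -> 0 < rho ->
  {within strip T, continuous u} -> {within strip T, continuous w} ->
  (forall z, strip T z -> `|z - z0| < rho -> u z <= w z) -> u z0 = w z0 ->
  (forall z, strip T z -> `|z - z0| < rho -> psub T sigma F1 u z) ->
  (forall z, strip T z -> `|z - z0| < rho -> psub T sigma F2 (fun z => - w z) z) ->
  (forall z q, strip T z -> `|z - z0| < rho -> first_order_cont T F1 z q) ->
  (forall z q, strip T z -> `|z - z0| < rho -> first_order_cont T F2 z q) ->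
  forall e : R, 0 < e -> exists z z' q r,
    [/\ strip T z, strip T z', `|z - z0| < e, `|z' - z0| < e &
    [/\ enorm r <= e, enorm q * enorm (sigma z - sigma z') <= e,
       enorm q * enorm (b z - b z') <= e & 0 <= F1 z (q + r) + F2 z' (- q) + e]].
Proof.
move=> Tz0 rho0 cu cw uw uwz0 P1 P2 cF1 cF2 e e0.
pose r0 := Num.min (rho / 2) (e / 2).
have r00 : 0 < r0 by rewrite lt_min !divr_gt0.
have r0rho : r0 < rho by rewrite (@le_lt_trans _ _ (rho / 2)) ?ge_min ?lexx //; lra.
have r0e : r0 < e by rewrite (@le_lt_trans _ _ (e / 2)) ?ge_min ?lexx ?orbT //; lra.
have [Bt Bt0 hBt] := trace_box_bounded z0 r0.
(* [D] bounds what the derivatives of |z - z0|^2 contribute on the box: time slope, trace and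
   gradient. The penalty [dl] thus costs at most e/2; the other half is left for alpha |sigma z -
   sigma z'|^2. *)
pose D := 1 + 2 * r0 + Bt + 2 * (1 + (k * 1)%:R) * r0.
have k0 : 0 <= (k * 1)%:R :> R by [].
have kr0 : 0 <= (k * 1)%:R * r0 by rewrite mulr_ge0 // ltW.
have D0 : 0 < D by rewrite /D; lra.
pose dl := e / (2 * D); have dl0 : 0 < dl by rewrite divr_gt0 // mulr_gt0.
have dlD : dl * D = e / 2 by rewrite /dl; field; rewrite gt_eqF.
have C1 : 0 < 16 * (1 + C) ^+ 2 by rewrite mulr_gt0 // exprn_gt0 // ltr_wpDr.
(* [e1] will bound w z - w z'. The first entry then keeps z within r0/4 of z0, the second makes the
   space-Lipschitz errors, of size C^2 alpha |x - x'|^2, small. *)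
pose e1 := Num.min (dl * (r0 / 4) ^+ 2) (e / (16 * (1 + C) ^+ 2)).
have e10 : 0 < e1 by rewrite lt_min divr_gt0 // mulr_gt0 // exprn_gt0 // divr_gt0.
have e1a : e1 <= dl * (r0 / 4) ^+ 2 by rewrite ge_min lexx.
have e1b : e1 * (16 * (1 + C) ^+ 2) <= e.
  by rewrite -ler_pdivlMr // ge_min lexx orbT.
have cA := @box_compact R k T z0 r0.
have [d1 d10 hd1] := @compact_unif_continuous R spacetime _ _ w cA (within_box cw) _ e10.
have [B B0 hB] := @compact_bounded_fun R spacetime _ _ cA (within_box cw).
pose m1 := Num.min d1 (Num.min (r0 / 4) 1).
have m10 : 0 < m1 by rewrite !lt_min d10 ltr01 divr_gt0.
have m1d : m1 <= d1 by rewrite ge_min lexx.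
have m1r : m1 <= r0 / 4 by rewrite /m1 !ge_min lexx orbT.
have m11 : m1 <= 1 by rewrite /m1 !ge_min lexx !orbT.
(* The oscillation of w on the box is at most 2 B, so this penalty forces the doubled points closer
   than [m1], where the modulus of continuity of w applies. *)
pose alpha := 4 * (B + 1) / m1 ^+ 2.
have m12 : 0 < m1 ^+ 2 by rewrite exprn_gt0.
have al0 : 0 < alpha by rewrite divr_gt0 // mulr_gt0 // ltr_wpDl.
have alm : alpha * m1 ^+ 2 = 4 * (B + 1) by rewrite divfK ?gt_eqF.
pose e2 := Num.min 1 (e / (8 * (1 + alpha))).
have a1 : 0 < 8 * (1 + alpha) by rewrite mulr_gt0 // ltr_wpDr // ltW.
have e20 : 0 < e2 by rewrite lt_min ltr01 divr_gt0.
have e21 : e2 <= 1 by rewrite ge_min lexx.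
have e2a : e2 * (8 * (1 + alpha)) <= e by rewrite -ler_pdivlMr // ge_min lexx orbT.
have [ds ds0 hds] := @box_enorm_unif _ _ sigma z0 r0 _ sigma_cont e20.
have [db db0 hdb] := @box_enorm_unif _ _ b z0 r0 _ b_cont e20.
(* Chosen after [alpha]: over times differing by at most [gam], sigma and b vary by at most [e2],
   and alpha e2 <= e/8. *)
pose gam := Num.min 1 (Num.min (ds / 2) (db / 2)).
have g0 : 0 < gam by rewrite !lt_min ltr01 !divr_gt0.
have g1 : gam <= 1 by rewrite ge_min lexx.
have gs : gam < ds by rewrite (@le_lt_trans _ _ (ds / 2)) ?ge_min ?lexx ?orbT //; lra.
have gb : gam < db by rewrite (@le_lt_trans _ _ (db / 2)) ?ge_min ?lexx ?orbT //; lra.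
have gn : gam != 0 by rewrite gt_eqF.
pose A := box T z0 r0; pose K := stpair gam @^-1` A.
pose ud z := u z - dl * pdist2 z0 z.
have cud : {within strip T, continuous ud}.
  have cp := @continuous_subspaceT _ _ (strip T : set spacetime) _ (@pdist2_continuous z0).
  have -> : ud = fun z => 1 * u z + (- dl) * pdist2 z0 z.
    by apply/funext => z; rewrite /ud; ring.
  by move=> z; have := @continuous_lincomb R (subspace (strip T : set spacetime)) _ _
    1 (- dl) z (@cu z) (cp z).
have K0 : K (stcol gam z0).
  by rewrite /K /A /box /= stcolK //; split=> //; rewrite subrr normr0 ltW.
have cK : compact K by exact: stpair_box_compact.
have cuK := @stpair_within R k T gam z0 r0 ud g0 cud.
have cwK := @stpair_within R k T gam z0 r0 w g0 cw.
have [x [y [Kx Ky hmax]]] := @doubling_max R (1 + k) K (ud \o stpair gam) (w \o stpair gam)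
  (alpha / 2) cK (ex_intro _ _ K0) cuK cwK.
pose z := stpair gam x; pose z' := stpair gam y.
have [Tz zr] : A z by []. have [Tz' zr'] : A z' by [].
pose Dl := dot (x - y) (x - y).
have zrho : `|z - z0| < rho by exact: le_lt_trans zr _.
(* The competitor is (z0, z0). Replacing u z by the larger w z leaves only the oscillation of w to
   pay for both penalties. *)
have base : 0 <= w z - w z' - dl * pdist2 z0 z - alpha / 2 * Dl.
  have := hmax _ _ K0 K0; rewrite /= stcolK // !subrr dot0l mulr0 /ud -/z -/z' -/Dl.
  have -> : pdist2 z0 z0 = 0 by rewrite /pdist2 !subrr expr0n dot0l addr0.
  by rewrite uwz0; have := uw _ Tz zrho; clear; lra.
have pd0 : 0 <= dl * pdist2 z0 z by rewrite mulr_ge0 ?pdist2_ge0 // ltW.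
have Dl0 : 0 <= Dl by exact: dot_ge0.
have aDl0 : 0 <= alpha * Dl by rewrite mulr_ge0 // ltW.
have Dm : Dl < m1 ^+ 2.
  rewrite -(ltr_pM2l al0) alm; have := hB z (conj Tz zr); have := hB z' (conj Tz' zr').
  rewrite !ler_norml => /andP[+ _] /andP[_ +]; move: base pd0; clear; lra.
have xy : `|x - y| < m1.
  rewrite -(@ltr_pXn2r _ 2) ?nnegrE ?(ltW m10) //.
  exact: le_lt_trans (normM_le_dot _) Dm.
have [tp xp] := tpart_norm (x - y).
have zz1 : `|z.1 - z'.1| <= gam.
  rewrite -mulrBr -tpartB normrM gtr0_norm // ler_piMr ?(ltW g0) //.
  by apply: le_trans tp _; apply/ltW; apply: lt_le_trans xy m11.
have zz : `|z - z'| < m1.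
  rewrite prod_norm_lt /= -mulrBr -tpartB normrM gtr0_norm //.
  rewrite -linearB /= (le_lt_trans xp xy) andbT.
  apply: le_lt_trans xy; apply: le_trans tp.
  by rewrite ler_piMl.
have wz : w z - w z' <= e1.
  apply: le_trans (ler_norm _) _; apply: hd1 => //; exact: lt_le_trans zz m1d.
have pd1 : pdist2 z0 z <= (r0 / 4) ^+ 2.
  rewrite -(ler_pM2l dl0); apply: le_trans e1a.
  by move: base wz aDl0; clear; lra.
have al1 : alpha * Dl <= 2 * e1 by move: base wz pd0; clear; lra.
have z4 : `|z - z0| <= r0 / 4.
  rewrite -(@ler_pXn2r _ 2) ?nnegrE ?divr_ge0 ?(ltW r00) //.
  exact: le_trans (pdist2_norm _ _) pd1.
have z4' : `|z' - z0| <= r0 / 2.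
  rewrite -(subrK z z') -addrA (le_trans (ler_normD _ _)) // distrC.
  by move: zz z4 m1r; clear; lra.
have int v : `|v - z0| <= r0 / 2 ->
    exists2 r : R, 0 < r & forall z'', strip T z'' -> `|z'' - v| < r -> A z''.
  move=> v2; exists (r0 / 4) => [|z'' Tz'' h]; first by rewrite divr_gt0.
  split=> //; rewrite -(subrK v z'') -addrA (le_trans (ler_normD _ _)) //.
  by clear -v2 h r00; lra.
have locP F f v : `|v - z0| <= r0 ->
    (forall z, strip T z -> `|z - z0| < rho -> psub T sigma F f z) ->
    exists2 r : R, 0 < r & forall z'', strip T z'' -> `|z'' - v| < r -> psub T sigma F f z''.
  move=> v2 P; exists (rho - r0) => [|z'' Tz'' h]; first by rewrite subr_gt0.
  apply: P => //; rewrite -(subrK v z'') -addrA (le_lt_trans (ler_normD _ _)) //.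
  by clear -v2 h r00; lra.
pose F1' z q := dl * (2 * (z.1 - z0.1)) +
      dl * \tr (sigma z *m (sigma z)^T) + F1 z (q + (dl * 2) *: (z.2 - z0.2)).
pose p := alpha *: (x - y).
have H1 : superj_trace_ge K (ud \o stpair gam) x p
    (- (2 * (tpart p / gam + F1' z (dsubmx p)))) (col_mx (0 : 'M[R]_(1, d)) (sigma z)).
  apply: (@superj_trace_ge_stpair R k d T sigma A) => //.
  - by move=> ? [].
  - by apply: int; move: z4 r00; clear; lra.
  - apply: locP => // z'' Tz'' zz''; apply: psub_shift; [exact: ltW|exact: P1].
  - by apply: first_order_cont_shift => //; [exact: ltW|exact: cF1].
have zrho' : `|z' - z0| < rho by exact: le_lt_trans zr' _.
have H2 : superj_trace_ge K (fun x => - (w \o stpair gam) x) y (- p)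
    (- (2 * (tpart (- p) / gam + F2 z' (dsubmx (- p))))) (col_mx (0 : 'M[R]_(1, d)) (sigma z')).
  apply: (@superj_trace_ge_stpair R k d T sigma A (fun z => - w z)) => //.
  - by move=> ? [].
  - exact: int.
  - exact: locP.
  - exact: cF2.
(* The two time slopes, plus and minus [tpart p / gam], cancel in the sum, although nothing bounds
   them as [gam] shrinks. *)
have := trace_sums _ cK cuK cwK Kx Ky al0 hmax H1 H2.
rewrite opp_col_mx add_col_mx subrr enorm_col0 => /(_ isT).
set q := dsubmx p; set r := (dl * 2) *: (z.2 - z0.2).
have -> : dsubmx (- p) = - q by rewrite linearN.
have -> : tpart (- p) = - tpart p by rewrite /tpart !mxE.
move=> main; exists z, z', q, r.
have qE : enorm q = alpha * enorm (z.2 - z'.2).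
  by rewrite /q linearZ /= enormZ gtr0_norm // linearB.
set n := enorm (z.2 - z'.2) in qE; have n0 : 0 <= n by exact: enorm_ge0.
have nD : n ^+ 2 <= Dl by rewrite enorm_dot; have := dot_dsubmx_le (x - y); rewrite linearB.
have n1 : n <= 1.
  rewrite -(@ler_pXn2r _ 2) ?nnegrE // expr1n; apply: le_trans nD _.
  by apply/ltW/(lt_le_trans Dm); rewrite expr_le1 // ltW.
have an : alpha * n ^+ 2 <= 2 * e1 by apply: le_trans (ler_wpM2l (ltW al0) nD) al1.
(* This intermediate point separates the Lipschitz variation in space from the mere continuity in
   time. *)
pose zm : spacetime := (z.1, z'.2).
have Am : A zm.
  split; first by split=> //; exact: Tz.1.
  move: zr zr'; rewrite !prod_norm_le => /andP[h _] /andP[_ h']; exact/andP.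
have zmz' : `|zm - z'| <= gam by rewrite prod_norm_le /= subrr normr0 zz1 ltW.
have sd : enorm (sigma z - sigma z') <= C * n + e2.
  rewrite -(subrK (sigma zm) (sigma z)) -addrA.
  apply: le_trans (enormD _ _) _; apply: lerD.
    have := lip z.2 z'.2 Tz.1; rewrite -surjective_pairing -/zm -/n.
    by apply: le_trans; rewrite lerDr enorm_ge0.
  by apply: hds => //; exact: le_lt_trans zmz' gs.
have bd : enorm (b z - b z') <= C * n + e2.
  rewrite -(subrK (b zm) (b z)) -addrA.
  apply: le_trans (enormD _ _) _; apply: lerD.
    have := lip z.2 z'.2 Tz.1; rewrite -surjective_pairing -/zm -/n.
    by apply: le_trans; rewrite lerDl enorm_ge0.
  by apply: hdb => //; exact: le_lt_trans zmz' gb.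
have an0 : 0 <= alpha * n by rewrite mulr_ge0 // ltW.
have ae2 : alpha * e2 <= e / 8 by clear -e20 e2a; lra.
have q1 : alpha * n * (C * n + e2) <= e.
  have : alpha * n * e2 <= alpha * e2.
    by rewrite -mulrA ler_wpM2l ?(ltW al0) // ler_piMl // ltW.
  have : C * (alpha * n ^+ 2) <= C * (2 * e1) by rewrite ler_wpM2l.
  have : 0 <= e1 * C ^+ 2 by rewrite mulr_ge0 ?sqr_ge0 // ltW.
  have : 0 <= e1 * C by rewrite mulr_ge0 // ltW.
  by move=> b1 b2 b3 b4; clear -b1 b2 b3 b4 ae2 e1b e0 e10; lra.
have q2 : alpha * enorm (sigma z - sigma z') ^+ 2 <= e / 2.
  have : enorm (sigma z - sigma z') ^+ 2 <= (C * n + e2) ^+ 2.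
    by rewrite ler_pXn2r ?nnegrE ?enorm_ge0 // addr_ge0 ?mulr_ge0 // ltW.
  move=> /(ler_wpM2l (ltW al0)) /le_trans; apply.
  have : 0 <= alpha * (C * n - e2) ^+ 2 by rewrite mulr_ge0 ?sqr_ge0 // ltW.
  have : C ^+ 2 * (alpha * n ^+ 2) <= C ^+ 2 * (2 * e1) by rewrite ler_wpM2l ?sqr_ge0.
  have : alpha * (e2 * e2) <= alpha * e2 by rewrite ler_wpM2l ?(ltW al0) // ler_piMl // ltW.
  have : 0 <= e1 * C by rewrite mulr_ge0 // ltW.
  by move=> b1 b2 b3 b4; clear -b1 b2 b3 b4 ae2 e1b e0 e10; lra.
split=> //.
- exact: le_lt_trans zr r0e.
- exact: le_lt_trans zr' r0e.
have zx : `|z.2 - z0.2| <= r0 by move: zr; rewrite prod_norm_le => /andP[].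
have zt : `|z.1 - z0.1| <= r0 by move: zr; rewrite prod_norm_le => /andP[].
have dB : dl * Bt >= 0 by rewrite mulr_ge0 // ltW.
have dr : 0 <= dl * r0 by rewrite mulr_ge0 // ltW.
have dkr : 0 <= dl * ((k * 1)%:R * r0) by rewrite mulr_ge0 // ltW.
split.
- have dl20 : 0 < dl * 2 by rewrite mulr_gt0.
  rewrite enormZ gtr0_norm //.
  have := ler_wpM2l (ltW dl0) (le_trans (enorm_le_norm (z.2 - z0.2))
    (ler_wpM2l (addr_ge0 ler01 k0) zx)).
  by move: dlD; rewrite /D => b1 b2; clear -b1 b2 dB dr dkr dl0; lra.
- by rewrite qE (le_trans _ q1) // ler_wpM2l.
- by rewrite qE (le_trans _ q1) // ler_wpM2l.
move: main; rewrite /F1' -/r -/q.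
have := ler_wpM2l (ltW dl0) (hBt z (conj Tz zr)).
have := ler_wpM2l (ltW dl0) (le_trans (ler_norm _) zt).
by move: dlD; rewrite /D => b1 b2 b3 b4; clear -b1 b2 b3 b4 q2 dB dr dkr dl0 aDl0; lra.
Qed.

End DoublingVariables.

(** * Obstacles and cycles of switching costs *)

Section Obstacles.
Variables (R : realType) (k d m : nat) (T : R).
Local Notation spacetime := (R * 'cV[R]_k)%type.
Variables (b : spacetime -> 'cV[R]_k) (sigma : spacetime -> 'M[R]_(k, d)).
Variable f : 'I_m -> spacetime -> 'cV[R]_m -> 'cV[R]_d -> R.
Variable g : 'I_m -> 'I_m -> spacetime -> R.
Variable h : 'I_m -> 'cV[R]_k -> R.
Implicit Types (v w : 'I_m -> spacetime -> R) (z : spacetime).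

Lemma system_op_le0 v i z a : (forall j, j != i -> v j z - g i j z < v i z) ->
  (system_op b sigma f g v i z a <= 0)%E -> pde_op b sigma f v i z a <= 0.
Proof.
move=> hv; rewrite /system_op ge_min lee_fin => /orP[|//].
rewrite leNgt => /negP[]; rewrite sube_gt0; apply/bigmax_ltP; split.
  by rewrite ltNyr.
by move=> j ji; rewrite lte_fin; exact: hv.
Qed.

Lemma system_op_ge0 v i z a : (0 <= system_op b sigma f g v i z a)%E ->
  (forall j, j != i -> v j z - g i j z <= v i z) /\ 0 <= pde_op b sigma f v i z a.
Proof.
rewrite /system_op le_min lee_fin => /andP[h1 ->]; split=> // j ji.
move: h1; rewrite sube_ge0 ?orbT // => /bigmax_leP[_ /(_ j ji)].
by rewrite lee_fin.
Qed.

Lemma psuperjN_limiting_subjet (u : spacetime -> R) z p q M : strip T z -> M^T = M ->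
  psuperj T (fun z => - u z) z (p, q, M) -> limiting_subjet T u z (- p, - q, - M).
Proof.
move=> Tz Ms J; apply: limiting_subjet_subjet; apply: superjetN_subjet.
by rewrite !opprK; exact: psuperj_superjet.
Qed.

Lemma strip_below_near z : z.1 < T -> exists2 r : R, 0 < r &
  forall z', `|z' - z| < r -> z'.1 < T.
Proof.
move=> zT; exists (T - z.1) => [|z']; first by rewrite subr_gt0.
by rewrite prod_norm_lt => /andP[/= + _]; rewrite ltr_norml => /andP[_]; lra.
Qed.

(* The obstacle inequality is only assumed where [w i] has a subjet, that is on a
   dense set. *)
Lemma supersolution_obstacle w i j z : viscosity_supersolution T b sigma f g h w ->
  {within strip T, continuous (w i)} -> {within strip T, continuous (w j)} ->
  {within strip T, continuous (g i j)} -> strip T z -> z.1 < T -> j != i ->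
  w j z - g i j z <= w i z.
Proof.
move=> [_ sup _] ci cj cg Tz zT ji; rewrite leNgt; apply/negP => gap.
pose G z := w j z - g i j z - w i z.
have cG : {within strip T, continuous G}.
  have -> : G = fun z => 1 * (1 * w j z + (-1) * g i j z) + (-1) * w i z.
    by apply/funext => y; rewrite /G; ring.
  move=> y; have h1 := @continuous_lincomb R (subspace (strip T : set spacetime)) _ _
    1 (-1) y (@cj y) (@cg y).
  by have := @continuous_lincomb R (subspace (strip T : set spacetime)) _ _
    1 (-1) y h1 (@ci y).
have G0 : 0 < G z / 2 by rewrite divr_gt0 // subr_gt0.
have [r1 r10 hr1] := (@within_continuousP R spacetime _ _ _).1 cG z Tz _ G0.
have [r2 r20 hr2] := strip_below_near zT.
pose r := Num.min r1 r2 / 2.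
have rm : 0 < Num.min r1 r2 by rewrite lt_min r10.
have r0 : 0 < r by rewrite divr_gt0.
have rr : r < Num.min r1 r2 by rewrite ltr_pdivrMr // ltr_pMr // ltr1n.
have [rr1 rr2] : r < r1 /\ r < r2 by move: rr; rewrite lt_min => /andP[].
have cA := @box_compact R k T z r.
have cwi := @within_box R k T _ (w i) z r ci.
have [B B0 hB] := @compact_bounded_fun R spacetime _ _ cA cwi.
have Az : box T z r z by split=> //; rewrite subrr normr0 ltW.
(* Large enough for the maximizer of - w i - n |. - z|^2 to lie inside the box, so that it carries a
   subjet of [w i]. *)
pose n := 4 * (1 + B) / r ^+ 2.
have rr0 : 0 < r ^+ 2 by rewrite exprn_gt0.
have n0 : 0 < n by rewrite divr_gt0 // mulr_gt0 // ltr_wpDr.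
have nr : n * r ^+ 2 = 4 * (1 + B) by rewrite divfK ?gt_eqF.
have [||y] := @compact_EVT_max _ _ (fun y => (-1) * w i y + (- n) * pdist2 z y) _ _ cA.
- by exists z.
- have cp := @continuous_subspaceT _ _ (box T z r : set spacetime) _ (@pdist2_continuous R k z).
  by move=> y; have := @continuous_lincomb R (subspace (box T z r : set spacetime)) _ _
    (-1) (- n) y (@cwi y) (cp y).
rewrite inE => -[Ty yr] ymax.
have yz : `|y - z| < r.
  rewrite -(@ltr_pXn2r _ 2) ?nnegrE ?(ltW r0) //.
  apply: le_lt_trans (pdist2_norm _ _) _; rewrite -(ltr_pM2l n0) nr.
  have := ymax z; rewrite inE => /(_ Az).
  have -> : pdist2 z z = 0 by rewrite /pdist2 !subrr expr0n dot0l addr0.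
  have := hB z Az; have := hB y (conj Ty yr); rewrite !ler_norml => /andP[a1 a2] /andP[b1 b2].
  lra.
have J0 : psuperj T (fun y => - w i y - n * pdist2 z y) y (0, 0, 0).
  apply: (@psuperj_max _ _ _ _ _ (r - `|y - z|)); first by rewrite subr_gt0.
  move=> y' Ty' yy'; have := ymax y'; rewrite inE => /(_ _); rewrite !mulN1r !mulNr; apply.
  split=> //; rewrite -(subrK y y') -addrA (le_trans (ler_normD _ _)) //.
  by apply: ltW; lra.
have := psuperj_add J0 (ptaylor_pdist2 z y (ltW n0)); rewrite !add0r => J.
have Ms : ((n * 2)%:M : 'M[R]_k)^T = (n * 2)%:M by rewrite tr_scalar_mx.
have tT : 0 <= y.1 < T.
  rewrite (hr2 _ (lt_trans yz rr2)) andbT.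
  by move: Ty.1; rewrite /= in_itv /= => /andP[].
have := psuperjN_limiting_subjet Ty Ms J; rewrite {1}[y]surjective_pairing.
move=> /(sup i _ _ _ tT) /system_op_ge0 [/(_ j ji) + _].
rewrite -surjective_pairing => obs.
have Gy : G y <= 0 by rewrite /G; move: obs; lra.
have := hr1 _ Ty (lt_trans yz rr1); rewrite ler_norml => /andP[+ _].
by move: Gy G0; lra.
Qed.

(* Following, from each index of [I], the constraint it violates ends in a cycle
   along which the switching costs sum to zero. *)
Lemma no_loop_index (c : 'I_m -> 'I_m -> R) (v : 'I_m -> R) (I : pred 'I_m) i0 :
  (forall (N : nat) (l : nat -> 'I_m), (3 <= N)%N -> l 1%N = l N ->
     #|[seq l n | n <- iota 1 N]| = N.-1 -> 0 < \sum_(1 <= n < N) c (l n) (l n.+1)) ->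
  I i0 ->
  (forall i, I i -> (forall j, j != i -> v j - c i j < v i) \/
     exists j, [/\ j != i, I j & c i j = v j - v i]) ->
  exists2 i, I i & forall j, j != i -> v j - c i j < v i.
Proof.
move=> loop Ii0 step.
have [//|H] := pselect (exists2 i, I i & forall j, j != i -> v j - c i j < v i).
exfalso.
have next i : exists j, I i -> [/\ j != i, I j & c i j = v j - v i].
  have [Ii|nI] := boolP (I i); last by exists i0.
  by case: (step i Ii) => [hi|[j hj]]; [case: H; exists i|exists j].
have [nx hnx] := choice next.
have Iit n i : I i -> I (iter n nx i).
  by elim: n => //= n IH Ii; have [] := hnx _ (IH Ii).
have [a [N0 [N00 per0]]] : exists a N0, (0 < N0)%N /\ iter N0 nx (iter a nx i0) = iter a nx i0.
  have : ~~ injectiveb (fun n : 'I_m.+1 => iter n nx i0).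
    apply/negP => /injectiveP inj; have := leq_card _ inj.
    by rewrite !card_ord ltnn.
  rewrite /injectiveb => /injectivePn [n1 [n2 n12 e12]].
  wlog lt12 : n1 n2 n12 e12 / (n1 < n2)%N.
    move=> W; case: (ltngtP n1 n2) => [lt|lt|/val_inj eq]; first exact: (W n1 n2).
      by apply: (W n2 n1) => //; rewrite eq_sym.
    by rewrite eq eqxx in n12.
  exists n1, (n2 - n1)%N; rewrite subn_gt0; split=> //.
  by rewrite -iterD subnK // ltnW.
set x := iter a nx i0 in per0; have Ix : I x by exact: Iit.
have ex : exists N, (0 < N)%N && (iter N nx x == x) by exists N0; rewrite N00 per0 eqxx.
case: (ex_minnP ex) => N /andP[N1 /eqP per] Nmin.
have nxx i : I i -> nx i != i by move=> /hnx [].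
have N2 : (2 <= N)%N.
  by case: N N1 per {Nmin} => [|[|N]] //= _ eq; move: (nxx x Ix); rewrite eq eqxx.
(* With the least period N the N indices are distinct. The loop condition counts from 1 and lists
   the starting index twice, so it is applied to N + 1 terms; it needs N >= 2, which holds because
   [nx] moves every index of [I]. *)
pose l n := iter n.-1 nx x.
have l1 : l 1%N = l N.+1 by rewrite /l /= per.
have inj p q : (p < q < N)%N -> iter p nx x != iter q nx x.
  move=> /andP[pq qN]; apply/eqP => e.
  have : iter (N - q + p) nx x = x by rewrite iterD e -iterD subnK // ltnW.
  move=> e'; have := Nmin (N - q + p)%N; rewrite e' eqxx andbT; lia.
have uniqN : uniq [seq l n | n <- iota 1 N].
  rewrite map_inj_in_uniq ?iota_uniq // => p q; rewrite !mem_iota => hp hq e.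
  case: (ltngtP p q) => // lt.
    have := inj p.-1 q.-1; rewrite /l in e; rewrite e eqxx => /(_ _)/negP; lia.
  have := inj q.-1 p.-1; rewrite /l in e; rewrite e eqxx => /(_ _)/negP; lia.
have card : #|[seq l n | n <- iota 1 N.+1]| = N.+1.-1.
  rewrite -[N.+1]addn1 iotaD map_cat /= add1n -l1.
  rewrite (@eq_card _ _ (mem [seq l n | n <- iota 1 N])) => [|y].
    by rewrite (card_uniqP uniqN) size_map size_iota addn1.
  rewrite [LHS]mem_cat mem_seq1 orbC; case: eqP => //= ->.
  by apply/esym/mapP; exists 1%N => //; rewrite mem_iota; lia.
have := loop N.+1 l N2 l1 card.
have -> : \sum_(1 <= n < N.+1) c (l n) (l n.+1) = \sum_(1 <= n < N.+1) (v (l n.+1) - v (l n)).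
  rewrite !big_nat; apply: eq_bigr => n /andP[n1 _].
  have : l n.+1 = nx (l n) by rewrite /l; case: n n1.
  by move=> ->; have [_ _ ->] := hnx _ (Iit n.-1 _ Ix).
by rewrite telescope_sumr // -l1 subrr ltxx.
Qed.

End Obstacles.

(** * Continuity jointly in the point and the slope *)

Section JointContinuity.
Variables (R : realType) (k : nat) (T : R).
Local Notation spacetime := (R * 'cV[R]_k)%type.
Implicit Types (z : spacetime) (q : 'cV[R]_k).

Definition joint_cont (W : normedModType R) (F : spacetime -> 'cV[R]_k -> W) z q :=
  forall e : R, 0 < e -> exists2 r : R, 0 < r & forall z' q', strip T z' ->
    `|z' - z| < r -> `|q' - q| < r -> `|F z' q' - F z q| <= e.

Lemma joint_cont_z (W : normedModType R) (F : spacetime -> W) z q :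
  {within strip T, continuous F} -> strip T z -> joint_cont (fun z _ => F z) z q.
Proof.
move=> /(@within_continuousP R spacetime) cF Tz e /(cF z Tz)[r r0 hr].
by exists r => // z' q' Tz' zz' _; exact: hr.
Qed.

Lemma joint_cont_q z q : joint_cont (fun _ q => q) z q.
Proof. by move=> e e0; exists e => // z' q' _ _ /ltW. Qed.

Lemma joint_contD (W : normedModType R) (F G : spacetime -> 'cV[R]_k -> W) z q :
  joint_cont F z q -> joint_cont G z q -> joint_cont (fun z q => F z q + G z q) z q.
Proof.
move=> cF cG e e0; have e2 : 0 < e / 2 by rewrite divr_gt0.
have [r r0 hr] := cF _ e2; have [s s0 hs] := cG _ e2.
exists (Num.min r s) => [|z' q' Tz']; first by rewrite lt_min r0.
rewrite !lt_min => /andP[z1 z2] /andP[q1 q2].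
rewrite opprD addrACA (le_trans (ler_normD _ _)) // (splitr e) lerD //.
  exact: hr.
exact: hs.
Qed.

Lemma joint_contZ (W : normedModType R) a (F : spacetime -> 'cV[R]_k -> W) z q :
  joint_cont F z q -> joint_cont (fun z q => a *: F z q) z q.
Proof.
move=> cF e e0; have a0 : 0 < 1 + `|a| by rewrite ltr_wpDr.
have [r r0 hr] := cF _ (divr_gt0 e0 a0).
exists r => // z' q' Tz' zz' qq'; have := hr _ _ Tz' zz' qq'.
rewrite -scalerBr normrZ ler_pdivlMr // => h.
by have := normr_ge0 (F z' q' - F z q); lra.
Qed.

Lemma joint_contN (W : normedModType R) (F : spacetime -> 'cV[R]_k -> W) z q :
  joint_cont F z q -> joint_cont (fun z q => - F z q) z q.
Proof.
move=> cF e /cF[r r0 hr]; exists r => // z' q' Tz' zz' qq'.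
by rewrite -opprD normrN; exact: hr.
Qed.

Lemma joint_cont_mulmx m n p (F : spacetime -> 'cV[R]_k -> 'M[R]_(m, n))
    (G : spacetime -> 'cV[R]_k -> 'M[R]_(n, p)) z q :
  joint_cont F z q -> joint_cont G z q -> joint_cont (fun z q => F z q *m G z q) z q.
Proof.
move=> cF cG e e0; pose A := 1 + `|F z q|; pose B := 1 + `|G z q|.
have A0 : 0 < A by rewrite ltr_wpDr. have B0 : 0 < B by rewrite ltr_wpDr.
have D0 : 0 < (1 + n%:R) * (A + B).
  by apply: mulr_gt0; [rewrite ltr_wpDr|exact: addr_gt0].
have e1 : 0 < Num.min 1 (e / ((1 + n%:R) * (A + B))) by rewrite lt_min ltr01 divr_gt0.
have [r r0 hr] := cF _ e1; have [s s0 hs] := cG _ e1.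
exists (Num.min r s) => [|z' q' Tz']; first by rewrite lt_min r0.
rewrite !lt_min => /andP[z1 z2] /andP[q1 q2].
have := hr _ _ Tz' z1 q1; have := hs _ _ Tz' z2 q2.
have -> : F z' q' *m G z' q' - F z q *m G z q =
   (F z' q' - F z q) *m G z' q' + F z q *m (G z' q' - G z q).
  by rewrite mulmxBl mulmxBr addrA subrK.
rewrite !le_min !ler_pdivlMr // => /andP[g1 g2] /andP[f1 f2].
set x := `|F z' q' - F z q| in f1 f2 *; set y := `|G z' q' - G z q| in g1 g2.
have x0 : 0 <= x by exact: normr_ge0. have y0 : 0 <= y by exact: normr_ge0.
have GB : `|G z' q'| <= B.
  rewrite -(subrK (G z q) (G z' q')) (le_trans (ler_normD _ _)) // /B addrC.
  by rewrite addrC lerD2r.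
have FA : `|F z q| <= A by rewrite lerDr.
have n0 : 0 <= n%:R :> R by [].
have h1 := le_trans (norm_mulmx (F z' q' - F z q) (G z' q'))
  (ler_wpM2l n0 (ler_wpM2l x0 GB)).
have h2 := le_trans (norm_mulmx (F z q) (G z' q' - G z q))
  (ler_wpM2l n0 (ler_wpM2r y0 FA)).
apply: le_trans (ler_normD _ _) _.
have AB : 0 < A + B by rewrite addr_gt0.
have p1 : B * (x * (1 + n%:R) * (A + B)) <= B * e by rewrite ler_wpM2l ?(ltW B0) // -mulrA.
have p2 : A * (y * (1 + n%:R) * (A + B)) <= A * e by rewrite ler_wpM2l ?(ltW A0) // -mulrA.
rewrite -(ler_pM2r AB).
apply: le_trans (ler_wpM2r (ltW AB) (lerD h1 h2)) _.
have : 0 <= B * x * (A + B) by apply: mulr_ge0 (ltW AB); rewrite mulr_ge0 // ltW.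
have : 0 <= A * y * (A + B) by apply: mulr_ge0 (ltW AB); rewrite mulr_ge0 // ltW.
lra.
Qed.

Lemma joint_cont_dot n (F G : spacetime -> 'cV[R]_k -> 'cV[R]_n) z q :
  joint_cont F z q -> joint_cont G z q ->
  joint_cont (fun z q => dot (F z q) (G z q) : R) z q.
Proof.
move=> cF cG; have cFT : joint_cont (fun z q => (F z q)^T) z q.
  move=> e /cF[r r0 hr]; exists r => // z' q' Tz' zz' qq'.
  by rewrite -linearB norm_trmx; exact: hr.
move=> e /(joint_cont_mulmx cFT cG)[r r0 hr]; exists r => // z' q' Tz' zz' qq'.
have := hr _ _ Tz' zz' qq'; apply: le_trans.
rewrite /dot; move: ((F z' q')^T *m _) ((F z q)^T *m _) => X Y.
by have := coord_le_norm (X - Y) 0 0; rewrite !mxE.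
Qed.

Lemma joint_cont_enorm m n (F : spacetime -> 'cV[R]_k -> 'M[R]_(m, n)) z q :
  joint_cont F z q -> joint_cont (fun z q => enorm (F z q) : R) z q.
Proof.
move=> cF e e0; have D0 : 0 < 1 + (m * n)%:R :> R by rewrite ltr_wpDr.
have [r r0 hr] := cF _ (divr_gt0 e0 D0).
exists r => // z' q' Tz' zz' qq'; have := hr _ _ Tz' zz' qq'.
rewrite ler_pdivlMr // mulrC => h.
have h1 := le_trans (enorm_le_norm (F z' q' - F z q)) h.
have h2 : enorm (F z q - F z' q') <= e by rewrite -enormN opprB.
have := enormD (F z' q' - F z q) (F z q); rewrite subrK.
have := enormD (F z q - F z' q') (F z' q'); rewrite subrK.
by rewrite ler_norml; move=> *; apply/andP; split; lra.
Qed.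

Lemma joint_cont_coord m n (F : spacetime -> 'cV[R]_k -> 'M[R]_(m, n)) z q :
  (forall i j, joint_cont (fun z q => F z q i j : R) z q) -> joint_cont F z q.
Proof.
move=> cF e e0.
have H (ij : 'I_m * 'I_n) : exists r : R, 0 < r /\ forall z' q', strip T z' ->
    `|z' - z| < r -> `|q' - q| < r -> `|F z' q' ij.1 ij.2 - F z q ij.1 ij.2| <= e.
  by have [r r0 hr] := cF ij.1 ij.2 e e0; exists r.
have [rr hrr] := choice H.
(* Below every [rr ij], and positive even for an empty index type. *)
pose r := (1 + \sum_ij (rr ij)^-1)^-1.
have S0 : 0 <= \sum_ij (rr ij)^-1.
  by rewrite sumr_ge0 // => ij _; rewrite invr_ge0 ltW //; case: (hrr ij).
have r0 : 0 < r by rewrite invr_gt0 ltr_wpDr.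
have rle ij : r <= rr ij.
  have [r1 _] := hrr ij; rewrite -[leRHS]invrK lef_pV2 ?posrE ?invr_gt0 ?ltr_wpDr //.
  rewrite (bigD1 ij) //= addrCA lerDl addr_ge0 // sumr_ge0 // => i _.
  by rewrite invr_ge0 ltW //; case: (hrr i).
exists r => // z' q' Tz' zz' qq'; apply: norm_le_coord => [|i j]; first exact: ltW.
rewrite !mxE; apply: (hrr (i, j)).2 => //; exact: lt_le_trans (rle _).
Qed.

Lemma ev_stcol_within (P : mpoly (1 + k) R) :
  {within strip T, continuous (fun z : spacetime => ev P (stcol 1 z))}.
Proof.
apply: continuous_subspaceT => z.
apply: continuous_comp; first exact: stcol_continuous.
exact: taylor_at_cont (ev_taylor _ _).
Qed.

Lemma joint_cont_grad (P : mpoly (1 + k) R) z q : strip T z ->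
  joint_cont (fun z _ => grad P (stcol 1 z)) z q.
Proof.
move=> Tz; apply: joint_cont_coord => i j e e0.
have [r r0 hr] := joint_cont_z q (@ev_stcol_within (pder i P)) Tz e0.
by exists r => // z' q' Tz' zz' qq'; rewrite !mxE; exact: (hr z' q').
Qed.

Lemma joint_cont_hess (P : mpoly (1 + k) R) z q : strip T z ->
  joint_cont (fun z _ => hess P (stcol 1 z)) z q.
Proof.
move=> Tz; apply: joint_cont_coord => i j e e0.
have [r r0 hr] := joint_cont_z q (@ev_stcol_within (pder i (pder j P))) Tz e0.
by exists r => // z' q' Tz' zz' qq'; rewrite !mxE; exact: (hr z' q').
Qed.

End JointContinuity.

(** * The polynomial barrier *)

Section Barrier.
Variables (R : realType) (k : nat) (T : R).
Local Notation P := (mpoly (1 + k) R).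

Lemma gradXn n (p : mpoly n R) s z :
  grad (p ^+ s.+1) z = (s.+1%:R * ev p z ^+ s) *: grad p z.
Proof.
elim: s => [|s IH]; first by rewrite !expr1 expr0 mulr1 scale1r.
rewrite exprS gradM IH evXn scalerA -scalerDl exprS; congr (_ *: _).
by rewrite -[s.+2]addn1 natrD; ring.
Qed.

Lemma hessXn n (p : mpoly n R) s z :
  hess (p ^+ s.+2) z = (s.+2%:R * ev p z ^+ s.+1) *: hess p z +
    (s.+2%:R * s.+1%:R * ev p z ^+ s) *: (grad p z *m (grad p z)^T).
Proof.
elim: s => [|s IH].
  rewrite expr2 hessM !expr1 expr0 -mulr2n.
  by apply/matrixP => i j; rewrite !mxE -!mulr2n; ring.
rewrite exprS hessM IH evXn gradXn linearZ /= -scalemxAr -scalemxAl.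
rewrite -[s.+3]addn1 -[s.+2]addn1 -[s.+1]addn1 !natrD !exprD !expr1.
by apply/matrixP => i j; rewrite !mxE; ring.
Qed.

Lemma grad_msqnorm n (y : 'cV[R]_n) : grad (msqnorm R n) y = 2 *: y.
Proof. by apply/colP => i; rewrite !mxE pder_msqnorm -scaler_nat evZ ev_mvar. Qed.

Lemma hess_msqnorm n (y : 'cV[R]_n) : hess (msqnorm R n) y = 2%:M.
Proof.
apply/matrixP => i j; rewrite !mxE pder_msqnorm pderMn pder_mvar eq_sym.
by case: eqP => _; rewrite -scaler_nat evZ ?ev0 ?mulr0 ?mulr0n ?ev1 ?mulr1n ?mulr1.
Qed.

Lemma stvecZ a c (y : 'cV[R]_k) : a *: stvec c y = stvec (a * c) (a *: y).
Proof. by rewrite /stvec scale_col_mx scale_scalar_mx. Qed.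

Lemma dsubmx_stvec c (y : 'cV[R]_k) : dsubmx (stvec c y) = y.
Proof. exact: col_mxKd. Qed.

Lemma drsubmxD (A B : 'M[R]_(1 + k)) : drsubmx (A + B) = drsubmx A + drsubmx B.
Proof. by rewrite /drsubmx !linearD. Qed.

Lemma drsubmxZ a (A : 'M[R]_(1 + k)) : drsubmx (a *: A) = a *: drsubmx A.
Proof. by rewrite /drsubmx !linearZ. Qed.

Lemma drsubmx0 : drsubmx (0 : 'M[R]_(1 + k)) = 0.
Proof. by apply/matrixP => i j; rewrite /drsubmx !mxE. Qed.

Lemma drsubmx_outer (u v : 'cV[R]_(1 + k)) :
  drsubmx (u *m v^T) = dsubmx u *m (dsubmx v)^T.
Proof.
by rewrite -[u in LHS]vsubmxK -[v in LHS]vsubmxK tr_col_mx mul_col_row block_mxKdr.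
Qed.

Definition tvar : P := mvar R (lshift k 0).
(* [1 + |x|^2], as [msqnorm] also counts the time variable. *)
Definition xsq1 : P := 1 + (msqnorm R (1 + k) - tvar ^+ 2).
Definition tdecay : P := (2 * T) *: 1 - tvar.
(** On the strip [tdecay] is at least T. The power j + 2 outgrows functions bounded by multiples of
    (1 + |x|^2)^j; M is the height adjusted until contact. Exponents ending in [.+2] let both
    derivatives be written without predecessors. *)
Definition barrier n j (M theta : R) : P :=
  tdecay ^+ n.+2 * (M *: 1 + theta *: xsq1 ^+ j.+2).

Variables (n j : nat) (M theta t : R) (x : 'cV[R]_k).
Let z := stcol 1 (t, x).
Let Q := 1 + dot x x.
Let S := M + theta * Q ^+ j.+2.

Let ev_tvar : ev tvar z = t.
Proof. by rewrite ev_mvar /z /stcol /stvec col_mxEu mxE eqxx divr1. Qed.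

Lemma ev_xsq1 : ev xsq1 z = Q.
Proof.
rewrite !(evD, evN) ev1 ev_msqnorm evXn ev_tvar /z /stcol dot_stvec divr1.
by rewrite /Q -expr2 /= addrAC subrr add0r.
Qed.

Lemma ev_tdecay : ev tdecay z = 2 * T - t.
Proof. by rewrite evD evN evZ ev1 ev_tvar mulr1. Qed.

Let grad_tvar : grad tvar z = stvec 1 0.
Proof.
rewrite grad_mvar; apply/colP => i; rewrite /stvec -[i]splitK.
case: (fintype.split i) => i' /=.
  by rewrite col_mxEu !mxE !ord1 !eqxx.
by rewrite col_mxEd !mxE eq_rlshift.
Qed.

Let gradN m (p : mpoly m R) y : grad (- p) y = - grad p y.
Proof. by rewrite -scaleN1r gradZ scaleN1r. Qed.

Let hessN m (p : mpoly m R) y : hess (- p) y = - hess p y.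
Proof. by rewrite -scaleN1r hessZ scaleN1r. Qed.

Let grad_tdecay : grad tdecay z = stvec (-1) 0.
Proof.
by rewrite gradD gradN gradZ grad1 scaler0 add0r grad_tvar -scaleN1r stvecZ mulr1 scaler0.
Qed.

Let hess_tdecay : hess tdecay z = 0.
Proof. by rewrite hessD hessN hessZ hess1 hess_mvar scaler0 subr0. Qed.

Let grad_xsq1 : grad xsq1 z = stvec 0 (2 *: x).
Proof.
rewrite !(gradD, gradN) grad1 add0r gradXn ev_tvar grad_tvar expr1.
rewrite grad_msqnorm /z /stcol divr1 /= !stvecZ -scaleN1r stvecZ stvecD.
by rewrite scaler0 scaler0 addr0; congr stvec; ring.
Qed.

Let hess_xsq1 : drsubmx (hess xsq1 z) = 2%:M.
Proof.
rewrite !(hessD, hessN) hess1 add0r hessXn hess_mvar scaler0 add0r grad_tvar.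
rewrite hess_msqnorm.
rewrite -scaleN1r !(drsubmxD, drsubmxZ) drsubmx_outer dsubmx_stvec mul0mx !scaler0 addr0.
by rewrite scalar_mx_block block_mxKdr.
Qed.

Let Sp : P := M *: 1 + theta *: xsq1 ^+ j.+2.

Let ev_Sp : ev Sp z = S.
Proof. by rewrite evD !evZ ev1 evXn ev_xsq1 mulr1. Qed.

Let grad_Sp : grad Sp z = stvec 0 ((theta * (j.+2%:R * Q ^+ j.+1)) *: (2 *: x)).
Proof.
rewrite gradD !gradZ grad1 scaler0 add0r gradXn ev_xsq1 grad_xsq1 !stvecZ !mulr0.
by rewrite !scalerA mulrA.
Qed.

Let hess_Sp : drsubmx (hess Sp z) = theta *: ((j.+2%:R * Q ^+ j.+1) *: 2%:M +
    (j.+2%:R * j.+1%:R * Q ^+ j) *: ((2 *: x) *m (2 *: x)^T)).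
Proof.
rewrite hessD !hessZ hess1 scaler0 add0r hessXn ev_xsq1 grad_xsq1.
by rewrite !(drsubmxD, drsubmxZ) hess_xsq1 drsubmx_outer dsubmx_stvec.
Qed.

Lemma barrier_ev : ev (barrier n j M theta) z = (2 * T - t) ^+ n.+2 * S.
Proof. by rewrite evM evXn ev_tdecay ev_Sp. Qed.

Lemma barrier_t : tpart (grad (barrier n j M theta) z) =
  - (n.+2%:R * (2 * T - t) ^+ n.+1 * S).
Proof.
rewrite gradM gradXn grad_tdecay grad_Sp ev_Sp ev_tdecay.
by rewrite !stvecZ stvecD tpart_stvec; ring.
Qed.

Lemma barrier_x : dsubmx (grad (barrier n j M theta) z) =
  ((2 * T - t) ^+ n.+2 * theta * (j.+2%:R * Q ^+ j.+1)) *: (2 *: x).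
Proof.
rewrite gradM gradXn grad_tdecay grad_Sp evXn ev_tdecay.
rewrite !stvecZ stvecD dsubmx_stvec !scaler0 add0r !scalerA.
by congr (_ *: _); ring.
Qed.

Lemma barrier_xx : drsubmx (hess (barrier n j M theta) z) =
  ((2 * T - t) ^+ n.+2 * theta) *: ((j.+2%:R * Q ^+ j.+1) *: 2%:M +
    (j.+2%:R * j.+1%:R * Q ^+ j) *: ((2 *: x) *m (2 *: x)^T)).
Proof.
rewrite hessM gradXn hessXn hess_tdecay grad_tdecay evXn ev_tdecay !stvecZ.
rewrite !(drsubmxD, drsubmxZ) !drsubmx_outer hess_Sp grad_Sp !dsubmx_stvec.
rewrite !(scaler0, trmx0, mul0mx, mulmx0, drsubmx0, add0r, addr0).
by rewrite scalerA.
Qed.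

Lemma trace_sigma_rank1 d (sigma : 'M[R]_(k, d)) w a c :
  \tr (sigma *m sigma^T *m (w *: (a *: 2%:M + c *: ((2 *: x) *m (2 *: x)^T)))) =
  w * (2 * a * enorm sigma ^+ 2 + 4 * c * enorm (sigma^T *m x) ^+ 2).
Proof.
have -> : (2 *: x) *m (2 *: x)^T = 4 *: (x *m x^T).
  by rewrite linearZ /= -scalemxAl -scalemxAr scalerA -natrM.
have trx : \tr (sigma *m sigma^T *m (x *m x^T)) = enorm (sigma^T *m x) ^+ 2.
  rewrite mulmxA mxtrace_mulC enorm_dot /dot trmx_mul trmxK -!mulmxA.
  by rewrite /mxtrace big_ord1.
rewrite -scalemxAr mxtraceZ mulmxDr mxtraceD -!scalemxAr !mxtraceZ mul_mx_scalar.
by rewrite mxtraceZ -enorm_sqr trx; ring.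
Qed.

(** The time derivative is -(n+2)/(2T - t) times the barrier, and 2T - t <= 2T. Linear growth of b
    and sigma makes each derivative term in space at most a constant times the barrier; these
    constants and [Cm] add up to the factor of 2 T in the last condition. *)
Lemma barrier_strict d (b : 'cV[R]_k) (sigma : 'M[R]_(k, d)) (C Cf Cm : R) :
  0 < T -> 0 <= t <= T -> 0 < M -> 0 <= theta -> 0 <= C -> 0 <= Cf -> 0 <= Cm ->
  enorm b + enorm sigma <= C * (1 + enorm x) ->
  2 * T * (2 * C ^+ 2 * (j.+2%:R + 2 * (j.+2%:R * j.+1%:R)) + 4 * j.+2%:R * C * (1 + Cf) + Cm)
    < n.+2%:R ->
  tpart (grad (barrier n j M theta) z)
    + 2^-1 * \tr (sigma *m sigma^T *m drsubmx (hess (barrier n j M theta) z))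
    + dot b (dsubmx (grad (barrier n j M theta) z))
    + Cf * enorm (sigma^T *m dsubmx (grad (barrier n j M theta) z))
    + Cm * ev (barrier n j M theta) z < 0.
Proof.
move=> T0 /andP[t0 tT] M0 th0 C0 Cf0 Cm0 lin.
rewrite barrier_ev barrier_t barrier_x barrier_xx.
set K := (X in 2 * T * X); move=> nK.
pose eta := (2 * T - t) ^+ n.+2.
have a0 : 0 < 2 * T - t by lra.
have eta0 : 0 < eta by rewrite exprn_gt0.
pose X := enorm x; have X0 : 0 <= X by exact: enorm_ge0.
have QX : Q = 1 + X ^+ 2 by rewrite /Q enorm_dot.
have Q1 : 1 <= Q by rewrite QX lerDl sqr_ge0.
have Q0 : 0 <= Q by lra.
have s0 := enorm_ge0 sigma; have b0 := enorm_ge0 b.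
have {}lin : enorm b + enorm sigma <= C * (1 + X) := lin.
have sX : enorm sigma <= C * (1 + X) by lra.
have bX : enorm b <= C * (1 + X) by lra.
have XX : (1 + X) * X <= 2 * Q by rewrite QX; nra.
have X2 : (1 + X) ^+ 2 <= 2 * Q by have := sqr_ge0 (1 - X); rewrite QX; lra.
have s2 : enorm sigma ^+ 2 <= 2 * C ^+ 2 * Q.
  have : enorm sigma ^+ 2 <= (C * (1 + X)) ^+ 2.
    by rewrite ler_pXn2r ?nnegrE // mulr_ge0 // addr_ge0.
  have := ler_wpM2l (sqr_ge0 C) X2; rewrite exprMn; lra.
have sbX : C * (1 + X) * X <= 2 * C * Q.
  by have := ler_wpM2l C0 XX; lra.
have bxX : enorm b * X <= 2 * C * Q by apply: le_trans (ler_wpM2r X0 bX) _.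
have sxX : enorm sigma * X <= 2 * C * Q by apply: le_trans (ler_wpM2r X0 sX) _.
pose w := eta * theta; have w0 : 0 <= w by rewrite mulr_ge0 // ltW.
pose q := Q ^+ j; have q0 : 0 <= q by exact: exprn_ge0.
have p0 : 0 <= j.+2%:R :> R by []. have p1 : 0 <= j.+1%:R :> R by [].
pose J := j.+2%:R : R; pose J' := j.+1%:R : R.
have J0 : 0 <= J by exact: p0.
have J'0 : 0 <= J' by exact: p1.
have qQ0 : 0 <= q * Q by exact: mulr_ge0.
(* The theta part of the barrier. Each space derivative lowers the power of |x| by one and each
   factor b or sigma restores it, so all these terms are multiples of [W]. *)
pose W := w * (q * Q ^+ 2).
have W0 : 0 <= W by apply: mulr_ge0 => //; apply: mulr_ge0 => //; exact: sqr_ge0.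
have trE : \tr (sigma *m sigma^T *m (w *: ((J * Q ^+ j.+1) *: 2%:M +
    (J * J' * q) *: ((2 *: x) *m (2 *: x)^T)))) =
    w * (2 * J * (q * Q) * enorm sigma ^+ 2 + 4 * J * J' * q * enorm (sigma^T *m x) ^+ 2).
  rewrite trace_sigma_rank1 exprS -/q; ring.
have sx : enorm (sigma^T *m x) ^+ 2 <= 2 * C ^+ 2 * Q * Q.
  have h1 : enorm (sigma^T *m x) ^+ 2 <= (enorm sigma * X) ^+ 2.
    rewrite ler_pXn2r ?nnegrE ?enorm_ge0 ?mulr_ge0 //.
    by have := enorm_mulmx sigma^T x; rewrite enorm_tr.
  apply: le_trans h1 _; rewrite exprMn; apply: ler_pM; rewrite ?sqr_ge0 //.
  by rewrite QX lerDr.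
have t1 : 2^-1 * (w * (2 * J * (q * Q) * enorm sigma ^+ 2 +
    4 * J * J' * q * enorm (sigma^T *m x) ^+ 2)) <= W * (2 * C ^+ 2 * (J + 2 * (J * J'))).
  have c1 : 0 <= w * (J * (q * Q)) by do 2! apply: mulr_ge0 => //.
  have c2 : 0 <= w * (2 * J * J' * q).
    by apply: mulr_ge0 => //; do 3! apply: mulr_ge0 => //.
  have := lerD (ler_wpM2l c1 s2) (ler_wpM2l c2 sx); rewrite /W; lra.
have cx : 0 <= w * (J * Q ^+ j.+1).
  by do 2! apply: mulr_ge0 => //; exact: exprn_ge0.
have t2 : dot b ((w * (J * Q ^+ j.+1)) *: (2 *: x)) <= W * (4 * J * C).
  rewrite !dotZr; have h := le_trans (ler_norm _) (dot_enorm b x).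
  have := ler_wpM2l cx (ler_wpM2l (ler0n R 2) (le_trans h bxX)).
  by rewrite /W exprS -/q; lra.
have t3 : enorm (sigma^T *m ((w * (J * Q ^+ j.+1)) *: (2 *: x))) <= W * (4 * J * C).
  rewrite -!scalemxAr !enormZ (ger0_norm cx) ger0_norm //.
  have h := enorm_mulmx sigma^T x; rewrite enorm_tr in h.
  have := ler_wpM2l cx (ler_wpM2l (ler0n R 2) (le_trans h sxX)).
  by rewrite /W exprS -/q; lra.
have WS : W <= eta * S.
  rewrite /W /S -/w !exprS -/q mulrDr.
  have : 0 <= eta * M by rewrite mulr_ge0 ?ltW.
  by rewrite /w; lra.
have S0 : 0 < S by rewrite /S ltr_wpDr // mulr_ge0 // exprn_ge0.
have eS : 0 < eta * S by rewrite mulr_gt0.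
have KW : W * (2 * C ^+ 2 * (J + 2 * (J * J')) + 4 * J * C * (1 + Cf)) + Cm * (eta * S)
    <= eta * S * K.
  have k0 : 0 <= 2 * C ^+ 2 * (J + 2 * (J * J')) + 4 * J * C * (1 + Cf).
    apply: addr_ge0; apply: mulr_ge0; rewrite ?addr_ge0 //.
    - by apply: mulr_ge0 => //; exact: sqr_ge0.
    - by do 2! apply: mulr_ge0 => //.
    - by do 2! apply: mulr_ge0 => //.
  by have := ler_wpM2r k0 WS; rewrite /K -/J -/J'; lra.
have main : eta * S * K < n.+2%:R * (2 * T - t) ^+ n.+1 * S.
  have -> : n.+2%:R * (2 * T - t) ^+ n.+1 * S = (n.+2%:R / (2 * T - t)) * (eta * S).
    have -> : eta = (2 * T - t) * (2 * T - t) ^+ n.+1 by rewrite /eta exprS.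
    by move: (_ ^+ n.+1) => y; field; rewrite gt_eqF.
  rewrite mulrC ltr_pM2r // ltr_pdivlMr //; apply: le_lt_trans nK.
  have K0 : 0 <= K.
    rewrite /K !addr_ge0 // !mulr_ge0 ?sqr_ge0 ?addr_ge0 ?mulr_ge0 //.
  have := mulr_ge0 K0 t0; lra.
rewrite -/eta -/w -/J -/J' -/q trE.
have := ler_wpM2l Cf0 t3.
lra.
Qed.

End Barrier.

(** * Growth bounds and contact with the barrier *)

Section Comparison.
Variables (R : realType) (k d m : nat) (T : R).
Local Notation spacetime := (R * 'cV[R]_k)%type.
Implicit Types (z : spacetime).

Lemma finite_radius (I : finType) (Q : I -> R -> Prop) :
  (forall i r s, 0 < s -> s <= r -> Q i r -> Q i s) ->
  (forall i, exists2 r : R, 0 < r & Q i r) -> exists2 r : R, 0 < r & forall i, Q i r.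
Proof.
move=> anti H; have H' i : exists r : R, 0 < r /\ Q i r.
  by have [r r0 hr] := H i; exists r.
have [rr hrr] := choice H'.
have S0 : 0 <= \sum_i (rr i)^-1.
  by rewrite sumr_ge0 // => i _; rewrite invr_ge0 ltW //; case: (hrr i).
exists (1 + \sum_i (rr i)^-1)^-1 => [|i]; first by rewrite invr_gt0 ltr_wpDr.
have [r0 hr] := hrr i; apply: (anti i) hr; first by rewrite invr_gt0 ltr_wpDr.
rewrite -[leRHS]invrK lef_pV2 ?posrE ?invr_gt0 ?ltr_wpDr //.
rewrite (bigD1 i) //= addrCA lerDl addr_ge0 // sumr_ge0 // => l _.
by rewrite invr_ge0 ltW //; case: (hrr l).
Qed.

(** From |x| <= 1 + |x|^2 a real exponent is traded for a natural power of 1 + |x|^2. Allowing all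
    larger powers lets finitely many functions share one exponent. *)
Lemma poly_growth_pow (phi : spacetime -> R) : poly_growth_strip T phi ->
  exists (C : R) (j : nat), 0 <= C /\ forall z i, strip T z -> (j <= i)%N ->
    `|phi z| <= C * (1 + dot z.2 z.2) ^+ i.
Proof.
move=> [C [gam [C0 g0 hC]]]; pose j := (Num.truncn gam).+1.
exists (2 * C), j; split=> [|[t x] i [tT _] ji]; first by rewrite mulr_ge0.
apply: le_trans (hC t x tT) _; rewrite (mulrC 2) -mulrA ler_wpM2l //=.
pose Q := 1 + dot x x; have Q1 : 1 <= Q by rewrite lerDl dot_ge0.
have xQ : enorm x <= Q.
  rewrite /Q -enorm_dot; have := sqr_ge0 (enorm x - 1); have := enorm_ge0 x; nra.
have : enorm x `^ gam <= Q ^+ i.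
  apply: (@le_trans _ _ (Q `^ gam)).
    by apply: ge0_ler_powR; rewrite ?nnegrE ?enorm_ge0 // (le_trans ler01).
  rewrite -powR_mulrn ?(le_trans ler01) //; apply: ler_powR => //.
  apply: (@le_trans _ _ j%:R); first by apply: ltW; rewrite truncnS_gt.
  by rewrite ler_nat.
have : 1 <= Q ^+ i by rewrite exprn_ege1.
by rewrite -/Q; lra.
Qed.

Lemma continuous_within_div (V : normedModType R) (A : set V) (f g : V -> R) :
  {within A, continuous f} -> {within A, continuous g} ->
  (forall y, A y -> g y != 0) -> {within A, continuous (fun y => f y / g y)}.
Proof.
move=> cf cg g0; rewrite continuous_subspace_in => y; rewrite inE => Ay.
by apply: cvgM; [exact: cf|apply: cvgV; [exact: g0|exact: cg]].
Qed.

(** Divided by its time factor, the barrier is M plus a fixed function, so M has to be the maximum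
    of [Th] over all indices and points. It is attained because [Th] is negative for large x, and
    positive because the barrier with M = 0 is exceeded somewhere. *)
Lemma barrier_max (D : 'I_m -> spacetime -> R) (C theta : R) n j :
  0 < T -> 0 <= C -> 0 < theta ->
  (forall l, {within strip T, continuous (D l)}) ->
  (forall l z, strip T z -> `|D l z| <= C * (1 + dot z.2 z.2) ^+ j) ->
  (exists l z, strip T z /\ ev (barrier k T n j 0 theta) (stcol 1 z) < D l z) ->
  exists M i z, [/\ 0 < M, strip T z,
    D i z = ev (barrier k T n j M theta) (stcol 1 z) &
    forall l z', strip T z' -> D l z' <= ev (barrier k T n j M theta) (stcol 1 z')].
Proof.
move=> T0 C0 th0 cD gD [l1 [z1 [Tz1 D1]]].
pose eta z : R := (2 * T - z.1) ^+ n.+2.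
pose Q z : R := 1 + dot z.2 z.2.
have Q1 z : 1 <= Q z by rewrite lerDl dot_ge0.
have bE M z : ev (barrier k T n j M theta) (stcol 1 z) = eta z * (M + theta * Q z ^+ j.+2).
  by case: z => t x; rewrite barrier_ev.
have Te z : strip T z -> T <= 2 * T - z.1.
  by move=> [+ _]; rewrite /= in_itv /= => /andP[_]; lra.
have eta0 z : strip T z -> 0 < eta z.
  by move=> /Te h; rewrite exprn_gt0 // (lt_le_trans T0).
have etaT z : strip T z -> T ^+ n.+2 <= eta z.
  move=> Tz; have h := Te z Tz; rewrite ler_pXn2r ?nnegrE ?(ltW T0) //.
  by rewrite (le_trans (ltW T0)).
pose Th l z := D l z / eta z - theta * Q z ^+ j.+2.
have ThD l z : strip T z -> D l z = eta z * (Th l z + theta * Q z ^+ j.+2).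
  by move=> Tz; rewrite subrK mulrC divfK // gt_eqF // eta0.
pose C' := C / T ^+ n.+2; have C'0 : 0 <= C' by rewrite divr_ge0 // exprn_ge0 // ltW.
(* Beyond this radius theta Q > C', so theta Q^(j+2) exceeds the bound C' Q^j on D / eta. *)
pose r0 := 1 + C' / theta; have r01 : 1 <= r0 by rewrite lerDl divr_ge0 // ltW.
have far l z : strip T z -> r0 < `|z.2| -> Th l z < 0.
  move=> Tz hz; have h1 : D l z / eta z <= C' * Q z ^+ j.
    have := le_trans (ler_norm _) (gD l z Tz); rewrite -/(Q z) => h.
    have p0 : 0 <= C * Q z ^+ j by rewrite mulr_ge0 // exprn_ge0 // (le_trans ler01).
    apply: le_trans (ler_wpM2r _ h) _; first by rewrite invr_ge0 ltW // eta0.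
    have -> : C' * Q z ^+ j = C * Q z ^+ j / T ^+ n.+2 by rewrite /C' mulrAC.
    apply: ler_wpM2l => //.
    rewrite lef_pV2 ?posrE; [exact: etaT|exact: eta0|exact: exprn_gt0].
  have rQ : r0 < Q z.
    have := normM_le_dot z.2; rewrite /Q; nra.
  have q0 : 0 < Q z ^+ j by rewrite exprn_gt0 // (lt_le_trans ltr01).
  have thQ : C' < theta * (Q z * Q z).
    have : C' < theta * Q z.
      by move: rQ; rewrite /r0 -ltrBrDl ltr_pdivrMr //; lra.
    have : theta * Q z <= theta * (Q z * Q z).
      by rewrite ler_wpM2l ?(ltW th0) // ler_peMl // (le_trans ler01).
    lra.
  have : C' * Q z ^+ j < theta * Q z ^+ j.+2.
    by rewrite !exprS; have := thQ; rewrite -(ltr_pM2r q0); lra.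
  by rewrite /Th; lra.
have cA := @box_compact R k T 0 (r0 + T).
have inA z : strip T z -> `|z.2| <= r0 -> box T 0 (r0 + T) z.
  move=> Tz hz; split=> //; rewrite subr0 prod_norm_le; apply/andP; split.
    by case: Tz; rewrite /= in_itv /= => /andP[t0 tT] _; rewrite ger0_norm //; lra.
  by apply: le_trans hz _; rewrite lerDl ltW.
have cTh l : {within box T 0 (r0 + T), continuous (Th l)}.
  have c1 := @within_box R k T _ _ 0 (r0 + T) (cD l).
  have c2 : {within box T 0 (r0 + T), continuous eta}.
    have -> : eta = fun z => ev ((tdecay k T) ^+ n.+2) (stcol 1 z).
      by apply/funext => -[t x]; rewrite evXn ev_tdecay.
    exact: within_box (@ev_stcol_within R k T _).
  have c3 : {within box T 0 (r0 + T), continuous (fun z => Q z ^+ j.+2)}.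
    have -> : (fun z => Q z ^+ j.+2) = fun z => ev (xsq1 R k ^+ j.+2) (stcol 1 z).
      by apply/funext => -[t x]; rewrite evXn ev_xsq1.
    exact: within_box (@ev_stcol_within R k T _).
  have c4 : {within box T 0 (r0 + T), continuous (fun z => D l z / eta z)}.
    by apply: (@continuous_within_div spacetime) => // y [Ty _]; rewrite gt_eqF // eta0.
  have -> : Th l = fun z => 1 * (D l z / eta z) + (- theta) * Q z ^+ j.+2.
    by apply/funext => z; rewrite /Th; ring.
  by move=> z; have := @continuous_lincomb R (subspace (box T 0 (r0 + T) : set spacetime)) _ _
    1 (- theta) z (@c4 z) (@c3 z).
have Az1 : box T 0 (r0 + T) z1.
  apply: inA => //; rewrite leNgt; apply/negP => /(far l1 _ Tz1).
  move: D1; rewrite bE add0r (ThD l1 _ Tz1) ltr_pM2l ?eta0 //; lra.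
have Th1 : 0 < Th l1 z1.
  by move: D1; rewrite bE add0r (ThD l1 _ Tz1) ltr_pM2l ?eta0 //; lra.
have mx l : exists c, box T 0 (r0 + T) c /\ forall z, box T 0 (r0 + T) z -> Th l z <= Th l c.
  have [|c] := @compact_EVT_max _ _ (Th l) _ _ cA (cTh l); first by exists z1.
  by rewrite inE => Ac hc; exists c; split=> // z Az; apply: hc; rewrite inE.
have [c hc] := choice mx.
pose i := [arg max_(i > l1) Th i (c i)]%O.
have imax l : Th l (c l) <= Th i (c i).
  by rewrite /i; case: arg_maxP => // i' _ hi'; exact: hi'.
have M0 : 0 < Th i (c i).
  by apply: lt_le_trans Th1 _; apply: le_trans (imax l1); exact: (hc l1).2.
exists (Th i (c i)), i, (c i); split=> //; first by case: (hc i) => -[].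
  by rewrite bE -ThD //; case: (hc i) => -[].
move=> l z Tz; rewrite bE (ThD l z Tz) ler_wpM2l ?(ltW (eta0 z Tz)) // lerD2r.
have [hz|hz] := leP `|z.2| r0; last by apply: ltW; exact: lt_trans (far l z Tz hz) M0.
by apply: le_trans (imax l); apply: (hc l).2; exact: inA.
Qed.

End Comparison.

(** The coordinates are replaced one at a time; at i, where F is not assumed monotone, both vectors
    agree and nothing changes. *)
Lemma monotone_coordinates (R : realType) m (F : 'cV[R]_m -> R) (i : 'I_m) :
  (forall l (y y' : 'cV[R]_m), l != i -> (forall j, j != l -> y j 0 = y' j 0) -> y l 0 <= y' l 0 ->
    F y <= F y') ->
  forall y y' : 'cV[R]_m, (forall l, y l 0 <= y' l 0) -> y i 0 = y' i 0 -> F y <= F y'.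
Proof.
move=> mono y y' yy' yi.
pose Y (s : seq 'I_m) : 'cV[R]_m := \col_l (if l \in s then y' l 0 else y l 0).
have H s : F y <= F (Y s).
  elim: s => [|l s IH].
    have -> : Y [::] = y by apply/colP => l; rewrite mxE.
    exact: lexx.
  apply: le_trans IH _; have [li|li] := eqVneq l i.
    have -> : Y (l :: s) = Y s; last exact: lexx.
    apply/colP => a; rewrite !mxE in_cons; have [->|//] := eqVneq a l.
    by rewrite li yi if_same.
  apply: (mono l) => // [a al|]; first by rewrite !mxE in_cons (negbTE al).
  by rewrite !mxE in_cons eqxx /=; case: ifP.
have -> : y' = Y (enum 'I_m) by apply/colP => l; rewrite mxE mem_enum.
exact: H.
Qed.

Lemma joint_cont_lip (R : realType) k (T : R) (W W' : normedModType R) (L : W -> W') c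
    (F : R * 'cV[R]_k -> 'cV[R]_k -> W) z q : 0 <= c ->
  (forall x y, `|L x - L y| <= c * `|x - y|) -> joint_cont T F z q ->
  joint_cont T (fun z q => L (F z q)) z q.
Proof.
move=> c0 lipL cF e e0; have c1 : 0 < 1 + c by rewrite ltr_wpDr.
have [r r0 hr] := cF _ (divr_gt0 e0 c1); exists r => // z' q' Tz' zz' qq'.
have := hr _ _ Tz' zz' qq'; rewrite ler_pdivlMr // => h.
apply: le_trans (lipL _ _) _; have := normr_ge0 (F z' q' - F z q); lra.
Qed.

(** * The linearized inequality at a contact point *)

Section Contact.
Variables (R : realType) (k d m : nat) (T : R).
Local Notation spacetime := (R * 'cV[R]_k)%type.
Variables (b : spacetime -> 'cV[R]_k) (sigma : spacetime -> 'M[R]_(k, d)).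
Variable f : 'I_m -> spacetime -> 'cV[R]_m -> 'cV[R]_d -> R.
Variable g : 'I_m -> 'I_m -> spacetime -> R.
Variable h : 'I_m -> 'cV[R]_k -> R.
Variables (C Cf : R).
Hypothesis b_cont : {within strip T, continuous b}.
Hypothesis sigma_cont : {within strip T, continuous sigma}.
Hypothesis C_ge0 : 0 <= C.
Hypothesis lip : forall (t : R) x x', t \in `[0, T] ->
  enorm (b (t, x) - b (t, x')) + enorm (sigma (t, x) - sigma (t, x')) <= C * enorm (x - x').
Hypothesis f_cont : forall i, continuous_unif_param T
  (fun tx (yz : 'cV[R]_m * 'cV[R]_d) => f i tx yz.1 yz.2).
Hypothesis Cf_ge0 : 0 <= Cf.
Hypothesis f_lip : forall i (t : R) x (y y' : 'cV[R]_m) z z', t \in `[0, T] ->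
  `|f i (t, x) y z - f i (t, x) y' z'| <= Cf * (\sum_(l < m) `|y l 0 - y' l 0| + enorm (z - z')).
Hypothesis f_mono : forall i l, l != i -> forall (t : R) x (y y' : 'cV[R]_m) z,
  t \in `[0, T] -> (forall j, j != l -> y j 0 = y' j 0) -> y l 0 <= y' l 0 ->
  f i (t, x) y z <= f i (t, x) y' z.
Hypothesis g_cont : forall i j, i != j -> {within strip T, continuous (g i j)}.
Implicit Types (v w : 'I_m -> spacetime -> R) (z : spacetime).

Lemma f_lip_norm i z (y y' : 'cV[R]_m) zeta zeta' : strip T z ->
  `|f i z y zeta - f i z y' zeta'| <= Cf * (m%:R * `|y - y'| + enorm (zeta - zeta')).
Proof.
case: z => t x [tT _]; apply: le_trans (f_lip i x y y' zeta zeta' tT) _.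
rewrite ler_wpM2l // lerD2r; have -> : m%:R * `|y - y'| = \sum_(l < m) `|y - y'|.
  by rewrite sumr_const card_ord mulr_natl.
by apply: ler_sum => l _; have := coord_le_norm (y - y') l 0; rewrite !mxE.
Qed.

(** The radius is uniform in [y] and [zeta]: the slopes produced by doubling are not bounded in
    advance. *)
Lemma f_near i z (e : R) : strip T z -> 0 < e -> exists2 r : R, 0 < r &
  forall z' y zeta, strip T z' -> `|z' - z| < r -> `|f i z' y zeta - f i z y zeta| < e.
Proof.
move=> Tz e0; have /(@near_within_norm _ spacetime)[r r0 hr] := f_cont i Tz e0.
by exists r => // z' y zeta Tz' zz'; exact: (hr z' Tz' zz' (y, zeta)).
Qed.

Lemma joint_cont_col v z q : (forall i, {within strip T, continuous (v i)}) -> strip T z ->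
  joint_cont T (fun z _ => \col_j v j z : 'cV[R]_m) z q.
Proof.
move=> cv Tz; apply: joint_cont_coord => i j e e0.
have [r r0 hr] := joint_cont_z q (cv i) Tz e0.
by exists r => // z' q' Tz' zz' qq'; rewrite !mxE; exact: (hr z' q').
Qed.

Lemma joint_cont_f i (Y : spacetime -> 'cV[R]_m) (Z : spacetime -> 'cV[R]_k -> 'cV[R]_d) z q :
  strip T z -> joint_cont T (fun z _ => Y z) z q -> joint_cont T Z z q ->
  joint_cont T (fun z q => f i z (Y z) (Z z q) : R) z q.
Proof.
move=> Tz cY cZ e e0; have e2 : 0 < e / 2 by rewrite divr_gt0.
have [r1 r10 h1] := f_near i Tz e2.
pose D := 1 + Cf * (m%:R + (1 + (d * 1)%:R)).
have D0 : 0 < D by rewrite ltr_wpDr // mulr_ge0 // addr_ge0.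
have e3 : 0 < e / 2 / D by rewrite divr_gt0.
have [r2 r20 h2] := cY _ e3; have [r3 r30 h3] := cZ _ e3.
exists (Num.min r1 (Num.min r2 r3)) => [|z' q' Tz']; first by rewrite !lt_min r10 r20.
rewrite !lt_min => /and3P[z1 z2 z3] /and3P[q1 q2 q3].
have a1 := h1 z' (Y z') (Z z' q') Tz' z1.
have a2 := h2 z' q' Tz' z2 q2; have a3 := h3 z' q' Tz' z3 q3.
have a4 := f_lip_norm i (Y z') (Y z) (Z z' q') (Z z q) Tz.
have a5 := enorm_le_norm (Z z' q' - Z z q).
have -> : f i z' (Y z') (Z z' q') - f i z (Y z) (Z z q) =
  (f i z' (Y z') (Z z' q') - f i z (Y z') (Z z' q')) +
  (f i z (Y z') (Z z' q') - f i z (Y z) (Z z q)) by rewrite addrA subrK.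
apply: le_trans (ler_normD _ _) _; rewrite (splitr e) lerD ?(ltW a1) //.
apply: le_trans a4 _; set E := e / 2 in e2 e3 a2 a3 *.
have b1 : m%:R * `|Y z' - Y z| <= m%:R * (E / D) by rewrite ler_wpM2l.
have b2 : (1 + (d * 1)%:R) * `|Z z' q' - Z z q| <= (1 + (d * 1)%:R) * (E / D).
  by rewrite ler_wpM2l // addr_ge0.
apply: (@le_trans _ _ ((Cf * (m%:R + (1 + (d * 1)%:R))) * (E / D))).
  by rewrite -mulrA ler_wpM2l // mulrDl; lra.
by rewrite mulrA ler_pdivrMr // mulrC ler_pM2l // /D lerDr.
Qed.

Section Doubling.
Variables (v w : 'I_m -> spacetime -> R) (P : mpoly (1 + k) R).
Hypothesis subv : viscosity_subsolution T b sigma f g h v.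
Hypothesis supw : viscosity_supersolution T b sigma f g h w.
Hypothesis cv : forall i, {within strip T, continuous (v i)}.
Hypothesis cw : forall i, {within strip T, continuous (w i)}.

Let phi z : R := ev P (stcol 1 z).
Let phit z := tpart (grad P (stcol 1 z)).
Let phix z := dsubmx (grad P (stcol 1 z)).
Let phixx z := drsubmx (hess P (stcol 1 z)).

Let V z : 'cV[R]_m := \col_j v j z.
Let W z : 'cV[R]_m := \col_j w j z.

(** [F1] is written for jets of v i - phi, to which the jet of phi is added back; [F2] for jets of -
    w i, hence the slope -q inside f. *)
Let F1 i z q := phit z + 2^-1 * \tr (sigma z *m (sigma z)^T *m phixx z)
  + dot (b z) (q + phix z) + f i z (V z) ((sigma z)^T *m (q + phix z)).
Let F2 i z q := dot (b z) q - f i z (W z) ((sigma z)^T *m (- q)).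

Let psub1 i z : strip T z -> z.1 < T -> (forall j, j != i -> v j z - g i j z < v i z) ->
  psub T sigma (F1 i) (fun z => v i z - phi z) z.
Proof.
move=> Tz zT obs p q M Ms J.
have := psuperj_add J (ptaylor_ev P z); rewrite -/(phit z) -/(phix z) -/(phixx z) => J'.
have Ms' : (M + phixx z)^T = M + phixx z.
  by rewrite linearD /= Ms /phixx trmx_drsub hess_sym.
have tT : 0 <= z.1 < T.
  by rewrite zT andbT; move: Tz.1; rewrite /= in_itv /= => /andP[].
have [_ sub _] := subv.
have := limiting_superjet_superjet (psuperj_superjet Tz Ms' J').
rewrite {1}[z]surjective_pairing => /(sub i _ _ _ tT).
rewrite -surjective_pairing => /(system_op_le0 obs).
rewrite /pde_op /F1 mulmxDr mxtraceD; lra.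
Qed.

Let psub2 i z : strip T z -> z.1 < T -> psub T sigma (F2 i) (fun z => - w i z) z.
Proof.
move=> Tz zT p q M Ms J.
have tT : 0 <= z.1 < T.
  by rewrite zT andbT; move: Tz.1; rewrite /= in_itv /= => /andP[].
have [_ sup _] := supw.
have := psuperjN_limiting_subjet Tz Ms J; rewrite {1}[z]surjective_pairing.
move=> /(sup i _ _ _ tT) /system_op_ge0 [_]; rewrite -surjective_pairing.
rewrite /pde_op /F2 mulmxN [\tr (- _)]raddfN !dotlin; lra.
Qed.

Let cphit z q : strip T z -> joint_cont T (fun z _ => phit z : R) z q.
Proof.
move=> /(joint_cont_grad P q); apply: (joint_cont_lip ler01) => x y.
by rewrite -tpartB mul1r; case: (tpart_norm (x - y)).
Qed.

Let cphix z q : strip T z -> joint_cont T (fun z _ => phix z) z q.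
Proof.
move=> /(joint_cont_grad P q); apply: (joint_cont_lip ler01) => x y.
by rewrite -linearB mul1r; case: (tpart_norm (x - y)).
Qed.

Let cphixx z q : strip T z -> joint_cont T (fun z _ => phixx z) z q.
Proof.
move=> /(joint_cont_hess P q); apply: (joint_cont_lip ler01) => X Y.
rewrite mul1r; apply: norm_le_coord => // i j.
have := coord_le_norm (X - Y) (rshift 1 i) (rshift 1 j).
by rewrite !mxE.
Qed.

Let csigmaT z q : strip T z -> joint_cont T (fun z _ => (sigma z)^T) z q.
Proof.
move=> /(joint_cont_z q sigma_cont); apply: (joint_cont_lip ler01) => X Y.
by rewrite -linearB mul1r norm_trmx.
Qed.

Let ctrace z q : strip T z ->
  joint_cont T (fun z _ => phit z + 2^-1 * \tr (sigma z *m (sigma z)^T *m phixx z) : R) z q.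
Proof.
move=> Tz; apply: joint_contD (cphit _ Tz) _; apply: (joint_contZ (W := R)).
have k0 : 0 <= k%:R :> R by [].
apply: (joint_cont_lip k0) => [X Y|]; first by rewrite -linearB; exact: mxtrace_norm.
apply: joint_cont_mulmx (cphixx _ Tz); apply: joint_cont_mulmx (csigmaT _ Tz).
exact: joint_cont_z.
Qed.

Let cF1 i z q : strip T z -> first_order_cont T (F1 i) z q.
Proof.
move=> Tz; have cq := joint_contD (@joint_cont_q R k T z q) (cphix q Tz).
apply: (joint_contD (W := R)).
  by apply: joint_contD (ctrace _ Tz) (joint_cont_dot _ cq); exact: joint_cont_z.
by apply: joint_cont_f (joint_cont_col _ cv Tz) _; [|exact: joint_cont_mulmx (csigmaT _ Tz) cq].
Qed.

Let cF2 i z q : strip T z -> first_order_cont T (F2 i) z q.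
Proof.
move=> Tz; have cq := @joint_cont_q R k T z q.
apply: (joint_contD (W := R)); first by apply: joint_cont_dot cq; exact: joint_cont_z.
apply: (joint_contN (W := R)); apply: joint_cont_f (joint_cont_col _ cw Tz) _ => //.
exact: joint_cont_mulmx (csigmaT _ Tz) (joint_contN cq).
Qed.

Let obstacle_near z0 i : strip T z0 -> (forall j, j != i -> v j z0 - g i j z0 < v i z0) ->
  exists2 r : R, 0 < r & forall z, strip T z -> `|z - z0| < r ->
    forall j, j != i -> v j z - g i j z < v i z.
Proof.
move=> Tz0 obs; have [|j|r r0 hr] := @finite_radius R 'I_m (fun j r => j != i ->
    forall z, strip T z -> `|z - z0| < r -> v j z - g i j z < v i z).
- by move=> j r s _ sr H ji z Tz zs; apply: H => //; exact: lt_le_trans sr.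
- have [->|ji] := eqVneq j i; first by exists 1.
  have e0 : 0 < (v i z0 - (v j z0 - g i j z0)) / 2 by rewrite divr_gt0 // subr_gt0 obs.
  have ij : i != j by rewrite eq_sym.
  have c := joint_contD (joint_contD (joint_cont_z 0 (@cv j) Tz0)
    (joint_contN (joint_cont_z 0 (@g_cont _ _ ij) Tz0))) (joint_contN (joint_cont_z 0 (@cv i) Tz0)).
  have [r r0 hr] := c _ e0; exists r => // _ z Tz zr.
  have := hr z 0 Tz zr; rewrite subrr normr0 => /(_ r0); rewrite ler_norml => /andP[_]; lra.
by exists r => // z Tz zr j ji; exact: hr.
Qed.

(** Subtract the two differential inequalities at the doubled points. Since v <= w + phi with
    equality at i, monotonicity in the other components gives f_i(v) <= f_i(w + phi), and the
    Lipschitz bound turns the difference to f_i(w) into Cf m phi plus Cf times the difference of the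
    z-arguments, which is sigma^T D phi up to small errors. *)
Lemma contact_inequality z0 i : strip T z0 -> z0.1 < T ->
  (forall l z, strip T z -> v l z <= w l z + phi z) -> v i z0 = w i z0 + phi z0 ->
  0 <= phi z0 -> (forall j, j != i -> v j z0 - g i j z0 < v i z0) ->
  0 <= phit z0 + 2^-1 * \tr (sigma z0 *m (sigma z0)^T *m phixx z0)
    + dot (b z0) (phix z0) + Cf * enorm ((sigma z0)^T *m phix z0) + Cf * m%:R * phi z0.
Proof.
move=> Tz0 z0T le eq0 phi0 obs; pose A z := phit z + 2^-1 * \tr (sigma z *m (sigma z)^T *m phixx z)
    + dot (b z) (phix z) + Cf * enorm ((sigma z)^T *m phix z).
rewrite -/(A z0) leNgt; apply/negP => neg.
(* The gap is 8 [e1]; the errors add up to 6 [e1]: one from A, two from f in (t, x), one each from v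
   and w, and one from doubling. *)
pose e1 := - (A z0 + Cf * m%:R * phi z0) / 8.
have e10 : 0 < e1 by rewrite divr_gt0 // oppr_gt0.
have [r1 r10 h1] : exists2 r : R, 0 < r & forall z, strip T z -> `|z - z0| < r -> A z <= A z0 + e1.
  have cx := cphix 0 Tz0.
  have cA : joint_cont T (fun z _ => A z : R) z0 0.
    apply: (joint_contD (W := R)).
      by apply: joint_contD (ctrace _ Tz0) (joint_cont_dot _ cx); exact: joint_cont_z.
    apply: (joint_contZ (W := R)); apply: joint_cont_enorm.
    exact: joint_cont_mulmx (csigmaT _ Tz0) cx.
  have [r r0 hr] := cA _ e10; exists r => // z Tz zr.
  have := hr z 0 Tz zr; rewrite subrr normr0 => /(_ r0); rewrite ler_norml => /andP[_]; lra.
have near_norm (W' : normedModType R) (F : spacetime -> W') (e : R) : 0 < e ->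
    joint_cont T (fun z _ => F z) z0 0 ->
    exists2 r : R, 0 < r & forall z, strip T z -> `|z - z0| < r -> `|F z - F z0| <= e.
  move=> e0 /(_ e e0)[r r0 hr]; exists r => // z Tz zr.
  by have := hr z 0 Tz zr; rewrite subrr normr0 => /(_ r0).
have Cm0 : 0 < 1 + Cf * m%:R by rewrite ltr_wpDr // mulr_ge0.
have [r2 r20 h2] := near_norm _ _ _ (divr_gt0 e10 Cm0) (joint_cont_col 0 cv Tz0).
have [r3 r30 h3] := near_norm _ _ _ (divr_gt0 e10 Cm0) (joint_cont_col 0 cw Tz0).
have [r4 r40 h4] := near_norm _ _ _ ltr01 (joint_cont_enorm (joint_cont_z 0 b_cont Tz0)).
have [r5 r50 h5] := near_norm _ _ _ ltr01 (joint_cont_enorm (joint_cont_z 0 sigma_cont Tz0)).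
have [r6 r60 h6] := f_near i Tz0 e10.
have [r7 r70 h7] := obstacle_near Tz0 obs.
have [r8 r80 h8] := strip_below_near z0T.
(* The total coefficient of [e] in the doubling errors. *)
pose B := 3 + enorm (b z0) + Cf * (2 + enorm (sigma z0)).
have B0 : 0 < B by rewrite ltr_wpDr ?mulr_ge0 ?addr_ge0 ?enorm_ge0 // ltr_wpDr // enorm_ge0.
pose e := Num.min (e1 / B) (Num.min r1 (Num.min r2 (Num.min r3 (Num.min r4 (Num.min r5 r6))))).
have e0 : 0 < e by rewrite !lt_min divr_gt0 // r10 r20 r30 r40 r50.
have r780 : 0 < Num.min r7 r8 by rewrite lt_min r70.
have cphi : {within strip T, continuous phi} by exact: ev_stcol_within.
have cu : {within strip T, continuous (fun z => v i z - phi z)}.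
  have -> : (fun z => v i z - phi z) = fun z => 1 * v i z + (-1) * phi z.
    by apply/funext => z; rewrite mul1r mulN1r.
  by move=> z; have := @continuous_lincomb R (subspace (strip T : set spacetime)) _ _
    1 (-1) z (@cv i z) (@cphi z).
have [||||||z [z' [q [r [Tz Tz' ze z'e [re sq bq ineq]]]]]] :=
    @local_comparison R k d T sigma b C sigma_cont b_cont C_ge0 lip _ _ (F1 i) (F2 i)
    z0 _ Tz0 r780 cu (@cw i) _ _ _ _ _ _ e e0.
- by move=> z Tz _; rewrite lerBlDr; exact: le.
- by rewrite eq0 addrK.
- by move=> z Tz; rewrite lt_min => /andP[zr7 zr8]; apply: psub1 => //; [exact: h8|exact: h7].
- by move=> z Tz; rewrite lt_min => /andP[zr7 zr8]; apply: psub2 => //; exact: h8.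
- by move=> z q Tz _; exact: cF1.
- by move=> z q Tz _; exact: cF2.
have eB : e * B <= e1 by rewrite -ler_pdivlMr // ge_min lexx.
move: (ze) (z'e); rewrite !lt_min => /and3P[_ z1 /and5P[z2 _ z4 z5 z6]].
move=> /and3P[_ _ /and5P[_ z'3 _ _ z'6]].
have {}h1 := h1 z Tz z1; have {}h2 := h2 z Tz z2; have {}h3 := h3 z' Tz' z'3.
have {}h4 := h4 z Tz z4; have {}h5 := h5 z Tz z5.
pose zeta := (sigma z)^T *m (q + r + phix z); pose zeta' := (sigma z')^T *m q.
have {ineq} : 0 <= A z - Cf * enorm ((sigma z)^T *m phix z) + dot (b z) (q + r) - dot (b z') q
    + f i z (V z) zeta - f i z' (W z') zeta' + e.
  by move: ineq; rewrite /F1 /F2 /A opprK !dotlin -/zeta -/zeta'; lra.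
have fz := h6 z (V z) zeta Tz z6; have fz' := h6 z' (W z') zeta' Tz' z'6.
have fV := f_lip_norm i (V z) (V z0) zeta zeta Tz0.
have fW := f_lip_norm i (W z') (W z0) zeta' zeta' Tz0.
(* Lies above v in every component and meets it in component i. *)
pose Y : 'cV[R]_m := \col_l (w l z0 + phi z0).
have fY := f_lip_norm i Y (W z0) zeta zeta' Tz0.
have fVY : f i z0 (V z0) zeta <= f i z0 Y zeta.
  apply: (@monotone_coordinates R m (fun y => f i z0 y zeta) i) => [l y y' li yy' yl|l|].
  - by case: (z0) Tz0 => t x [tT _]; exact: (f_mono li).
  - by rewrite !mxE; exact: le.
  - by rewrite !mxE eq0.
have YW : `|Y - W z0| <= phi z0.
  by apply: norm_le_coord => // l j; rewrite !mxE addrC addKr ger0_norm.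
have bq' : dot (b z) q - dot (b z') q <= e.
  have -> : dot (b z) q - dot (b z') q = dot (b z - b z') q by rewrite !dotlin.
  apply: le_trans (ler_norm _) _; apply: le_trans (dot_enorm _ _) _.
  by rewrite mulrC.
have br : dot (b z) r <= (1 + enorm (b z0)) * e.
  apply: le_trans (ler_norm _) _; apply: le_trans (dot_enorm _ _) _.
  apply: ler_pM => //; rewrite ?enorm_ge0 //.
  by rewrite -lerBlDr (le_trans (ler_norm _)).
have zz : enorm (zeta - zeta') <= e + (1 + enorm (sigma z0)) * e + enorm ((sigma z)^T *m phix z).
  have -> : zeta - zeta' = (sigma z - sigma z')^T *m q + (sigma z)^T *m r + (sigma z)^T *m phix z.
    rewrite /zeta /zeta' linearB /= mulmxBl !mulmxDr -!addrA; congr (_ + _).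
    by rewrite [RHS]addrC -!addrA.
  apply: le_trans (enormD _ _) _; rewrite lerD2r; apply: le_trans (enormD _ _) _.
  apply: lerD; apply: le_trans (enorm_mulmx _ _) _; rewrite enorm_tr.
    by rewrite mulrC.
  apply: ler_pM => //; rewrite ?enorm_ge0 //.
  by rewrite -lerBlDr (le_trans (ler_norm _)).
have enorm0 : enorm (0 : 'cV[R]_d) = 0 by rewrite -(scale0r 0) enormZ normr0 mul0r.
have lipm (x : R) : x <= e1 / (1 + Cf * m%:R) -> Cf * (m%:R * x) <= e1.
  move=> hx; apply: le_trans (_ : (1 + Cf * m%:R) * (e1 / (1 + Cf * m%:R)) <= _).
    rewrite mulrA; apply: le_trans (ler_wpM2l _ hx) _; first by rewrite mulr_ge0.
    by rewrite ler_wpM2r ?lerDr // divr_ge0 ?ltW.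
  by rewrite mulrC divfK // gt_eqF.
have lV := lipm _ h2; have lW := lipm _ h3.
have lY : Cf * (m%:R * `|Y - W z0|) <= Cf * m%:R * phi z0.
  by rewrite -mulrA ler_wpM2l // ler_wpM2l.
have lz := ler_wpM2l Cf_ge0 zz.
have e1E : A z0 + Cf * m%:R * phi z0 = - (8 * e1) by rewrite /e1; field.
move: eB; rewrite /B.
move: fV fW fY fz fz'; rewrite !subrr enorm0 !addr0 dotDr ![Cf * (_ + enorm (zeta - zeta'))]mulrDr.
rewrite !ltr_norml !ler_norml => /andP[fV1 fV2] /andP[fW1 fW2] /andP[fY1 fY2].
move=> /andP[fz1 fz2] /andP[fz1' fz2'] eB.
move: lz e1E e10 lV lW lY h1 bq' br; clear -fV1 fV2 fW1 fW2 fY1 fY2 fz1 fz2 fz1' fz2' eB fVY e0.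
lra.
Qed.
End Doubling.
End Contact.

(** * Comparison of sub- and supersolutions *)

Section ComparisonPrinciple.
Variables (R : realType) (T : R) (k d m : nat).
Local Notation spacetime := (R * 'cV[R]_k)%type.
Variables (b : spacetime -> 'cV[R]_k) (sigma : spacetime -> 'M[R]_(k, d)).
Variable f : 'I_m -> spacetime -> 'cV[R]_m -> 'cV[R]_d -> R.
Variable g : 'I_m -> 'I_m -> spacetime -> R.
Variable h : 'I_m -> 'cV[R]_k -> R.
Hypothesis T_gt0 : 0 < T.
Hypothesis b_cont : {within strip T, continuous b}.
Hypothesis sigma_cont : {within strip T, continuous sigma}.
Hypothesis b_sigma_lip : exists C : R, [/\ 0 <= C,
  forall (t : R) x, t \in `[0, T] ->
    enorm (b (t, x)) + enorm (sigma (t, x)) <= C * (1 + enorm x) &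
  forall (t : R) x x', t \in `[0, T] ->
    enorm (b (t, x) - b (t, x')) + enorm (sigma (t, x) - sigma (t, x')) <= C * enorm (x - x')].
Hypothesis f_cont : forall i, continuous_unif_param T
  (fun tx (yz : 'cV[R]_m * 'cV[R]_d) => f i tx yz.1 yz.2).
Hypothesis f_lip : forall i, exists C : R, 0 <= C /\
  forall (t : R) x (y y' : 'cV[R]_m) z z', t \in `[0, T] ->
    `|f i (t, x) y z - f i (t, x) y' z'| <= C * (\sum_(l < m) `|y l 0 - y' l 0| + enorm (z - z')).
Hypothesis f_mono : forall i l, l != i -> forall (t : R) x (y y' : 'cV[R]_m) z,
  t \in `[0, T] -> (forall j, j != l -> y j 0 = y' j 0) -> y l 0 <= y' l 0 ->
  f i (t, x) y z <= f i (t, x) y' z.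
Hypothesis g_cont : forall i j, i != j -> {within strip T, continuous (g i j)}.
Hypothesis g_no_free_loop : forall (t : R) x, t \in `[0, T] ->
  forall (N : nat) (c : nat -> 'I_m), (3 <= N)%N -> c 1%N = c N ->
    #|[seq c n | n <- iota 1 N]| = N.-1 ->
    0 < \sum_(1 <= n < N) g (c n) (c n.+1) (t, x).

Lemma comparison (v w : 'I_m -> spacetime -> R) :
  viscosity_subsolution T b sigma f g h v -> viscosity_supersolution T b sigma f g h w ->
  (forall i, {within strip T, continuous (v i)}) ->
  (forall i, {within strip T, continuous (w i)}) ->
  (forall i, poly_growth_strip T (v i)) -> (forall i, poly_growth_strip T (w i)) ->
  forall i z, strip T z -> v i z <= w i z.
Proof.
move=> subv supw cv cw gv gw i1 z1 Tz1; rewrite leNgt; apply/negP => gap.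
have [C [C0 lin lip]] := b_sigma_lip.
have [cf hcf] := choice f_lip; pose Cf := \sum_i cf i.
have Cf0 : 0 <= Cf by rewrite sumr_ge0 // => i _; case: (hcf i).
have lipf i t x (y y' : 'cV[R]_m) z z' : t \in `[0, T] ->
    `|f i (t, x) y z - f i (t, x) y' z'| <= Cf * (\sum_(l < m) `|y l 0 - y' l 0| + enorm (z - z')).
  move=> tT; apply: le_trans ((hcf i).2 t x y y' z z' tT) _.
  rewrite ler_wpM2r ?addr_ge0 ?enorm_ge0 ?sumr_ge0 //.
  by rewrite /Cf (bigD1 i) //= lerDl sumr_ge0 // => l _; case: (hcf l).
pose D l z := v l z - w l z.
have cD l : {within strip T, continuous (D l)}.
  have -> : D l = fun z => 1 * v l z + (-1) * w l z.
    by apply/funext => z; rewrite mul1r mulN1r.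
  by move=> z; have := @continuous_lincomb R (subspace (strip T : set spacetime)) _ _
    1 (-1) z (@cv l z) (@cw l z).
have [G [j [G0 hG]]] : exists (G : R) (j : nat), 0 <= G /\ forall l z, strip T z ->
    `|D l z| <= G * (1 + dot z.2 z.2) ^+ j.
  have [cG hG] := choice (fun l => poly_growth_pow (gv l)).
  have [jv {}hG] := choice hG.
  have [cG' hG'] := choice (fun l => poly_growth_pow (gw l)).
  have [jw {}hG'] := choice hG'.
  have GG l : 0 <= cG l + cG' l by rewrite addr_ge0 //; [case: (hG l)|case: (hG' l)].
  exists (\sum_l (cG l + cG' l)), (\sum_l (jv l + jw l))%N.
  split=> [|l z Tz]; first by rewrite sumr_ge0.
  have Q0 : 0 <= (1 + dot z.2 z.2) ^+ (\sum_l (jv l + jw l))%N.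
    by rewrite exprn_ge0 // addr_ge0 // dot_ge0.
  apply: (@le_trans _ _ ((cG l + cG' l) * (1 + dot z.2 z.2) ^+ (\sum_l (jv l + jw l))%N)).
    rewrite mulrDl; apply: le_trans (ler_normB _ _) _; apply: lerD.
      by apply: (hG l).2 => //; rewrite (bigD1 l) //= -addnA leq_addr.
    by apply: (hG' l).2 => //; rewrite (bigD1 l) //= (addnC (jv l)) -addnA leq_addr.
  by rewrite ler_wpM2r // (bigD1 l) //= lerDl sumr_ge0.
(* The threshold of [barrier_strict]. It depends on neither theta nor M, so n can be fixed before
   both. *)
pose K := 2 * T * (2 * C ^+ 2 * (j.+2%:R + 2 * (j.+2%:R * j.+1%:R))
  + 4 * j.+2%:R * C * (1 + Cf) + Cf * m%:R).
pose n := Num.truncn K.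
have nK : K < n.+2%:R.
  by apply: lt_trans (truncnS_gt K) _; rewrite ltr_nat.
have bE M th (z : spacetime) : ev (barrier k T n j M th) (stcol 1 z) =
    (2 * T - z.1) ^+ n.+2 * (M + th * (1 + dot z.2 z.2) ^+ j.+2).
  by case: z => t x; rewrite barrier_ev.
have eta0 (z : spacetime) : strip T z -> 0 < (2 * T - z.1) ^+ n.+2.
  move=> [+ _]; rewrite /= in_itv /= => /andP[_ zT]; rewrite exprn_gt0 //.
  by have := T_gt0; lra.
have Q0 (z : spacetime) : 0 < (1 + dot z.2 z.2) ^+ j.+2 by rewrite exprn_gt0 // ltr_wpDr // dot_ge0.
pose X := (2 * T - z1.1) ^+ n.+2 * (1 + dot z1.2 z1.2) ^+ j.+2.
have X0 : 0 < X by rewrite mulr_gt0 ?eta0.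
have D0 : 0 < D i1 z1 by rewrite subr_gt0.
(* With M = 0 the barrier at [z1] is then half the gap, so it is still exceeded there. *)
pose th := D i1 z1 / 2 / X; have th0 : 0 < th by rewrite !divr_gt0.
have [|M [i0 [z0 [M0 Tz0 eq0 Dle]]]] := barrier_max T_gt0 G0 th0 cD hG (n := n).
  exists i1, z1; split=> //; rewrite bE add0r mulrCA -/X /th divfK ?gt_eqF //.
  by rewrite ltr_pdivrMr // ltr_pMr // ltr1n.
pose P := barrier k T n j M th.
have phi0 : 0 < ev P (stcol 1 z0).
  by rewrite bE mulr_gt0 ?eta0 // addr_gt0 // mulr_gt0.
(* At time T the terminal conditions give v <= h <= w, while the barrier is positive at contact. *)
have z0T : z0.1 < T.
  have := Tz0.1; rewrite /= in_itv /= => /andP[_]; rewrite le_eqVlt => /orP[/eqP e|//].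
  have [_ _ hv] := subv; have [_ _ hw] := supw.
  move: phi0; rewrite -eq0 /D [z0]surjective_pairing e subr_gt0.
  by have := le_trans (hv i0 z0.2) (hw i0 z0.2); rewrite leNgt => /negbTE ->.
pose I l := D l z0 == ev P (stcol 1 z0).
have I0 : I i0 by apply/eqP.
have [|i Ii|i /eqP Ii obs] := @no_loop_index R m (fun i l => g i l z0) (fun i => v i z0) I i0 _ I0.
- by case: (z0) Tz0 => t x [tT _]; exact: g_no_free_loop.
- have [|/existsNP[l /not_implyP[li /negP]]] :=
    pselect (forall l, l != i -> v l z0 - g i l z0 < v i z0).
    by left.
  (* With phi the barrier at [z0]: v_l - g_il >= v_i = w_i + phi >= w_l - g_il + phi >= v_l - g_il.
     Equality throughout makes l a contact index too, with g_il = v_l - v_i. *)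
  rewrite -leNgt => vl; right; exists l; split=> //.
    have il : i != l by rewrite eq_sym.
    have := supersolution_obstacle supw (@cw i) (@cw l) (@g_cont _ _ il) Tz0 z0T li.
    have := Dle l z0 Tz0; rewrite -/P; move/eqP: Ii; rewrite /I /D => Ii Dl wl.
    by rewrite eq_le; apply/andP; split => //; lra.
  have il : i != l by rewrite eq_sym.
  have := supersolution_obstacle supw (@cw i) (@cw l) (@g_cont _ _ il) Tz0 z0T li.
  have := Dle l z0 Tz0; rewrite -/P; move/eqP: Ii; rewrite /I /D => Ii Dl wl.
  by apply/eqP; rewrite eq_le; apply/andP; split; lra.
have le l z : strip T z -> v l z <= w l z + ev P (stcol 1 z).
  by move=> /(Dle l); rewrite /D -/P; lra.
have eqi : v i z0 = w i z0 + ev P (stcol 1 z0) by rewrite -Ii /D addrC subrK.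
have := contact_inequality b_cont sigma_cont C0 lip f_cont Cf0 lipf f_mono g_cont
  subv supw cv cw Tz0 z0T le eqi (ltW phi0) obs.
apply/negP; rewrite -ltNge.
rewrite [z0]surjective_pairing.
apply: (@barrier_strict R k T n j M th z0.1 z0.2 d _ _ C Cf (Cf * m%:R)) => //.
- by move: Tz0.1; rewrite /= in_itv.
- exact: ltW.
- by rewrite mulr_ge0.
- by apply: lin; case: Tz0.
Qed.
End ComparisonPrinciple.

Theorem theorem8 (R : realType) (T : R) (k d m : nat)
  (T_gt0 : 0 < T) (k_gt0 : (0 < k)%N) (d_gt0 : (0 < d)%N) (m_gt0 : (0 < m)%N)
  (b : R * 'cV[R]_k -> 'cV[R]_k) (sigma : R * 'cV[R]_k -> 'M[R]_(k, d))
  (f : 'I_m -> R * 'cV[R]_k -> 'cV[R]_m -> 'cV[R]_d -> R)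
  (g : 'I_m -> 'I_m -> R * 'cV[R]_k -> R)
  (h : 'I_m -> 'cV[R]_k -> R)
  (b_cont : {within strip T, continuous b})
  (sigma_cont : {within strip T, continuous sigma})
  (b_sigma_lip : exists C : R, [/\ 0 <= C,
     forall (t : R) x, t \in `[0, T] ->
       enorm (b (t, x)) + enorm (sigma (t, x)) <= C * (1 + enorm x) &
     forall (t : R) x x', t \in `[0, T] ->
       enorm (b (t, x) - b (t, x')) + enorm (sigma (t, x) - sigma (t, x'))
         <= C * enorm (x - x')])
  (f_cont : forall i, continuous_unif_param T
     (fun tx (yz : 'cV[R]_m * 'cV[R]_d) => f i tx yz.1 yz.2))
  (f_lip : forall i, exists C : R, 0 <= C /\
     forall (t : R) x (y y' : 'cV[R]_m) z z', t \in `[0, T] ->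
       `|f i (t, x) y z - f i (t, x) y' z'|
         <= C * (\sum_(l < m) `|y l 0 - y' l 0| + enorm (z - z')))
  (f0_borel : forall i, borel_strip T (fun tx => f i tx 0 0))
  (f0_growth : forall i, poly_growth_strip T (fun tx => f i tx 0 0))
  (f_mono : forall i l, l != i -> forall (t : R) x (y y' : 'cV[R]_m) z, t \in `[0, T] ->
     (forall j, j != l -> y j 0 = y' j 0) -> y l 0 <= y' l 0 ->
     f i (t, x) y z <= f i (t, x) y' z)
  (g_cont : forall i j, i != j -> {within strip T, continuous (g i j)})
  (g_ge0 : forall i j, i != j ->
     forall (t : R) x, t \in `[0, T] -> 0 <= g i j (t, x))
  (g_growth : forall i j, i != j -> poly_growth_strip T (g i j))
  (g_no_free_loop : forall (t : R) x, t \in `[0, T] ->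
     forall (N : nat) (c : nat -> 'I_m), (3 <= N)%N -> c 1%N = c N ->
       #|[seq c n | n <- iota 1 N]| = N.-1 ->
       0 < \sum_(1 <= n < N) g (c n) (c n.+1) (t, x))
  (h_cont : forall i, continuous (h i))
  (h_growth : forall i, poly_growth (h i))
  (h_compat : forall i x,
     (\big[maxe/-oo]_(j < m | j != i) (h j x - g i j (T, x))%:E
        <= (h i x)%:E)%E) :
  forall v w : 'I_m -> R * 'cV[R]_k -> R,
    viscosity_solution T b sigma f g h v ->
    (forall i, poly_growth_strip T (v i)) ->
    viscosity_solution T b sigma f g h w ->
    (forall i, poly_growth_strip T (w i)) ->
    forall i (t : R) x, t \in `[0, T] -> v i (t, x) = w i (t, x).
Proof.
move=> v w [cv supv subv] gv [cw supw subw] gw i t x tT.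
have Tz : strip T (t, x) by split.
apply/le_anti/andP; split.
- exact: (comparison T_gt0 b_cont sigma_cont b_sigma_lip f_cont f_lip f_mono g_cont
    g_no_free_loop subv supw cv cw gv gw i Tz).
- exact: (comparison T_gt0 b_cont sigma_cont b_sigma_lip f_cont f_lip f_mono g_cont
    g_no_free_loop subw supv cw cv gw gv i Tz).
Qed.
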